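(* Let $K$ be a field and let $h=(1,3,3,h_3,h_4,\ldots,h_s=1)$ be a $(1,3,3)$ sequence. Then the following statements are equivalent: (i) $h$ is a complete intersection sequence; (ii) $h$ is a Gorenstein sequence; (iii) $h$ satisfies one of the following conditions: (I) $h_3\le 3$; (II) $h_3=4$ and $\Delta(h)=1$; (III) $h_3=4$, $\Delta(h)=2$, and $h$ has a unique fall by two, which is at the peak position. In this case $h$ is of the following form: $h_1=3$ and, for $0\le i\le s$ with $i\neq 1$, $$h_i=\begin{cases} i+1 & \text{for } i\le d-2,\\ d & \text{for } i=d-1,d,\ldots,d+r-1,\\ d-2 & \text{for } i=d+r,\\ h_{i-1}\text{ or }h_{i-1}-1 & \text{for } i\ge d+r+1,\end{cases}$$ for some integers $d=\max h\ge 4$ and $r\ge 0$.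
   Context: For an Artinian local $K$-algebra $(A,\mathfrak m)$ with $A/\mathfrak m\simeq K$, the Hilbert function is $\mathrm{HF}_A(t)=\dim_K \mathfrak m^t/\mathfrak m^{t+1}$, written as a vector $h=(h_0,h_1,\ldots,h_s)$, where $s$ is the socle degree, i.e. the largest $j$ with $\mathfrak m^j\ne 0$. An O-sequence is a sequence satisfying Macaulay's bound, i.e. a Hilbert function of a standard graded $K$-algebra. A $(1,3,3)$ sequence is an O-sequence of the form $(1,3,3,h_3,h_4,\ldots,h_s=1)$ (and $h_i=0$ for $i>s$). An O-sequence is a complete intersection (resp. Gorenstein) sequence if it is the Hilbert function of some Artinian local complete intersection (resp. Gorenstein) $K$-algebra $(A,\mathfrak m)$ with $A/\mathfrak m\simeq K$. Notation: $\max h=\max\{h_i: i\ge 0\}$ and $\Delta(h)=\max\{|h_i-h_{i-1}| : i=3,\ldots,s\}$. The sequence $h$ has a fall by $m$ at $i$ if $h_{i+1}=h_i-m$. Every $(1,3,3)$ sequence is unimodal with $h_3\le 4$; the peak position of $h$ is the smallest $t$ such that $h_{t+1}<h_t$. *)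

(* Defs.v *)
From HB Require Import structures.
From mathcomp Require Import all_boot all_order all_algebra.
From mathcomp Require Import boolp classical_sets.
From mathcomp.multinomials Require Import mpoly.

Set Implicit Arguments.
Unset Strict Implicit.
Unset Printing Implicit Defensive.

Import GRing.Theory.
Local Open Scope ring_scope.
Local Open Scope classical_set_scope.

(* R[[x_1, ..., x_n]], a series being its family of coefficients. *)
Definition mseries (n : nat) (R : comNzRingType) : Type := 'X_{1..n} -> R.

HB.instance Definition _ n R := gen_eqMixin (mseries n R).
HB.instance Definition _ n R := gen_choiceMixin (mseries n R).

Section Series.
Context (n : nat) (R : comNzRingType).
Implicit Types (f g h : mseries n R) (a b : R) (m : 'X_{1..n}).

Definition series0 : mseries n R := fun=> 0.
Definition series_opp f : mseries n R := fun m => - f m.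
Definition series_add f g : mseries n R := fun m => f m + g m.
Definition series_scale a f : mseries n R := fun m => a * f m.
Definition series1 : mseries n R := fun m => (m == 0%MM)%:R.

(* The bound on the degree of k is implied by k <= m; it only makes the index
   type finite. *)
Definition series_mul f g : mseries n R := fun m =>
  \sum_(k : 'X_{1..n < (mdeg m).+1} | (k <= m)%MM) f k * g (m - k)%MM.

Let addA : associative series_add.
Proof. by move=> f g h; apply/funext => m; rewrite /series_add addrA. Qed.

Let addC : commutative series_add.
Proof. by move=> f g; apply/funext => m; rewrite /series_add addrC. Qed.

Let add0 : left_id series0 series_add.
Proof. by move=> f; apply/funext => m; rewrite /series_add add0r. Qed.

Let addN : left_inverse series0 series_opp series_add.
Proof. by move=> f; apply/funext => m; rewrite /series_add addNr. Qed.

HB.instance Definition _ :=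
  GRing.isZmodule.Build (mseries n R) addA addC add0 addN.

(* The ring axioms are transferred from polynomials: the coefficient of a
   product at m only depends on the truncations of the factors in degrees
   below any d > mdeg m. *)
Let trunc (d : nat) f : {mpoly R[n]} :=
  \sum_(k : 'X_{1..n < d}) f k *: 'X_[k].

Let mcoeff_trunc d f m : (mdeg m < d)%N -> (trunc d f)@_m = f m.
Proof.
move=> md; rewrite raddf_sum /= (bigD1 (BMultinom md)) //= big1 ?addr0.
  by rewrite mcoeffZ mcoeffX eqxx mulr1.
by move=> k; rewrite bmeqP mcoeffZ mcoeffX => /negPf /= ->; rewrite mulr0.
Qed.

Let mcoeffM_lin (p q : {mpoly R[n]}) m : (p * q)@_m =
  \sum_(k : 'X_{1..n < (mdeg m).+1} | (k <= m)%MM) p@_k * q@_(m - k).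
Proof. exact: (mcoeff_poly_mul_lin p q (ltnSn (mdeg m))). Qed.

Let mul_trunc d f g m :
  (mdeg m < d)%N -> series_mul f g m = (trunc d f * trunc d g)@_m.
Proof.
move=> md; rewrite mcoeffM_lin.
apply: eq_bigr => k km; rewrite !mcoeff_trunc //.
  by apply: leq_ltn_trans (mdegB _ _) md.
by apply: leq_ltn_trans md; rewrite -ltnS bmdeg.
Qed.

Let mcoeffM_eq (p p' q q' : {mpoly R[n]}) m :
    (forall k, (mdeg k <= mdeg m)%N -> p@_k = p'@_k) ->
    (forall k, (mdeg k <= mdeg m)%N -> q@_k = q'@_k) ->
  (p * q)@_m = (p' * q')@_m.
Proof.
move=> pE qE; rewrite !mcoeffM_lin.
apply: eq_bigr => k km; rewrite pE ?qE ?mdegB //.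
by rewrite -ltnS bmdeg.
Qed.

Let mulA : associative series_mul.
Proof.
move=> f g h; apply/funext => m; have md := ltnSn (mdeg m).
rewrite !(mul_trunc _ _ md).
rewrite (@mcoeffM_eq _ (trunc (mdeg m).+1 f) _
  (trunc (mdeg m).+1 g * trunc (mdeg m).+1 h)) //; last first.
  by move=> k km; rewrite mcoeff_trunc // -mul_trunc.
rewrite mulrA; apply: mcoeffM_eq => // k km.
by rewrite mcoeff_trunc // -mul_trunc.
Qed.

Let mulC : commutative series_mul.
Proof.
move=> f g; apply/funext => m; have md := ltnSn (mdeg m).
by rewrite !(mul_trunc _ _ md) mulrC.
Qed.

Let mul1 : left_id series1 series_mul.
Proof.
move=> f; apply/funext => m; have md := ltnSn (mdeg m).
rewrite (mul_trunc _ _ md) (@mcoeffM_eq _ 1 _ (trunc (mdeg m).+1 f)) //.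
  by rewrite mul1r mcoeff_trunc.
by move=> k km; rewrite mcoeff_trunc // mcoeff1.
Qed.

Let mulDl : left_distributive series_mul series_add.
Proof.
move=> f g h; apply/funext => m; rewrite /series_add /series_mul -big_split.
by apply: eq_bigr => k _; rewrite mulrDl.
Qed.

Let one_neq0 : series1 != 0.
Proof.
apply/eqP => /(congr1 (fun f : mseries n R => f 0%MM)) /eqP.
by rewrite /series1 eqxx oner_eq0.
Qed.

HB.instance Definition _ := GRing.Zmodule_isComNzRing.Build (mseries n R)
  mulA mulC mul1 mulDl one_neq0.

Let scaleA a b f : series_scale a (series_scale b f) = series_scale (a * b) f.
Proof. by apply/funext => m; rewrite /series_scale mulrA. Qed.

Let scale1 : left_id 1 series_scale.
Proof. by move=> f; apply/funext => m; rewrite /series_scale mul1r. Qed.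

Let scaleDr : right_distributive series_scale +%R.
Proof. by move=> a f g; apply/funext => m; rewrite /series_scale mulrDr. Qed.

Let scaleDl f : {morph series_scale^~ f : a b / a + b}.
Proof. by move=> a b; apply/funext => m; rewrite /series_scale mulrDl. Qed.

HB.instance Definition _ := GRing.Zmodule_isLmodule.Build R (mseries n R)
  scaleA scale1 scaleDr scaleDl.

Let scaleAl a f g : a *: (f * g) = (a *: f) * g.
Proof.
apply/funext => m; rewrite [LHS]mulr_sumr.
by apply: eq_bigr => k _; rewrite mulrA.
Qed.

HB.instance Definition _ :=
  GRing.Lmodule_isLalgebra.Build R (mseries n R) scaleAl.
HB.instance Definition _ :=
  GRing.Lalgebra_isComAlgebra.Build R (mseries n R).

End Series.

Section Ideals.
Context (R : comNzRingType).
Implicit Types (I J m : set R).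

Definition is_ideal I : Prop :=
  [/\ I 0, forall x y, I x -> I y -> I (x + y) & forall a x, I x -> I (a * x)].

Definition ideal_gen (S : set R) : set R := smallest is_ideal S.

Definition ideal_mul I J : set R := ideal_gen [set x * y | x in I & y in J].

Fixpoint ideal_pow I (t : nat) : set R :=
  if t is t'.+1 then ideal_mul I (ideal_pow I t') else setT.

Definition is_maximal_ideal m : Prop :=
  [/\ is_ideal m, ~ m 1 &
      forall J, is_ideal J -> m `<=` J -> ~ J 1 -> J = m].

Definition is_local m : Prop :=
  is_maximal_ideal m /\ forall m', is_maximal_ideal m' -> m' = m.

Definition is_artinian : Prop :=
  forall I : nat -> set R, (forall i, is_ideal (I i)) ->
    (forall i, I i.+1 `<=` I i) ->
  exists N, forall i, (N <= i)%N -> I i = I N.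

Definition socle m : set R := [set x | forall y, m y -> y * x = 0].

Definition regular_sequence (f : seq R) : Prop :=
  ~ ideal_gen [set` f] 1 /\
  forall i, (i < size f)%N -> forall g,
    ideal_gen [set` take i f] (g * f`_i) -> ideal_gen [set` take i f] g.

End Ideals.

Section Algebras.
Context (K : fieldType).

(* [has_qdim U V d]: for linear subspaces V <= U, the quotient U / V has a
   basis of d elements, namely the classes of the e i. *)
Definition has_qdim (A : lmodType K) (U V : set A) (d : nat) : Prop :=
  exists e : 'I_d -> A,
    [/\ forall i, U (e i),
        forall x, U x -> exists c : 'I_d -> K, V (x - \sum_i c i *: e i) &
        forall c : 'I_d -> K, V (\sum_i c i *: e i) -> forall i, c i = 0].

(* The last clause is the surjectivity of the structure map K -> A / m, which
   is automatically injective. *)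
Definition artinian_local (A : comAlgType K) (m : set A) : Prop :=
  [/\ is_artinian A, is_local m & forall x : A, exists c : K, m (x - c%:A)].

Definition is_hilbert_function (A : comAlgType K) (m : set A) (h : nat -> nat) :
  Prop := forall t, has_qdim (ideal_pow m t) (ideal_pow m t.+1) (h t).

(* For an Artinian local ring with residue field K: Gorenstein means that the
   socle (0 : m) is one-dimensional over K. *)
Definition is_gorenstein (A : comAlgType K) (m : set A) : Prop :=
  has_qdim (socle m) [set 0] 1.

(* An Artinian local ring is complete, so that no completion is needed: A itself
   is presented as a quotient of a power series ring. *)
Definition is_complete_intersection (A : comAlgType K) : Prop :=
  exists n (phi : {lrmorphism mseries n K -> A}) (f : seq (mseries n K)),
    [/\ forall a, exists g, phi g = a,
        regular_sequence f &
        [set g | phi g = 0] = ideal_gen [set` f]].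

Definition complete_intersection_sequence (h : nat -> nat) : Prop :=
  exists (A : comAlgType K) (m : set A),
    [/\ artinian_local m, is_complete_intersection A & is_hilbert_function m h].

Definition gorenstein_sequence (h : nat -> nat) : Prop :=
  exists (A : comAlgType K) (m : set A),
    [/\ artinian_local m, is_gorenstein m & is_hilbert_function m h].

End Algebras.

Local Open Scope nat_scope.

(* [binomial_expansion i a k]: with k = [:: k_i; k_(i-1); ...; k_j],
   a = 'C(k_i, i) + 'C(k_(i-1), i - 1) + ... + 'C(k_j, j) and
   k_i > k_(i-1) > ... > k_j >= j >= 1; the empty k expands a = 0. *)
Definition binomial_expansion (i a : nat) (k : seq nat) : Prop :=
  [/\ size k <= i, sorted gtn k,
      forall l, l < size k -> i - l <= nth 0 k l &
      a = \sum_(l < size k) 'C(nth 0 k l, i - l)].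

(* Macaulay's bound h_(i+1) <= h_i^<i>; the expansion k of h_i is unique. *)
Definition O_sequence (h : nat -> nat) : Prop :=
  h 0 = 1 /\
  forall i, 1 <= i -> exists k, binomial_expansion i (h i) k /\
    h i.+1 <= \sum_(l < size k) 'C((nth 0 k l).+1, (i - l).+1).

Definition is_133_sequence (h : nat -> nat) (s : nat) : Prop :=
  [/\ O_sequence h, h 1 = 3, h 2 = 3, h s = 1 & forall i, s < i -> h i = 0].

Definition seq_max (h : nat -> nat) (s : nat) : nat := \max_(i < s.+1) h i.

Definition seq_delta (h : nat -> nat) (s : nat) : nat :=
  \max_(3 <= i < s.+1) `|(h i)%:Z - (h i.-1)%:Z|%N.

(* Stated additively because subtraction on nat is truncated. *)
Definition has_fall (h : nat -> nat) (a i : nat) : Prop := h i = h i.+1 + a.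

Definition is_peak_position (h : nat -> nat) (t : nat) : Prop :=
  h t.+1 < h t /\ forall u, h u.+1 < h u -> t <= u.

Definition condition_I (h : nat -> nat) : Prop := h 3 <= 3.

Definition condition_II (h : nat -> nat) (s : nat) : Prop :=
  h 3 = 4 /\ seq_delta h s = 1.

Definition condition_III (h : nat -> nat) (s : nat) : Prop :=
  [/\ h 3 = 4, seq_delta h s = 2 &
      exists t, [/\ is_peak_position h t, has_fall h 2 t &
                    forall i, has_fall h 2 i -> i = t]].

(* The last clause is additive for the same reason as [has_fall]. *)
Definition form_III (h : nat -> nat) (s d r : nat) : Prop :=
  h 1 = 3 /\
  forall i, i <= s -> i != 1 ->
    [/\ i <= d - 2 -> h i = i.+1,
        d - 1 <= i <= d + r - 1 -> h i = d,
        i = d + r -> h i = d - 2 &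
        d + r + 1 <= i -> h i = h i.-1 \/ h i.-1 = h i + 1].

(* Main.v *)
Require Import Defs.
From HB Require Import structures.
From mathcomp Require Import all_boot all_order all_algebra falgebra ring_quotient generic_quotient.
From mathcomp Require Import boolp classical_sets.
From mathcomp.multinomials Require Import mpoly.
From mathcomp Require Import zify ring.
Set Implicit Arguments.
Unset Strict Implicit.
Unset Printing Implicit Defensive.
Import GRing.Theory.
Local Open Scope ring_scope.
Local Open Scope classical_set_scope.

(** The proof runs through (iii), (i), (ii) and back to (iii). Throughout, [m]
    is the maximal ideal of the local algebra at hand.

    Complete intersections are Gorenstein. Let [xs] be the variables of
    [R = K[[x_1, ..., x_n]]]. The Koszul cohomology [H^i(xs; R/I)] is killed by
    [(xs)], so for [a] in [(xs)] regular modulo [I] the long exact sequence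
    attached to multiplication by [a] places [H^i(R/(I + (a)))] between
    [H^i(R/I)] and [H^(i+1)(R/I)]. Going up from [K = R/(xs)] by removing one
    variable at a time, [H^n(R)] is a line and the lower groups vanish. Going
    down again along a regular sequence [f_1, ..., f_n], [H^0(R/(f))], which is
    the socle of [R/(f)], is a line. A shorter sequence would leave no socle at
    all; a longer one is impossible, because its next term would kill the socle
    of [R/(f_1, ..., f_n)] ([regular_socle_line]).

    Gorenstein sequences satisfy the conditions. Only [h_3 = 4] needs an
    argument. The growth from 3 to 4 is maximal and yields [x] in [m] outside
    [m^2] with [x m] inside [m^3] ([special_element]). If [y] and [z] complete
    [x] to generators, then [m^(t+1) = y m^t + z m^t] for [t >= 2], and
    [B = K + K y + K z + m^2] is a subalgebra of codimension one. The pairs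
    [(z c, - y c)] are relations between [y] and [z]; comparing their number
    with the number of all relations shows that [h_t - h_(t+1)] is at most the
    number of independent elements of [m^t] killed by [y] and [z]
    ([koszul_count]). Let [phi] be a linear form that does not vanish on the
    socle, and [U] the orthogonal of [B] in [m^2], which is at most a line. If
    [U = 0], all falls are at most one. If [U = K u] with [u] in [m^j] outside
    [m^(j+1)], the count is made modulo [u]: the falls there are at most one,
    and dividing out [u] only changes [h] in degree [j], so that [h] falls by
    at most two in degree [j] and by at most one elsewhere. A fall before [j]
    would turn the count into an equality; the expression of [u] as
    [y a + z b] would then be of the form above modulo [u], whence [u] in
    [m^(j+1)], a contradiction ([falls_of_generators]).

    The conditions give a complete intersection. By Macaulay's bound [h] climbs
    by one up to its maximum [d], stays there until the peak position [nu], and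
    never rises again; the conditions say that all later falls are by at most
    one, except that the first one may be by two ([conditions_peak_falls]). Put
    [D = d - 3] and [r = nu - d + 1]. For [b < d - 1] let [e_b] be the last
    degree with [h > b], and put [n_b = e_b - b], [k_i = n_i - n_(i+1)] and
    [n = n_(D+1)]. With [p_0 = 1], [p_1 = z],
    [p_(i+2) = z p_(i+1) + y^(k_i) p_i], the ideal is generated by

      [x y], [p_(D+2) - x z], [y^n p_(D+1) + z^r p_(D+2) + x p_(D+1) - x^2].

    The first two generators say that [x] acts on the column [(y, z)] through a
    matrix with trace [p_(D+1)] and determinant 0; the third one prescribes the
    defect [q = y^n p_(D+1) + z^r p_(D+2)] of [x] from satisfying the
    characteristic equation. By Cayley and Hamilton [q y = q z = 0], and also
    [y p_(D+2) = 0], in the quotient; these relations imply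
    [y^(n_i + 1) p_i = 0] for all [i], and comparing leading terms shows that
    [y^(t-b) z^b] for [b < t <= b + n_b] and [z^t] for [t <= nu] span
    [m^t / m^(t+1)] for [t >= 2]: these are [h_t] elements ([fall_spanning]).
    On the other hand the generators form a regular sequence, and the length of
    the quotient is found by splitting products: first [x y], then, modulo [x],
    the pair [p_(D+2)], [y^n p_(D+1)] by Euclid's algorithm, and, modulo [y],
    the product [z (z^(D+1) - x)] ([fall_ideal_reglen]). The length is the sum
    of the [h_t], so the spanning sets are bases ([hilbert_of_spanning]). *)

(** * Dimensions of quotients of subspaces *)

Section QDim.
Variables (K : fieldType) (A : lmodType K).
Implicit Types (U V W : set A) (c : K) (x y : A).

Definition is_subspace U := U 0 /\ forall c x y, U x -> U y -> U (c *: x + y).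

Lemma subspaceZ U c x : is_subspace U -> U x -> U (c *: x).
Proof. by move=> [U0 UL] Ux; rewrite -[_ *: _]addr0; apply: UL. Qed.

Lemma subspaceD U x y : is_subspace U -> U x -> U y -> U (x + y).
Proof. by move=> [U0 UL] Ux Uy; rewrite -[x]scale1r; apply: UL. Qed.

Lemma subspaceB U x y : is_subspace U -> U x -> U y -> U (x - y).
Proof. by move=> [U0 UL] Ux Uy; rewrite addrC -scaleN1r; apply: UL. Qed.

Lemma subspace_sum U (I : Type) (r : seq I) (P : pred I) (F : I -> A) :
  is_subspace U -> (forall i, P i -> U (F i)) -> U (\sum_(i <- r | P i) F i).
Proof.
move=> sU UF; elim/big_ind: _ => //; first by case: sU.
by move=> x y; apply: subspaceD.
Qed.

Lemma subspace_comb U d (e : 'I_d -> A) (c : 'I_d -> K) :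
  is_subspace U -> (forall i, U (e i)) -> U (\sum_i c i *: e i).
Proof. by move=> sU Ue; apply: subspace_sum => // i _; apply: subspaceZ. Qed.

Lemma subspace0 : is_subspace [set 0].
Proof. by split=> // c x y -> ->; rewrite scaler0 addr0. Qed.

Lemma qdim_indep_le U V d d' (e : 'I_d' -> A) : is_subspace V ->
  has_qdim U V d -> (forall i, U (e i)) ->
  (forall c : 'I_d' -> K, V (\sum_i c i *: e i) -> forall i, c i = 0) ->
  (d' <= d)%N.
Proof.
move=> sV [b [Ub genb _]] Ue inde.
have /choice [C CE] : forall i, exists c : 'I_d -> K, V (e i - \sum_j c j *: b j).
  by move=> i; apply: genb.
pose M : 'M[K]_(d', d) := \matrix_(i, j) C i j.
rewrite -(_ : \rank M = d') ?rank_leq_col //.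
apply/eqP; rewrite -/(row_free M) -kermx_eq0; apply/rowV0P => v /sub_kermxP vM.
apply/rowP => i; rewrite mxE; move: i.
apply: inde.
rewrite (_ : \sum_i _ = \sum_i v 0 i *: (e i - \sum_j C i j *: b j)).
  by apply: subspace_comb.
under [RHS]eq_bigr do rewrite scalerBr.
rewrite sumrB [X in _ - X](_ : _ = 0) ?subr0 //.
under eq_bigr do rewrite scaler_sumr.
rewrite exchange_big big1 //= => j _.
under eq_bigr do rewrite scalerA.
rewrite -scaler_suml (_ : \sum_i _ = (v *m M) 0 j); last first.
  by rewrite mxE; apply: eq_bigr => i _; rewrite mxE.
by rewrite vM mxE scale0r.
Qed.

Lemma qdim_le U U' V d d' : is_subspace V -> U' `<=` U ->
  has_qdim U V d -> has_qdim U' V d' -> (d' <= d)%N.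
Proof.
move=> sV UU dU [e [Ue _ inde]].
by apply: (qdim_indep_le sV dU _ inde) => i; apply: UU.
Qed.

Lemma qdim_uniq U V d d' : is_subspace V ->
  has_qdim U V d -> has_qdim U V d' -> d = d'.
Proof.
move=> sV h h'; apply/eqP.
by rewrite eqn_leq (qdim_le sV _ h' h) // (qdim_le sV _ h h').
Qed.

Lemma qdim_add U V W a b : is_subspace V -> is_subspace W ->
  V `<=` U -> W `<=` V ->
  has_qdim U V a -> has_qdim V W b -> has_qdim U W (a + b).
Proof.
move=> sV sW VU WV [e [Ue ge ie]] [e' [Ve ge' ie']].
exists (fun k => match split k with inl i => e i | inr j => e' j end); split.
- by move=> k; case: (split k) => i; [apply: Ue | apply/VU/Ve].
- move=> x /ge [c /ge' [c' Wx]].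
  exists (fun k => match split k with inl i => c i | inr j => c' j end).
  rewrite big_split_ord /= opprD addrA.
  under eq_bigr do rewrite (unsplitK (inl _)).
  under [X in _ - X]eq_bigr do rewrite (unsplitK (inr _)).
  exact: Wx.
- move=> c; rewrite big_split_ord /=.
  under eq_bigr do rewrite (unsplitK (inl _)).
  under [X in _ + X]eq_bigr do rewrite (unsplitK (inr _)).
  set x := (X in X + _); set y := (X in _ + X) => Wxy.
  have Vy : V y by apply: subspace_comb.
  have Vx : V x by rewrite -[x](addrK y); apply: subspaceB => //; apply: WV.
  have c1 := ie _ Vx; have x0 : x = 0 by apply: big1 => i _; rewrite c1 scale0r.
  move: Wxy; rewrite x0 add0r => /ie' c2 k.
  by case: (split_ordP k) => j ->.
Qed.

(** Upper bounds for dimensions come from spanning families, which are found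
    long before their independence is known. *)
Lemma qdim_span U V k (e : 'I_k -> A) : is_subspace V ->
  (forall i, U (e i)) ->
  (forall x, U x -> exists c : 'I_k -> K, V (x - \sum_i c i *: e i)) ->
  exists2 d, (d <= k)%N & has_qdim U V d.
Proof.
move=> sV; elim: k e => [|k IHk] e Ue ge.
  by exists 0%N => //; exists e; split=> // c _ [].
have [inde|] := pselect (forall c : 'I_k.+1 -> K,
   V (\sum_i c i *: e i) -> forall i, c i = 0).
  by exists k.+1 => //; exists e.
move=> /existsNP [c /not_implyP [Vc /existsNP [j /eqP cj]]].
have [] := IHk (e \o lift j); first by move=> i; apply: Ue.
  move=> x /ge [c' Vx].
  exists (fun i => c' (lift j i) - c' j / c j * c (lift j i)).
  have -> : x - \sum_i (c' (lift j i) - c' j / c j * c (lift j i)) *: (e \o lift j) i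
     = (c' j / c j) *: (\sum_i c i *: e i) + (x - \sum_i c' i *: e i).
    rewrite !(bigD1_ord j) //=.
    under eq_bigr do rewrite scalerBl -scalerA.
    rewrite sumrB -scaler_sumr scalerDr scalerA mulfVK //.
    by rewrite opprB opprD addrCA [X in _ = _ + X]addrCA addrACA subrr add0r.
  by case: sV => _; apply.
by move=> d dk h; exists d => //; apply: leqW.
Qed.

Lemma qdim0 U V : is_subspace V -> V `<=` U -> has_qdim U V 0 -> U = V.
Proof.
move=> sV VU [e [_ ge _]]; apply/seteqP; split=> // x /ge [c].
by rewrite big_ord0 subr0.
Qed.

Lemma qdim_refl V : has_qdim V V 0.
Proof. by exists (fun _ => 0); split=> [[]//|x Vx|c _ []//]; exists (fun _ => 0); rewrite big_ord0 subr0. Qed.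

End QDim.

(** A copy of [A] that remembers a proof of finite dimension: it carries the
    structure of a finite-dimensional algebra, which [A] itself cannot. *)
Definition fdalg (K : fieldType) (A : comAlgType K) (N : nat)
  (_ : has_qdim (@setT A) [set 0] N) : Type := A.

Section FD.
Variables (K : fieldType) (A : comAlgType K) (N : nat).
Hypothesis (H : has_qdim (@setT A) [set 0] N).

HB.instance Definition _ := GRing.ComAlgebra.on (fdalg H).

Lemma fdalg_axiom : Vector.axiom N (fdalg H).
Proof.
have [e he] := cid H.
have [_ ge ie] := he.
have /choice [v2r vE] : forall x : A, exists c : 'rV[K]_N, x = \sum_i c 0 i *: e i.
  move=> x; have [c /eqP] := ge x I; rewrite subr_eq0 => /eqP ->.
  by exists (\row_i c i); apply: eq_bigr => i _; rewrite mxE.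
have inj (c c' : 'rV[K]_N) : \sum_i c 0 i *: e i = \sum_i c' 0 i *: e i -> c = c'.
  move=> /eqP; rewrite -subr_eq0 -sumrB => /eqP h.
  apply/rowP => i; apply/eqP; rewrite -subr_eq0; apply/eqP; move: i; apply: ie.
  by apply: (etrans _ h); apply: eq_bigr => i _; rewrite scalerBl.
exists v2r.
  move=> c x y; apply: inj; apply: etrans (esym (vE _)) _.
  transitivity (c *: (\sum_i v2r x 0 i *: e i) + \sum_i v2r y 0 i *: e i).
    by congr (_ *: _ + _); apply: vE.
  rewrite scaler_sumr -big_split /=.
  by apply: eq_bigr => i _; rewrite scalerA -scalerDl !mxE.
exists (fun c : 'rV[K]_N => \sum_i c 0 i *: e i : A).
  by move=> x; apply: esym (vE _).
by move=> c; apply: inj; apply: esym (vE _).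
Qed.

HB.instance Definition _ := Lmodule_hasFinDim.Build K (fdalg H) fdalg_axiom.
HB.instance Definition _ := Algebra_isFalgebra.Build K (fdalg H).
End FD.

(** * Ideals and Artinian local algebras *)

Section IdealTheory.
Variable R : comNzRingType.
Implicit Types (I J : set R) (a b x y z : R).

Lemma idealN I x : is_ideal I -> I x -> I (- x).
Proof. by move=> [_ _ IM] Ix; rewrite -mulN1r; apply: IM. Qed.

Lemma idealB I x y : is_ideal I -> I x -> I y -> I (x - y).
Proof. by move=> iI Ix Iy; case: (iI) => _ ID _; apply: ID => //; apply: idealN. Qed.

Lemma idealMr I x y : is_ideal I -> I x -> I (x * y).
Proof. by move=> [_ _ IM] Ix; rewrite mulrC; apply: IM. Qed.

Lemma ideal_congr I x y : is_ideal I -> I (x - y) -> I y -> I x.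
Proof. by move=> [_ ID _] Ixy Iy; rewrite -(subrK y x); apply: ID. Qed.

Lemma ideal_sym I x y : is_ideal I -> I (x - y) -> I (y - x).
Proof. by move=> iI; rewrite -[y - x]opprB; apply: idealN. Qed.

Lemma ideal_trans I x y z : is_ideal I -> I (x - y) -> I (y - z) -> I (x - z).
Proof.
by move=> [_ ID _] h1 h2; rewrite -[x](subrK y) -addrA; apply: ID.
Qed.

Lemma is_idealT : is_ideal (@setT R). Proof. by []. Qed.

Lemma is_ideal0 : is_ideal [set (0 : R)].
Proof. by split=> // [x y -> ->|a x ->]; rewrite ?addr0 ?mulr0. Qed.

Lemma ideal_gen_ideal (S : set R) : is_ideal (ideal_gen S).
Proof.
split; first by move=> J [[]].
- by move=> x y gx gy J JP; case: (JP.1) => _ JD _; apply: JD; [apply: gx|apply: gy].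
- by move=> a x gx J JP; case: (JP.1) => _ _; apply; apply: gx.
Qed.

Lemma ideal_gen_sub (S : set R) I : is_ideal I -> S `<=` I -> ideal_gen S `<=` I.
Proof. by move=> iI SI; apply: smallest_sub. Qed.

Lemma ideal_gen_in (S : set R) x : S x -> ideal_gen S x.
Proof. by move=> Sx J [_]; apply. Qed.

Lemma ideal_mulP I J x y : I x -> J y -> ideal_mul I J (x * y).
Proof. by move=> Ix Jy; apply: ideal_gen_in; exists x => //; exists y. Qed.

Lemma ideal_pow_ideal I t : is_ideal (ideal_pow I t).
Proof. by case: t => [|t]; [apply: is_idealT | apply: ideal_gen_ideal]. Qed.

Lemma ideal_powM I t x y : I x -> ideal_pow I t y -> ideal_pow I t.+1 (x * y).
Proof. exact: ideal_mulP. Qed.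

Lemma ideal_powS I t : ideal_pow I t.+1 `<=` ideal_pow I t.
Proof.
apply: ideal_gen_sub; first exact: ideal_pow_ideal.
by move=> _ [x Ix [y Jy <-]]; case: (ideal_pow_ideal I t) => _ _; apply.
Qed.

Lemma ideal_pow1 I : is_ideal I -> ideal_pow I 1 = I.
Proof.
move=> iI; apply/seteqP; split.
  by apply: ideal_gen_sub => // _ [x Ix [y _ <-]]; apply: idealMr.
by move=> x Ix; rewrite -[x]mulr1; apply: ideal_powM.
Qed.

(** Zorn's lemma is applied to the sets [X] for which the union of [X] and [J]
    is a proper ideal, so that the empty chain needs no separate treatment. *)
Lemma maximal_above J : is_ideal J -> ~ J 1 ->
  exists m, is_maximal_ideal m /\ J `<=` m.
Proof.
move=> iJ J1.
pose P (X : set R) := is_ideal (X `|` J) /\ ~ (X `|` J) 1.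
have [|M [[iM M1] maxM]] := @Zorn_bigcup _ P.
  move=> F FP tot; pose U := \bigcup_(X in F) X.
  have UJ x : (U `|` J) x -> J x \/ exists2 X, F X & (X `|` J) x.
    by case=> [[X FX Xx]|]; [right; exists X => //; left|left].
  have JU X : F X -> X `|` J `<=` U `|` J.
    by move=> FX x [Xx|]; [left; exists X|right].
  have JJ X : J `<=` X `|` J by move=> x; right.
  split; last by move/UJ => [//|[X /FP[_ h] /h]].
  split; first by apply: JJ; case: iJ.
    move=> x y /UJ [Jx|[X FX Xx]] /UJ [Jy|[Y FY Yy]].
    - by apply: JJ; case: (iJ) => _ + _; apply.
    - apply: (JU Y) => //; case: (FP _ FY) => -[_ + _] _; apply => //; exact: JJ.
    - apply: (JU X) => //; case: (FP _ FX) => -[_ + _] _; apply => //; exact: JJ.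
    - have [XY|YX] := tot X Y FX FY.
      + apply: (JU Y) => //; case: (FP _ FY) => -[_ + _] _; apply => //.
        by case: Xx => [/XY|]; [left|right].
      + apply: (JU X) => //; case: (FP _ FX) => -[_ + _] _; apply => //.
        by case: Yy => [/YX|]; [left|right].
  move=> a x /UJ [Jx|[X FX Xx]].
    by apply: JJ; case: (iJ) => _ _; apply.
  by apply: (JU X) => //; case: (FP _ FX) => -[_ _ + ] _; apply.
exists (M `|` J); split; last by move=> x; right.
split=> // J' iJ' MJ' J'1; apply/seteqP; split=> // x J'x.
apply: contrapT => Mx.
have sJJ' : J `<=` J' by move=> y Jy; apply: MJ'; right.
apply: (maxM J').
  split=> [|e]; last by apply: Mx; left; apply: e.
  by move=> y My; apply: MJ'; left.
by rewrite /P (setUidl sJJ').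
Qed.

End IdealTheory.

Lemma ideal_subspace (K : fieldType) (A : comAlgType K) (I : set A) :
  is_ideal I -> is_subspace I.
Proof.
move=> [I0 ID IM]; split=> // c x y Ix Iy; apply: ID => //.
by rewrite -mulr_algl; apply: IM.
Qed.

Section Local.
Variables (K : fieldType) (A : comAlgType K) (m : set A).
Hypothesis locA : artinian_local m.
Implicit Types (a b x y : A).

Lemma local_max : is_maximal_ideal m. Proof. by case: locA => _ []. Qed.

Lemma local_ideal : is_ideal m. Proof. by case: local_max. Qed.

(** In a local ring [1 - a] is invertible for [a] in [m]. Only its regularity
    matters here: the annihilator of [x] contains [1 - a], and if it were proper
    it would lie in [m], which then contained 1. *)
Lemma local_cancel x a : m a -> x * (1 - a) = 0 -> x = 0.
Proof.
move=> ma xa; apply: contrapT => x0.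
have [||M [Mmax sM]] := @maximal_above A [set b | x * b = 0].
- split=> [|b c /= xb xc|b c /= xc]; first exact: mulr0.
    by rewrite mulrDr xb xc addr0.
  by rewrite mulrCA xc mulr0.
- by move=> /=; rewrite mulr1.
have EM : M = m by case: locA => _ [_ h] _; apply: h.
case: local_max => im m1 _; apply: m1; rewrite -[1](subrK a).
by case: (im) => _ + _; apply => //; rewrite -EM; apply: sM.
Qed.

(** Nakayama's lemma for the powers of the maximal ideal. If [x] does not
    kill [m ^ N], then neither does [x * y] for some [y] in [m]; iterating
    gives a decreasing chain of principal ideals, which must become constant,
    and this contradicts [local_cancel]. *)
Lemma ideal_pow_stable N : ideal_pow m N.+1 = ideal_pow m N ->
  ideal_pow m N = [set 0].
Proof.
move=> mN; apply/seteqP; split; last by move=> _ ->; case: (ideal_pow_ideal m N).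
move=> z0 mz0; apply: contrapT => /= z00.
pose alive x := exists2 i, ideal_pow m N i & x * i <> 0.
have /choice [nx nxP] : forall u : {x : A | alive x}, exists v : {x : A | alive x},
    exists2 y, m y & sval v = sval u * y.
  move=> [x [i mi xi]] /=.
  have [//|] := pselect (exists2 y, m y & alive (x * y)).
    by move=> [y my ay]; exists (exist _ (x * y) ay); exists y.
  move=> nex; exfalso; apply: xi; move: mi; rewrite -mN.
  suff : ideal_pow m N.+1 `<=` [set i | x * i = 0] by apply.
  apply: ideal_gen_sub.
    split=> [|b c /= xb xc|b c /= xc]; first exact: mulr0.
      by rewrite mulrDr xb xc addr0.
    by rewrite mulrCA xc mulr0.
  move=> _ [y my [j mj <-]] /=; apply: contrapT => xyj; apply: nex.
  by exists y => //; exists j => //; rewrite -mulrA.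
have a1 : alive 1 by exists z0; rewrite ?mul1r.
pose v n := iter n nx (exist _ 1 a1).
have vS n : exists2 y, m y & sval (v n.+1) = sval (v n) * y := nxP (v n).
pose J n : set A := [set sval (v n) * b | b in setT].
have iJ n : is_ideal (J n).
  split; first by exists 0; rewrite ?mulr0.
    by move=> _ _ [b _ <-] [c _ <-]; exists (b + c); rewrite ?mulrDr.
  by move=> a _ [b _ <-]; exists (a * b) => //; rewrite mulrCA.
have JS n : J n.+1 `<=` J n.
  move=> _ [b _ <-]; case: (vS n) => y _ ->; exists (y * b) => //.
  by rewrite mulrA.
have [art _ _] := locA; have [n nE] := art J iJ JS.
have : J n.+1 (sval (v n)) by rewrite nE //; exists 1; rewrite ?mulr1.
case=> b _; case: (vS n) => y my -> E.
have : sval (v n) = 0.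
  apply: (@local_cancel _ (y * b)); first exact: idealMr local_ideal my.
  by rewrite mulrBr mulr1 mulrA E subrr.
by case: (svalP (v n)) => i _ + E0; rewrite E0 mul0r.
Qed.

Lemma max_nilpotent : exists N, ideal_pow m N = [set 0].
Proof.
have [art _ _] := locA.
have [N NE] := art _ (ideal_pow_ideal m) (@ideal_powS _ m).
by exists N; apply: ideal_pow_stable; apply: NE.
Qed.

(** Multiply [a] by elements of [m] as long as the result is not 0; as [m] is
    nilpotent this ends, and it ends in the socle. *)
Lemma socle_above a : a != 0 -> exists b, b * a != 0 /\ socle m (b * a).
Proof.
have [N N0] := max_nilpotent.
have : forall t, ideal_pow m t `<=` [set c | c * a = 0] -> a != 0 ->
    exists b, b * a != 0 /\ socle m (b * a).
  elim=> [h a0|t IHt h a0].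
    by have := h 1 I; rewrite /= mul1r => E; rewrite E eqxx in a0.
  have [/IHt/(_ a0)//|/existsNP [c /not_implyP [mc /eqP ca]]] :=
    pselect (ideal_pow m t `<=` [set c | c * a = 0]).
  exists c; split=> // y my; rewrite mulrA; apply: h; exact: ideal_powM.
move=> /(_ N); rewrite N0 => gen a0.
by apply: gen => // c ->; rewrite /= mul0r.
Qed.

End Local.

Lemma hilbert_total (K : fieldType) (A : comAlgType K) (m : set A) h n :
  is_hilbert_function m h -> ideal_pow m n = [set 0] -> forall t, (t <= n)%N ->
  has_qdim (ideal_pow m t) [set 0] (\sum_(t <= i < n) h i).
Proof.
move=> hh mn t tn; have [k] := ubnP (n - t)%N; elim: k t tn => // k IHk t tn kn.
have [{}tn|nt] := ltnP t n; last first.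
  have -> : t = n by lia.
  by rewrite big_geq // mn; apply: qdim_refl.
rewrite big_ltn //; apply: (@qdim_add _ _ _ (ideal_pow m t.+1)).
- exact/ideal_subspace/ideal_pow_ideal.
- exact: subspace0.
- exact: ideal_powS.
- by move=> _ ->; case: (ideal_pow_ideal m t.+1).
- exact: hh.
- by apply: IHk; lia.
Qed.

Lemma hilbert_vanish (K : fieldType) (A : comAlgType K) (m : set A) h s :
  artinian_local m -> is_hilbert_function m h -> h s = 0%N ->
  ideal_pow m s = [set 0].
Proof.
move=> loc hh hs; apply: ideal_pow_stable => //; apply/esym.
apply: qdim0; last by rewrite -hs; apply: hh.
  exact/ideal_subspace/ideal_pow_ideal.
exact: ideal_powS.
Qed.

(** * Koszul cohomology *)

Section Koszul.
Variable R : comNzRingType.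
Implicit Types (I J : set R) (a x y : R) (xs : seq R) (c b e : seq bool -> R).
Implicit Types (w v : seq bool).

(** The Koszul complex of [xs]. A cochain is a function on subsets of [xs], a
    subset being a word [w] of bits with [size w = size xs], and its degree is
    [count id w]. Words make the differential a structural recursion: the
    complex of [x :: xs] is the cone of multiplication by [x] on that of
    [xs]. *)
Fixpoint kosz xs c w : R :=
  match xs, w with
  | x :: xs', false :: w' => kosz xs' (fun v => c (false :: v)) w'
  | x :: xs', true :: w' =>
      x * c (false :: w') - kosz xs' (fun v => c (true :: v)) w'
  | _, _ => 0
  end.

(** Contraction with the [j]-th basis vector. *)
Fixpoint kosz_htpy xs j c w : R :=
  match xs, j, w with
  | x :: xs', 0, false :: w' => c (true :: w')
  | x :: xs', j'.+1, false :: w' => kosz_htpy xs' j' (fun v => c (false :: v)) w'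
  | x :: xs', j'.+1, true :: w' => - kosz_htpy xs' j' (fun v => c (true :: v)) w'
  | _, _, _ => 0
  end.

Lemma kosz_lin xs a c b w :
  kosz xs (fun v => a * c v + b v) w = a * kosz xs c w + kosz xs b w.
Proof.
elim: xs c b w => [|x xs IH] c b [|[] w] /=; rewrite ?mulr0 ?addr0 //.
by rewrite (IH (fun v => c (true :: v)) (fun v => b (true :: v))); ring.
Qed.

Lemma kosz_htpy_lin xs j a c b w : kosz_htpy xs j (fun v => a * c v + b v) w =
  a * kosz_htpy xs j c w + kosz_htpy xs j b w.
Proof.
elim: xs j c b w => [|x xs IH] [|j] c b [|[] w] /=; rewrite ?mulr0 ?addr0 //.
by rewrite (IH j (fun v => c (true :: v)) (fun v => b (true :: v))); ring.
Qed.

Lemma kosz_zero xs w : kosz xs (fun _ => 0) w = 0.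
Proof.
by elim: xs w => [|x xs IH] [|[] w] //=; rewrite IH mulr0 subr0.
Qed.

Lemma kosz_ext xs c b w : c =1 b -> kosz xs c w = kosz xs b w.
Proof. by move=> /funext ->. Qed.

Lemma kosz_scale xs a c w : kosz xs (fun v => a * c v) w = a * kosz xs c w.
Proof.
transitivity (kosz xs (fun v => a * c v + 0) w).
  by apply: kosz_ext => v; rewrite addr0.
by rewrite (kosz_lin _ _ _ (fun _ => 0)) kosz_zero addr0.
Qed.

Lemma kosz_sub xs c b w :
  kosz xs (fun v => c v - b v) w = kosz xs c w - kosz xs b w.
Proof.
transitivity (kosz xs (fun v => (-1) * b v + c v) w).
  by apply: kosz_ext => v; ring.
by rewrite kosz_lin; ring.
Qed.

Lemma kosz_htpy_sub xs j c b w : kosz_htpy xs j (fun v => c v - b v) w =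
  kosz_htpy xs j c w - kosz_htpy xs j b w.
Proof.
transitivity (kosz_htpy xs j (fun v => (-1) * b v + c v) w).
  by congr kosz_htpy; apply/funext => v; ring.
by rewrite kosz_htpy_lin; ring.
Qed.

Lemma kosz_htpy_scale xs j a c w :
  kosz_htpy xs j (fun v => a * c v) w = a * kosz_htpy xs j c w.
Proof.
transitivity (kosz_htpy xs j (fun v => a * c v + 0 * c v) w).
  by congr kosz_htpy; apply/funext => v; ring.
rewrite (kosz_htpy_lin _ _ _ _ (fun v => 0 * c v)).
transitivity (a * kosz_htpy xs j c w + kosz_htpy xs j (fun v => c v - c v) w).
  by congr (_ + kosz_htpy _ _ _ _); apply/funext => v; ring.
by rewrite kosz_htpy_sub subrr addr0.
Qed.

Lemma kosz_kosz xs c w : kosz xs (kosz xs c) w = 0.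
Proof.
elim: xs c w => [|x xs IH] c [|[] w] //=.
rewrite (kosz_sub _ (fun v => x * c (false :: v))) (kosz_scale _ _ (fun v => c (false :: v))).
by rewrite (IH (fun v => c (true :: v))); ring.
Qed.

(** Multiplication by [x_j] is homotopic to 0. *)
Lemma koszE xs j c w : (j < size xs)%N -> size w = size xs ->
  kosz xs (kosz_htpy xs j c) w + kosz_htpy xs j (kosz xs c) w = xs`_j * c w.
Proof.
elim: xs j c w => [|x xs IH] [|j] c [|b w] //=; rewrite ?ltnS.
  by move=> _ [sw]; case: b; rewrite ?kosz_zero; ring.
move=> jn [sw]; case: b; last exact: IH.
rewrite (kosz_htpy_sub _ _ (fun v => x * c (false :: v))).
rewrite (kosz_htpy_scale _ _ _ (fun v => c (false :: v))).
rewrite -(IH j (fun v => c (true :: v)) w jn sw).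
rewrite (kosz_ext _ (b := fun v => (-1) * kosz_htpy xs j (fun u => c (true :: u)) v)).
  by rewrite kosz_scale; ring.
by move=> v; ring.
Qed.

Lemma count0_nseq w : count id w = 0%N -> w = nseq (size w) false.
Proof. by elim: w => //= -[] //= w IH /IH {1}->. Qed.

Lemma kosz_count0 xs c w : count id w = 0%N -> kosz xs c w = 0.
Proof. by elim: xs c w => [|x xs IH] c [|[] w] //=; apply: IH. Qed.

Lemma kosz_congr I xs c b i : is_ideal I ->
  (forall w, size w = size xs -> count id w = i -> I (c w - b w)) ->
  forall w, size w = size xs -> count id w = i.+1 ->
    I (kosz xs c w - kosz xs b w).
Proof.
move=> iI; elim: xs i c b => [|x xs IH] i c b h [|[] w] //= [sw]; last first.
  rewrite add0n; apply: (IH _ (fun v => c (false :: v)) (fun v => b (false :: v))) => //.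
  by move=> v sv cv; apply: h => //=; rewrite sv.
rewrite add1n => -[cw].
have -> : x * c (false :: w) - kosz xs (fun v => c (true :: v)) w -
    (x * b (false :: w) - kosz xs (fun v => b (true :: v)) w) =
  x * (c (false :: w) - b (false :: w)) -
  (kosz xs (fun v => c (true :: v)) w - kosz xs (fun v => b (true :: v)) w).
  by ring.
apply: idealB => //.
  by case: (iI) => _ _; apply; apply: h => /=; rewrite ?sw.
case: i cw h => [|i] cw h; first by rewrite !kosz_count0 // subrr; case: iI.
apply: (IH i (fun v => c (true :: v)) (fun v => b (true :: v))) => //.
by move=> v sv cv; apply: h => /=; rewrite ?sv ?cv.
Qed.

Lemma kosz_htpy_in I xs j c i : is_ideal I ->
  (forall w, size w = size xs -> count id w = i.+1 -> I (c w)) ->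
  forall w, size w = size xs -> count id w = i -> I (kosz_htpy xs j c w).
Proof.
move=> iI; have I0 : I 0 by case: iI.
elim: xs i j c => [|x xs IH] i [|j] c h [|[] w] //= [sw] cw.
- by apply: h => /=; rewrite ?sw ?add1n -?cw.
- apply: idealN => //; case: i h cw => // i h [cw].
  apply: (IH i j (fun v => c (true :: v))) => // v sv cv.
  by apply: h => /=; rewrite ?sv ?cv.
- apply: (IH i j (fun v => c (false :: v))) => // v sv cv.
  by apply: h => /=; rewrite ?sv ?cv.
Qed.

Lemma kosz_count1 I xs c : is_ideal I ->
  (forall w, size w = size xs -> count id w = 1%N -> I (kosz xs c w)) <->
  (forall x, x \in xs -> I (x * c (nseq (size xs) false))).
Proof.
move=> iI; have cf n : count id (nseq n false) = 0%N by rewrite count_nseq.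
elim: xs c => [|x xs IH] c; first by split=> // _ [].
split=> [h y|h].
  rewrite inE => /orP[/eqP ->|yxs].
    have /= := h (true :: nseq (size xs) false).
    by rewrite size_nseq cf (kosz_count0 _ _ (cf _)) subr0; apply.
  apply: (proj1 (IH (fun v => c (false :: v)))) => // w sw cw.
  by apply: (h (false :: w)) => /=; rewrite ?sw.
case=> [|[] w] //= [sw].
  rewrite add1n => -[cw]; rewrite kosz_count0 // subr0 (count0_nseq cw) sw.
  by apply: h; rewrite mem_head.
rewrite add0n => cw; apply: (proj2 (IH (fun v => c (false :: v)))) => //.
by move=> y yxs; apply: h; rewrite inE yxs orbT.
Qed.

Definition ideal_adj I a : set R := [set z | exists r, I (z - a * r)].

Lemma ideal_adj_ideal I a : is_ideal I -> is_ideal (ideal_adj I a).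
Proof.
move=> iI; have [I0 ID IM] := iI; split; first by exists 0; rewrite mulr0 subr0.
  move=> x y [r xr] [s ys]; exists (r + s).
  by rewrite mulrDr opprD addrACA; apply: ID.
by move=> b x [r xr]; exists (b * r); rewrite mulrCA -mulrBr; apply: IM.
Qed.

Lemma ideal_adj_sub I a : is_ideal I -> I `<=` ideal_adj I a.
Proof. by move=> [I0 ID IM] x Ix; exists 0; rewrite mulr0 subr0. Qed.

Lemma ideal_adj_in I a : is_ideal I -> ideal_adj I a a.
Proof. by move=> [I0 ID IM]; exists 1; rewrite mulr1 subrr. Qed.

Lemma ideal_adj_min I a J : is_ideal J -> I `<=` J -> J a -> ideal_adj I a `<=` J.
Proof.
move=> iJ IJ Ja x [r /IJ xr]; apply: (ideal_congr iJ xr); exact: idealMr.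
Qed.

Lemma ideal_gen_rcons (s : seq R) a :
  ideal_gen [set` rcons s a] = ideal_adj (ideal_gen [set` s]) a.
Proof.
have is_ := ideal_gen_ideal [set` s].
apply/seteqP; split.
  apply: ideal_gen_sub; first exact: ideal_adj_ideal.
  move=> x /=; rewrite mem_rcons inE => /orP[/eqP ->|xs].
    exact: ideal_adj_in.
  by apply: ideal_adj_sub => //; apply: ideal_gen_in.
apply: ideal_adj_min; first exact: ideal_gen_ideal.
  apply: ideal_gen_sub; first exact: ideal_gen_ideal.
  by move=> x /= xs; apply: ideal_gen_in => /=; rewrite mem_rcons inE xs orbT.
by apply: ideal_gen_in => /=; rewrite mem_rcons mem_head.
Qed.

Lemma ideal_gen_take (s : seq R) i : (i < size s)%N ->
  ideal_gen [set` take i.+1 s] = ideal_adj (ideal_gen [set` take i s]) s`_i.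
Proof. by move=> h; rewrite (take_nth 0 h) ideal_gen_rcons. Qed.

Lemma ideal_gen_nil : ideal_gen [set` [::] : seq R] = [set 0].
Proof.
apply/seteqP; split; first by apply: ideal_gen_sub => //; apply: is_ideal0.
by move=> _ ->; case: (ideal_gen_ideal [set` [::] : seq R]).
Qed.

(** Cochains of [R / I] are represented by functions with values in [R], and all
    equations between them hold modulo [I]. *)
Variable xs : seq R.
Definition kcocycle I i c := forall w, size w = size xs -> count id w = i.+1 ->
  I (kosz xs c w).
Definition kcobound I i c := exists b, forall w,
  size w = size xs -> count id w = i -> I (c w - kosz xs b w).
Definition kvanish I i := forall c, kcocycle I i c -> kcobound I i c.

(** The ideal [(xs)] kills the cohomology: [kosz_htpy] provides a primitive of
    [x_j * c], and primitives can be added. *)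
Lemma kosz_kill I i c a : is_ideal I -> ideal_gen [set` xs] a ->
  kcocycle I i c -> kcobound I i (fun w => a * c w).
Proof.
move=> iI; have [I0 ID IM] := iI.
move=> xa Zc; move: a xa; apply: ideal_gen_sub.
  split.
  - by exists (fun _ => 0) => w _ _; rewrite kosz_zero mul0r subr0.
  - move=> x y [b hb] [b' hb']; exists (fun w => 1 * b w + b' w) => w sw cw.
    rewrite kosz_lin (_ : _ - _ = (x * c w - kosz xs b w) + (y * c w - kosz xs b' w)).
      by apply: ID; [apply: hb|apply: hb'].
    by ring.
  - move=> a x [b hb]; exists (fun w => a * b w) => w sw cw.
    by rewrite kosz_scale -mulrA -mulrBr; apply: IM; apply: hb.
move=> _ /= /(nthP 0) [j jn <-]; exists (kosz_htpy xs j c) => w sw cw.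
rewrite -koszE // addrAC subrr add0r.
exact: (@kosz_htpy_in I xs j (kosz xs c) i iI Zc).
Qed.
End Koszul.

Section KoszulTransfer.
Variables (K : fieldType) (R : comAlgType K) (xs : seq R).
Implicit Types (I J : set R) (a x y : R) (c b e : seq bool -> R) (l : K).

Definition nzd a I := forall g, I (g * a) -> I g.

(** [H^i(xs; R / I)] is a line over [K], spanned by the class of [c0]. *)
Definition kline I i := exists c0, [/\ kcocycle xs I i c0,
  ~ kcobound xs I i c0 &
  forall c, kcocycle xs I i c ->
    exists l : K, kcobound xs I i (fun w => c w - l%:A * c0 w)].

(** From here on, the long exact sequence of
    [0 -> R / I -> R / I -> R / J -> 0], the first map being multiplication by
    [a]. As [a] kills the cohomology, it splits into
    [0 -> H^i(R / I) -> H^i(R / J) -> H^(i+1)(R / I) -> 0]. *)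

Variables (I : set R) (a : R).
Hypotheses (iI : is_ideal I) (xa : ideal_gen [set` xs] a) (aI : nzd a I).
Local Notation J := (ideal_adj I a).

Let I0 : I 0. Proof. by case: iI. Qed.
Let ID x y : I x -> I y -> I (x + y). Proof. by case: iI => _ + _; apply. Qed.
Let IM x y : I y -> I (x * y). Proof. by case: iI => _ _; apply. Qed.
Let iJ : is_ideal J. Proof. exact: ideal_adj_ideal. Qed.
Let nzl x : I (a * x) -> I x. Proof. by rewrite mulrC; apply: aI. Qed.

(** The connecting homomorphism: a cochain [c] that is closed modulo [J] has a
    coboundary divisible by [a]. *)
Let connect i c : kcocycle xs J i c -> exists2 e, kcocycle xs I i.+1 e &
  forall w, size w = size xs -> count id w = i.+1 -> I (kosz xs c w - a * e w).
Proof.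
move=> Zc.
have /choice [e eP] : forall w, exists r,
    size w = size xs -> count id w = i.+1 -> I (kosz xs c w - a * r).
  move=> w; have [[sw cw]|h] := pselect (size w = size xs /\ count id w = i.+1).
    by have [r Ir] := Zc w sw cw; exists r.
  by exists 0 => sw cw; case: h.
exists e => // w sw cw; apply: nzl.
have := kosz_congr iI eP sw cw.
by rewrite kosz_kosz kosz_scale sub0r => /(idealN iI); rewrite opprK.
Qed.

(** The connecting homomorphism, which takes the class of [c] to that of [e],
    respects coboundaries. It is stated for the combinations [c - l * c0] that
    occur when a cohomology group is shown to be a line. *)
Let lift i c e b b' (l : R) (c0 e0 : seq bool -> R) :
  (forall w, size w = size xs -> count id w = i.+1 -> I (kosz xs c w - a * e w)) ->
  (forall w, size w = size xs -> count id w = i.+1 -> I (kosz xs c0 w - a * e0 w)) ->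
  (forall w, size w = size xs -> count id w = i ->
     I (c w - l * c0 w - kosz xs b w - a * b' w)) ->
  forall w, size w = size xs -> count id w = i.+1 -> I (e w - l * e0 w - kosz xs b' w).
Proof.
move=> h h0 hc w sw cw; apply: nzl.
have k : I (kosz xs c w - l * kosz xs c0 w - a * kosz xs b' w).
  have := @kosz_congr _ I xs (fun w => c w - l * c0 w - kosz xs b w - a * b' w)
    (fun _ => 0) i iI _ w sw cw.
  rewrite kosz_zero subr0.
  rewrite (kosz_sub xs (fun w => c w - l * c0 w - kosz xs b w) (fun v => a * b' v)).
  rewrite (kosz_sub xs (fun w => c w - l * c0 w) (kosz xs b)).
  rewrite (kosz_sub xs c (fun v => l * c0 v)) !kosz_scale kosz_kosz subr0.
  by apply=> v sv cv; rewrite subr0; apply: hc.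
rewrite (_ : a * _ = (kosz xs c w - l * kosz xs c0 w - a * kosz xs b' w) -
   (kosz xs c w - a * e w) + l * (kosz xs c0 w - a * e0 w)); last by ring.
by apply: ID; [apply: idealB => //; apply: h|apply: IM; apply: h0].
Qed.

Let cobJ i c : kcobound xs J i c -> exists b b', forall w,
  size w = size xs -> count id w = i -> I (c w - kosz xs b w - a * b' w).
Proof.
move=> [b hb]; exists b.
suff /choice [b' hb'] : forall w, exists r, size w = size xs -> count id w = i ->
  I (c w - kosz xs b w - a * r) by exists b'.
move=> w; have [[sw cw]|h] := pselect (size w = size xs /\ count id w = i).
  by have [r Ir] := hb w sw cw; exists r.
by exists 0 => sw cw; case: h.
Qed.

(** Where [H^i(R / I)] vanishes, the connecting homomorphism is injective. *)
Let bound_down i c e b' : kvanish xs I i ->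
  (forall w, size w = size xs -> count id w = i.+1 -> I (kosz xs c w - a * e w)) ->
  (forall w, size w = size xs -> count id w = i.+1 -> I (e w - kosz xs b' w)) ->
  kcobound xs J i c.
Proof.
move=> van h he; have [w sw cw|b hb] := van (fun w => c w - a * b' w).
  rewrite (kosz_sub _ c (fun v => a * b' v)) kosz_scale.
  rewrite (_ : _ - _ = (kosz xs c w - a * e w) + a * (e w - kosz xs b' w)); last by ring.
  by apply: ID; [apply: h|apply/IM/he].
exists b => w sw cw; exists (b' w).
rewrite (_ : _ - _ = c w - a * b' w - kosz xs b w); last by ring.
exact: hb.
Qed.

Lemma kvanish_down i : kvanish xs I i -> kvanish xs I i.+1 -> kvanish xs J i.
Proof.
move=> van0 van1 c /connect [e /van1 [b' hb'] h].
exact: (bound_down van0 h hb').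
Qed.

(** The connecting homomorphism is onto, because [a] kills the class of [e]. *)
Let lift_ex i e : kcocycle xs I i.+1 e -> exists c, forall w,
  size w = size xs -> count id w = i.+1 -> I (kosz xs c w - a * e w).
Proof.
move=> /(kosz_kill iI xa) [c hc]; exists c => w sw cw.
by apply: ideal_sym => //; apply: hc.
Qed.

Let lift_cocycle i c e :
  (forall w, size w = size xs -> count id w = i.+1 -> I (kosz xs c w - a * e w)) ->
  kcocycle xs J i c.
Proof. by move=> h w sw cw; exists (e w); apply: h. Qed.

Let zero_lift w : I (kosz xs (fun _ => 0) w - a * 0).
Proof. by rewrite kosz_zero mulr0 subr0. Qed.

Lemma kvanish_up i : kvanish xs J i -> kvanish xs I i.+1.
Proof.
move=> van e /lift_ex [c h]; have [b [b' hb]] := cobJ (van c (lift_cocycle h)).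
exists b' => w sw cw.
have := @lift i c e b b' 0 (fun _ => 0) (fun _ => 0) h
  (fun w _ _ => zero_lift w) _ w sw cw.
by rewrite mulr0 subr0; apply => v sv cv; rewrite ?mulr0 ?subr0; apply: hb.
Qed.

Lemma kcobound_up i c e :
  (forall w, size w = size xs -> count id w = i.+1 -> I (kosz xs c w - a * e w)) ->
  kcobound xs J i c -> kcobound xs I i.+1 e.
Proof.
move=> h /cobJ [b [b' hb]]; exists b' => w sw cw.
have := @lift i c e b b' 0 (fun _ => 0) (fun _ => 0) h
  (fun w _ _ => zero_lift w) _ w sw cw.
by rewrite mulr0 subr0; apply => v sv cv; rewrite ?mulr0 ?subr0; apply: hb.
Qed.

Let kosz_comb c c0 l w : kosz xs (fun v => c v - l%:A * c0 v) w =
  kosz xs c w - l%:A * kosz xs c0 w.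
Proof. by rewrite (kosz_sub _ c (fun v => l%:A * c0 v)) kosz_scale. Qed.

Let comb_lift i c e c0 e0 l :
  (forall w, size w = size xs -> count id w = i.+1 -> I (kosz xs c w - a * e w)) ->
  (forall w, size w = size xs -> count id w = i.+1 -> I (kosz xs c0 w - a * e0 w)) ->
  (forall w, size w = size xs -> count id w = i.+1 ->
    I (kosz xs (fun v => c v - l%:A * c0 v) w - a * (e w - l%:A * e0 w))).
Proof.
move=> h h0 w sw cw; rewrite kosz_comb.
rewrite (_ : _ - _ = kosz xs c w - a * e w - l%:A * (kosz xs c0 w - a * e0 w)); last by ring.
by apply: idealB => //; [apply: h|apply/IM/h0].
Qed.

Lemma kline_down i : kvanish xs I i -> kline I i.+1 -> kline J i.
Proof.
move=> van [e0 [Ze0 Be0 ge]].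
have [c0 h0] := lift_ex Ze0.
exists c0; split; first exact: lift_cocycle h0.
  by move=> /(kcobound_up h0).
move=> c /connect [e /ge [l [b' hb']] h]; exists l.
exact: (@bound_down i (fun w => c w - l%:A * c0 w) (fun w => e w - l%:A * e0 w) b'
  van (comb_lift l h h0) hb').
Qed.

Lemma kline_up i : kvanish xs I i -> kline J i -> kline I i.+1.
Proof.
move=> van [c0 [Zc0 Bc0 gc]].
have [e0 Ze0 h0] := connect Zc0; exists e0; split=> //.
  by move=> [b' hb']; apply: Bc0; apply: (bound_down van h0 hb').
move=> e /lift_ex [c h]; have [l lc] := gc c (lift_cocycle h); exists l.
exact: (@kcobound_up i (fun w => c w - l%:A * c0 w) (fun w => e w - l%:A * e0 w)
  (comb_lift l h h0) lc).
Qed.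

End KoszulTransfer.

Section KoszulSocle.
Variables (K : fieldType) (R : comAlgType K) (xs : seq R).
Implicit Types (I J : set R) (a x y : R) (c b e : seq bool -> R) (l : K).
Local Notation n := (size xs).
Local Notation gen s := (ideal_gen [set` s]).

(** In degree 0 there are no coboundaries, and the cocycles are the elements
    killed by [xs]; so [kcocycle0] and [kcobound0] identify [H^0(R / I)] with the
    socle of [R / I]. *)
Lemma kcocycle0 I c : is_ideal I -> kcocycle xs I 0 c <->
  (forall x, x \in xs -> I (x * c (nseq n false))).
Proof. exact: kosz_count1. Qed.

Lemma kcobound0 I c : is_ideal I -> kcobound xs I 0 c <-> I (c (nseq n false)).
Proof.
move=> iI; have cf k : count id (nseq k false) = 0%N by rewrite count_nseq.
split=> [[b]|Ic].
  by move=> /(_ (nseq n false)); rewrite size_nseq cf kosz_count0 // subr0; apply.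
by exists (fun _ => 0) => w sw cw; rewrite kosz_zero subr0 (count0_nseq cw) sw.
Qed.

Hypotheses (xs1 : ~ gen xs 1) (xsK : forall r : R, exists l : K, gen xs (r - l%:A)).
Hypothesis xs_reg : forall i, (i < n)%N -> nzd xs`_i (gen (take i xs)).

Let gen_nth i : (i < n)%N -> gen xs xs`_i.
Proof. by move=> h; apply: ideal_gen_in; apply: mem_nth. Qed.

Let base_line : kline xs (gen xs) 0.
Proof.
have ig := ideal_gen_ideal [set` xs].
exists (fun _ => 1); split.
- by apply/(kcocycle0 _ ig) => x xxs; rewrite mulr1; apply: ideal_gen_in.
- by move/(kcobound0 _ ig).
- move=> c _; have [l hl] := xsK (c (nseq n false)); exists l.
  by apply/(kcobound0 _ ig); rewrite mulr1.
Qed.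

(** Removing the variables one by one, from the last to the first, moves the
    line from degree 0 up to degree [n]. *)
Let xs_coh k : (k <= n)%N ->
  (forall i, (i < k)%N -> kvanish xs (gen (take (n - k) xs)) i) /\
  kline xs (gen (take (n - k) xs)) k.
Proof.
elim: k => [_|k IHk kn]; first by rewrite subn0 take_size.
have [van lin] := IHk (ltnW kn).
have kE : (n - k = (n - k.+1).+1)%N by lia.
have ltn : (n - k.+1 < n)%N by lia.
rewrite kE ideal_gen_take // in van lin.
set I := gen (take (n - k.+1) xs) in van lin *.
have iI : is_ideal I by apply: ideal_gen_ideal.
have v0 : kvanish xs I 0.
  move=> c /(kcocycle0 _ iI) h; apply/(kcobound0 _ iI).
  by apply: (xs_reg ltn); rewrite mulrC; apply: h; apply: mem_nth.
have v i : (i < k.+1)%N -> kvanish xs I i.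
  case: i => // i ik; apply: (@kvanish_up _ _ _ _ _ iI (gen_nth ltn) (xs_reg ltn)).
  exact: van.
split=> //; apply: (@kline_up _ _ _ _ _ iI (gen_nth ltn) (xs_reg ltn)) => //.
exact: v.
Qed.

Variable f : seq R.
Hypotheses (fxs : forall i, (i < size f)%N -> gen xs f`_i)
  (f_reg : forall i, (i < size f)%N -> nzd f`_i (gen (take i f))).

(** Each regular element moves the line down by one degree. *)
Let f_coh k : (k <= n)%N -> (k <= size f)%N ->
  (forall i, (i < n - k)%N -> kvanish xs (gen (take k f)) i) /\
  kline xs (gen (take k f)) (n - k).
Proof.
elim: k => [_ _|k IHk kn kf].
  by rewrite subn0; have := xs_coh (leqnn n); rewrite subnn !take0.
have [van lin] := IHk (ltnW kn) (ltnW kf).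
rewrite ideal_gen_take //; set I := gen (take k f) in van lin *.
have iI : is_ideal I by apply: ideal_gen_ideal.
split=> [i ik|].
  apply: (@kvanish_down _ _ _ _ _ iI (f_reg kf)); apply: van; lia.
apply: (@kline_down _ _ _ _ _ iI (fxs kf) (f_reg kf)); first by apply: van; lia.
by rewrite (_ : (n - k.+1).+1 = n - k)%N //; lia.
Qed.

(** The hypothesis provides one nonzero socle element. It excludes that [f] is
    shorter than [xs], where [H^0] vanishes by [f_coh]. If [f] were longer, the
    element [f_n] of [(xs)] would annihilate the nonzero socle of
    [R / (f_0, ..., f_(n-1))], although it is regular there. *)
Lemma regular_socle_line :
  (exists c : R, ~ gen f c /\ forall x, x \in xs -> gen f (x * c)) ->
  exists c0 : R, [/\ ~ gen f c0, forall x, x \in xs -> gen f (x * c0) &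
    forall c : R, (forall x, x \in xs -> gen f (x * c)) ->
      exists l : K, gen f (c - l%:A * c0)].
Proof.
move=> [c [fc sc]].
have ig s := ideal_gen_ideal [set` (s : seq R)].
have [fn|nf|fn] := ltngtP (size f) n.
- have [+ _] := f_coh (ltnW fn) (leqnn _).
  move=> /(_ 0%N); rewrite subn_gt0 take_size => /(_ fn (fun _ => c)) h.
  exfalso; apply: fc; apply/(kcobound0 (fun _ => c) (ig f)); apply: h.
  exact/(kcocycle0 (fun _ => c) (ig f)).
- have [_] := f_coh (leqnn n) (ltnW nf); rewrite subnn.
  move=> [c0 [/(kcocycle0 _ (ig _)) s0 + _]]; case.
  apply/(kcobound0 _ (ig _)); apply: (f_reg nf); rewrite mulrC.
  move: (fxs nf); set v := c0 _ in s0 *.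
  suff : gen xs `<=` [set a | gen (take n f) (a * v)] by apply.
  apply: ideal_gen_sub; last by move=> x /= /s0.
  have [g0 gD gM] := ig (take n f).
  split; first by rewrite /= mul0r.
    by move=> x y /= hx hy; rewrite mulrDl; apply: gD.
  by move=> a x /= hx; rewrite -mulrA; apply: gM.
- have [_] := f_coh (leqnn n) (eq_leq (esym fn)).
  rewrite subnn -fn take_size => -[c0 [/(kcocycle0 _ (ig _)) s0 b0 g0]].
  exists (c0 (nseq n false)); split=> //.
    by move=> fc0; apply: b0; apply/(kcobound0 _ (ig _)).
  move=> c' sc'; have [|l] := g0 (fun _ => c'); first by apply/(kcocycle0 (fun _ => c') (ig _)).
  by move/(kcobound0 _ (ig _)) => h; exists l.
Qed.
End KoszulSocle.

(** * Power series *)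

Section Series.
Variables (n : nat) (K : fieldType).
Local Notation R := (mseries n K).
Implicit Types (f g r u : R) (k : 'I_n) (m : 'X_{1..n}) (T : pred 'I_n).

Definition serX k : R := fun m => (m == U_(k)%MM)%:R.

Lemma seriesME f g m : (f * g) m =
  \sum_(k : 'X_{1..n < (mdeg m).+1} | (k <= m)%MM) f k * g (m - k)%MM.
Proof. by []. Qed.

Lemma seriesDE f g m : (f + g) m = f m + g m. Proof. by []. Qed.
Lemma seriesNE f m : (- f) m = - f m. Proof. by []. Qed.
Lemma series1E m : (1 : R) m = (m == 0%MM)%:R. Proof. by []. Qed.
Lemma seriesZE (c : K) f m : (c *: f) m = c * f m. Proof. by []. Qed.

Lemma series_sumE (I : Type) (s : seq I) (P : pred I) (F : I -> R) m :
  (\sum_(i <- s | P i) F i) m = \sum_(i <- s | P i) F i m.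
Proof.
by elim/big_rec2: _ => // i x y _ <-; rewrite seriesDE.
Qed.

Lemma serXM k g m : (serX k * g) m = if (0 < m k)%N then g (m - U_(k))%MM else 0.
Proof.
rewrite seriesME; case: ifPn => [mk|].
  have km : (U_(k) <= m)%MM.
    by apply/mnm_lepP => j; rewrite mnm1E; case: eqP => // <-.
  have kd : (mdeg U_(k)%MM < (mdeg m).+1)%N.
    by rewrite ltnS -(submK km) mdegD leq_addl.
  rewrite (bigD1 (BMultinom kd)) //= big1 ?addr0 /serX ?eqxx ?mul1r // => i /andP[_].
  by rewrite bmeqP /= => /negPf ->; rewrite mul0r.
rewrite -leqNgt leqn0 => /eqP mk; apply: big1 => i /mnm_lepP /(_ k).
rewrite mk leqn0 => /eqP ik; rewrite /serX; case: eqP => [iE|]; last by rewrite mul0r.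
by move: ik; rewrite iE mnm1E eqxx.
Qed.

(** The ideal of the variables in [T], described by coefficients: every monomial
    of [g] involves one of them. This description makes regularity of the
    variables evident; [xideal_adj] relates it to generators. *)
Definition xideal T : set R := [set g | forall m, (forall j, T j -> m j = 0%N) -> g m = 0].

Lemma xideal_ideal T : is_ideal (xideal T).
Proof.
split=> [m _ //|f g hf hg m hm|a f hf m hm].
  by rewrite seriesDE hf ?hg ?addr0.
rewrite seriesME big1 // => i _; rewrite hf ?mulr0 // => j Tj.
by rewrite mnmBE hm.
Qed.

Lemma xideal_adj T k : xideal (predU1 k T) = ideal_adj (xideal T) (serX k).
Proof.
apply/seteqP; split.
  move=> g hg; exists (fun m => g (m + U_(k))%MM) => m hm.
  rewrite seriesDE seriesNE serXM; case: ifPn => [mk|].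
    rewrite submK ?subrr //.
    by apply/mnm_lepP => j; rewrite mnm1E; case: eqP => // <-.
  rewrite -leqNgt leqn0 => /eqP mk; rewrite hg ?subr0 // => j /=.
  by rewrite /predU1 /= => /orP[/eqP ->|/hm].
apply: ideal_adj_min; first exact: xideal_ideal.
  by move=> g hg m hm; apply: hg => j Tj; apply: hm; apply/orP; right.
move=> m hm; rewrite /serX; case: eqP => // mE.
have := hm k; rewrite /= eqxx mE mnm1E eqxx => /(_ isT) //.
Qed.

Lemma xideal_nzd T k : ~~ T k -> nzd (serX k) (xideal T).
Proof.
move=> Tk g hg m hm; have := hg (m + U_(k))%MM.
rewrite mulrC serXM mnmDE mnm1E eqxx addn1 /= addmK; apply=> j Tj.
rewrite mnmDE mnm1E hm //; case: eqP => // kj; by rewrite kj Tj in Tk.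
Qed.

Lemma xideal_ext T T' : T =1 T' -> xideal T = xideal T'.
Proof. by move=> /funext ->. Qed.

Lemma xideal0 : xideal pred0 = [set 0].
Proof.
apply/seteqP; split=> [g hg|_ -> m //].
by apply/funext => m; rewrite hg.
Qed.

Lemma xidealT : xideal predT = [set g | g 0%MM = 0].
Proof.
apply/seteqP; split=> [g|g /= g0 m hm]; first by apply=> j _; rewrite mnm0E.
by rewrite (_ : m = 0%MM) //; apply/mnmP => j; rewrite mnm0E hm.
Qed.

Lemma xideal_in T k : T k -> xideal T (serX k).
Proof.
move=> Tk m hm; rewrite /serX; case: eqP => // mE.
by have := hm k Tk; rewrite mE mnm1E eqxx.
Qed.

Lemma series_order_mul f g a b : (forall m, (mdeg m < a)%N -> f m = 0) ->
  (forall m, (mdeg m < b)%N -> g m = 0) ->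
  forall m, (mdeg m < a + b)%N -> (f * g) m = 0.
Proof.
move=> hf hg m md; rewrite seriesME big1 // => i im.
have [/hf ->|ai] := ltnP (mdeg i) a; first by rewrite mul0r.
rewrite hg ?mulr0 //; have := mdegD i (m - i)%MM; rewrite addmC submK // => E.
lia.
Qed.

Lemma series_order_exp u N : u 0%MM = 0 ->
  forall m, (mdeg m < N)%N -> (u ^+ N) m = 0.
Proof.
move=> u0; elim: N => // N IHN m md; rewrite exprS.
apply: (@series_order_mul _ _ 1 N) => //.
move=> v; rewrite ltnS leqn0 mdeg_eq0 => /eqP ->; exact: u0.
Qed.

(** The inverse of [1 - u] is the sum of the powers of [u]; in degree [m] only
    those up to [mdeg m] contribute, as [u] has no constant term. *)
Lemma series_unit g : g 0%MM != 0 -> exists r, r * g = 1.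
Proof.
move=> g0; pose u : R := 1 - (g 0%MM)^-1 *: g.
have u0 : u 0%MM = 0.
  by rewrite /u seriesDE seriesNE seriesZE series1E eqxx mulVf // subrr.
pose G : R := fun m => \sum_(k < (mdeg m).+1) (u ^+ k) m.
have GE : (1 - u) * G = 1.
  apply/funext => m; pose N := (mdeg m).+1.
  transitivity (((1 - u) * (\sum_(k < N) u ^+ k)) m).
    rewrite !seriesME; apply: eq_bigr => i im; congr (_ * _).
    rewrite series_sumE /G.
    have le : ((mdeg (m - i)).+1 <= N)%N by rewrite ltnS mdegB.
    rewrite -(subnKC le) big_split_ord /= [X in _ + X]big1 ?addr0 // => k _.
    by apply: series_order_exp => //=; rewrite ltnS leq_addr.
  rewrite -[1 - u]opprB mulNr -subrX1 opprB seriesDE seriesNE.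
  by rewrite series_order_exp // subr0.
exists ((g 0%MM)^-1 *: G).
by rewrite -scalerAl mulrC scalerAl -[RHS]GE /u opprB addrC subrK.
Qed.
End Series.

Section SeriesVars.
Variables (n : nat) (K : fieldType).
Local Notation R := (mseries n K).

Definition ser_vars : seq R := [seq serX K i | i <- enum 'I_n].

Lemma size_ser_vars : size ser_vars = n.
Proof. by rewrite size_map size_enum_ord. Qed.

Lemma nth_ser_vars k (kn : (k < n)%N) : ser_vars`_k = serX K (Ordinal kn).
Proof.
rewrite (nth_map (Ordinal kn)) ?size_enum_ord //; congr serX.
by apply: val_inj; rewrite /= nth_enum_ord.
Qed.

Lemma ideal_ser_vars k : (k <= n)%N ->
  ideal_gen [set` take k ser_vars] = xideal (fun j : 'I_n => (j < k)%N).
Proof.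
elim: k => [_|k IHk kn].
  by rewrite take0 ideal_gen_nil -xideal0; apply: xideal_ext => j.
rewrite ideal_gen_take ?size_ser_vars // IHk 1?ltnW // (nth_ser_vars kn) -xideal_adj.
by apply: xideal_ext => j; rewrite /= ltnS [RHS]leq_eqVlt.
Qed.

Lemma ideal_ser_varsT : ideal_gen [set` ser_vars] = [set g : R | g 0%MM = 0].
Proof.
rewrite -[ser_vars]take_size size_ser_vars ideal_ser_vars // -xidealT.
by apply: xideal_ext => j; rewrite ltn_ord.
Qed.

Lemma ser_vars_regular i : (i < size ser_vars)%N ->
  nzd ser_vars`_i (ideal_gen [set` take i ser_vars]).
Proof.
rewrite size_ser_vars => ni; rewrite ideal_ser_vars 1?ltnW // (nth_ser_vars ni).
by apply: xideal_nzd; rewrite -leqNgt.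
Qed.

(** A series outside the ideal of the variables is a unit. *)
Lemma proper_ideal_max (I : set R) : is_ideal I -> ~ I 1 ->
  I `<=` [set g : R | g 0%MM = 0].
Proof.
move=> [_ _ IM] I1 g Ig; apply: contrapT => /= /eqP /series_unit [r rg].
by apply: I1; rewrite -rg; apply: IM.
Qed.

End SeriesVars.

(** * Artinian complete intersections are Gorenstein *)

(** The socle of [A] pulls back to the elements of the power series ring that
    the variables multiply into [(f)], which [regular_socle_line] describes. *)
Lemma complete_intersection_gorenstein (K : fieldType) (A : comAlgType K) (m : set A) :
  artinian_local m -> is_complete_intersection A -> is_gorenstein m.
Proof.
move=> loc [n [phi [f [surj [f1 freg] kerE]]]].
pose M0 : set (mseries n K) := [set g | g 0%MM = 0].
have ker_phi g : phi g = 0 <-> ideal_gen [set` f] g.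
  by rewrite -kerE.
have im := local_ideal loc; have [_ m1 mmax] := local_max loc.
have [m0 mD mM] := im.
have pre_m g : m (phi g) -> g 0%MM = 0.
  have : [set g | m (phi g)] `<=` M0.
    apply: proper_ideal_max; last by rewrite /= rmorph1.
    split=> [|x y /= mx my|a x /= mx]; first by rewrite /= rmorph0.
      by rewrite rmorphD; apply: mD.
    by rewrite rmorphM; apply: mM.
  by apply.
have gen_ideal := ideal_gen_ideal [set` f].
(* the image of the ideal of the variables is a proper ideal containing m *)
have M0m : [set phi g | g in M0] = m.
  apply: mmax.
  - have [z0 zD zM] := @xideal_ideal n K predT; rewrite xidealT in z0 zD zM.
    split; first by exists 0; rewrite ?rmorph0.
      by move=> _ _ [x hx <-] [y hy <-]; exists (x + y); [apply: zD|rewrite rmorphD].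
    move=> a _ [x hx <-]; have [b <-] := surj a.
    by exists (b * x); [apply: zM|rewrite rmorphM].
  - by move=> y my; have [g gy] := surj y; exists g => //; apply: pre_m; rewrite gy.
  - move=> [g g0 gE]; have : ideal_gen [set` f] (1 - g).
      by apply/ker_phi; rewrite [LHS]rmorphB rmorph1 [X in _ - X](gE : phi g = 1) subrr.
    move/(proper_ideal_max gen_ideal f1) => /=.
    rewrite seriesDE seriesNE g0 subr0 series1E eqxx => /eqP.
    by rewrite oner_eq0.
have varsE := @ideal_ser_varsT n K.
have gen_xs : ideal_gen [set` ser_vars n K] = M0 by [].
have socE c : socle m (phi c) <-> forall x, x \in ser_vars n K -> ideal_gen [set` f] (x * c).
  split=> [sc x xs|sc y].
    apply/ker_phi; rewrite rmorphM; apply: sc; rewrite -M0m; exists x => //.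
    by rewrite -gen_xs; apply: ideal_gen_in.
  rewrite -M0m => -[g + <-]; rewrite -gen_xs -rmorphM => hg; apply/ker_phi.
  move: g hg; apply: ideal_gen_sub => //.
  have [z0 zD zM] := gen_ideal.
  split; first by rewrite /= mul0r.
    by move=> x z /= hx hz; rewrite mulrDl; apply: zD.
  by move=> a x /= hx; rewrite -mulrA; apply: zM.
have [c0 [nc0 sc0 gc0]] : exists c0 : mseries n K, [/\ ~ ideal_gen [set` f] c0,
    forall x, x \in ser_vars n K -> ideal_gen [set` f] (x * c0) &
    forall c : mseries n K, (forall x, x \in ser_vars n K -> ideal_gen [set` f] (x * c)) ->
      exists l : K, ideal_gen [set` f] (c - l%:A * c0)].
  apply: regular_socle_line.
  - by rewrite gen_xs /M0 /= series1E eqxx => /eqP; rewrite oner_eq0.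
  - move=> r; exists (r 0%MM); rewrite gen_xs /M0 /= seriesDE seriesNE seriesZE.
    by rewrite series1E eqxx mulr1 subrr.
  - exact: ser_vars_regular.
  - move=> i fi; rewrite gen_xs; apply: (proper_ideal_max gen_ideal f1).
    by apply: ideal_gen_in; apply: mem_nth.
  - exact: freg.
  have [b [bz sb]] := socle_above loc (oner_neq0 A).
  have [c cb] := surj (b * 1); exists c; split; last by apply/socE; rewrite cb.
  by move/ker_phi; rewrite cb => /eqP; apply/negP.
exists (fun _ => phi c0); split.
- by move=> _; apply/socE.
- move=> x; have [c <-] := surj x => /socE /gc0 [l hl].
  exists (fun _ => l); rewrite big_ord1 /=; have := (ker_phi _).2 hl.
  by rewrite mulr_algl [LHS]linearB linearZZ.
- move=> l; rewrite big_ord1 /= => lc i; rewrite ord1; apply: contrapT => /eqP l0.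
  apply: nc0; apply/ker_phi; rewrite -[phi c0]scale1r -(mulVf l0) -scalerA.
  by rewrite lc scaler0.
Qed.

(** * Counting linear relations between two operators *)

Lemma linear_lfun (K : fieldType) (aT rT : vectType K) (f : aT -> rT) :
  linear f -> exists F : 'Hom(aT, rT), F =1 f.
Proof.
move=> lf; pose L := GRing.isLinear.Build K aT rT *:%R f lf.
pose g : {linear aT -> rT} := HB.pack f L.
by exists (linfun g); apply: lfunE.
Qed.

(** The sequence [F0 -> F1/U x F1/U -> F2/U -> 0] with the maps
    [c |-> (Z c, - Y c)] and [(a, b) |-> Y a + Z b] is a complex that is exact at
    [F2/U], and [E] is the kernel of its first map. The inequality says that its
    homology in the middle has dimension at least 0, and equality means that the
    homology is 0: every relation modulo [U] is a Koszul relation. *)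
Lemma koszul_count (K : fieldType) (V : vectType K) (Y Z : 'End(V))
    (F0 F1 F2 U E : {vspace V}) :
  (forall c, Y (Z c) = Z (Y c)) ->
  (forall u, u \in U -> (Y u \in U) && (Z u \in U)) ->
  (Y @: F0 <= F1)%VS -> (Z @: F0 <= F1)%VS -> (U <= F1)%VS ->
  (Y @: F1 + Z @: F1 + U = F2)%VS ->
  (forall c, (c \in E) = [&& c \in F0, Y c \in U & Z c \in U]) ->
  (\dim F0 + \dim U + \dim F2 <= 2 * \dim F1 + \dim E)%N /\
  ((\dim F0 + \dim U + \dim F2 = 2 * \dim F1 + \dim E)%N ->
   forall a b, a \in F1 -> b \in F1 -> Y a + Z b \in U ->
   exists c, [/\ c \in F0, a - Z c \in U & b + Y c \in U]).
Proof.
move=> YZ YZU YF ZF UF F2E EE.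
have [kap kapE] : exists F : 'Hom(V, (V * V)%type), F =1 (fun c => (Z c, - Y c)).
  apply: linear_lfun => k x y; congr pair; rewrite linearP //=.
  by rewrite opprD scalerN.
have [pii piiE] : exists F : 'Hom((V * V)%type, V), F =1 (fun p => Y p.1 + Z p.2).
  apply: linear_lfun => k x y; rewrite !linearP /= scalerDr.
  by rewrite addrACA.
have [il ilE] : exists F : 'Hom(V, (V * V)%type), F =1 (fun c => (c, 0)).
  by apply: linear_lfun => k x y; congr pair; rewrite /= scaler0 addr0.
have [ir irE] : exists F : 'Hom(V, (V * V)%type), F =1 (fun c => (0, c)).
  by apply: linear_lfun => k x y; congr pair; rewrite /= scaler0 addr0.
pose sq (W : {vspace V}) := (il @: W + ir @: W)%VS.
have sqP W p : (p \in sq W) = (p.1 \in W) && (p.2 \in W).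
  apply/idP/andP => [/memv_addP [_ /memv_imgP [a aW ->] [_ /memv_imgP [b bW ->] ->]]|].
    by rewrite ilE irE /= addr0 add0r.
  case: p => a b /= [aW bW].
  rewrite (_ : (a, b) = il a + ir b); last by rewrite ilE irE; congr pair; rewrite /= ?addr0 ?add0r.
  by apply: memv_add; apply: memv_img.
have dim_sq W : \dim (sq W) = (2 * \dim W)%N.
  rewrite dimv_disjoint_sum ?limg_dim_eq ?addnn ?mul2n //.
  - apply/eqP; rewrite -subv0; apply/subvP => x /memv_capP [_].
    by rewrite memv_ker irE memv0 => /eqP [->].
  - apply/eqP; rewrite -subv0; apply/subvP => x /memv_capP [_].
    by rewrite memv_ker ilE memv0 => /eqP [->].
  - apply/eqP; rewrite -subv0; apply/subvP => x /memv_capP [].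
    move=> /memv_imgP [a _ ->] /memv_imgP [b _]; rewrite ilE irE memv0 => -[-> _].
    by [].
(* the relations modulo U; below, T is the space of the Koszul relations *)
pose Zs := (sq F1 :&: (pii @^-1: U))%VS.
have piF : (pii @: sq F1 + U = F2)%VS.
  rewrite -F2E; congr (_ + U)%VS; apply/eqP; rewrite eqEsubv; apply/andP; split.
    apply/subvP => _ /memv_imgP [p + ->]; rewrite sqP piiE => /andP[p1 p2].
    by apply: memv_add; apply: memv_img.
  rewrite subv_add; apply/andP; split; apply/subvP => _ /memv_imgP [a aF ->].
    rewrite (_ : Y a = pii (a, 0)); last by rewrite piiE /= linear0 addr0.
    by apply: memv_img; rewrite sqP /= aF mem0v.
  rewrite (_ : Z a = pii (0, a)); last by rewrite piiE /= linear0 add0r.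
  by apply: memv_img; rewrite sqP /= aF mem0v.
have piZ : (pii @: Zs = pii @: sq F1 :&: U)%VS.
  apply/eqP; rewrite eqEsubv; apply/andP; split; apply/subvP => x.
    case/memv_imgP => p /memv_capP [pF]; rewrite -memv_preim => pU ->.
    by apply/memv_capP; split=> //; apply: memv_img.
  case/memv_capP => /memv_imgP [p pF ->] pU.
  by apply: memv_img; apply/memv_capP; rewrite -memv_preim.
have dimZ : (\dim Zs + \dim F2 = 2 * \dim F1 + \dim U)%N.
  have h1 := limg_ker_dim pii Zs; have h2 := limg_ker_dim pii (sq F1).
  have h3 := dimv_sum_cap (pii @: sq F1) U; rewrite piF in h3.
  have E1 : (Zs :&: lker pii = sq F1 :&: lker pii)%VS.
    apply/vspaceP => p; rewrite !memv_cap -memv_preim memv_ker.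
    by case: eqP => [->|]; rewrite ?mem0v ?andbT ?andbF.
  rewrite piZ E1 in h1; rewrite dim_sq in h2; lia.
pose T := (kap @: F0 + sq U)%VS.
have TZ : (T <= Zs)%VS.
  rewrite subv_add; apply/andP; split; apply/subvP => p.
    case/memv_imgP => c cF ->; rewrite memv_cap sqP -memv_preim piiE kapE /=.
    have Zc : Z c \in F1 by apply: (subvP ZF); apply: memv_img.
    have Yc : Y c \in F1 by apply: (subvP YF); apply: memv_img.
    by rewrite memvN Zc Yc linearN /= YZ subrr mem0v.
  move=> pU; have /andP[p1 p2] : (p.1 \in U) && (p.2 \in U) by rewrite -sqP.
  rewrite memv_cap sqP -memv_preim piiE.
  rewrite !(subvP UF) //=.
  have /andP[Y1 _] := YZU _ p1; have /andP[_ Z2] := YZU _ p2.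
  by rewrite memvD.
have dimT : (\dim T + \dim E = \dim F0 + 2 * \dim U)%N.
  have := dimv_sum_cap (kap @: F0) (sq U); rewrite -/T dim_sq.
  have -> : (kap @: F0 :&: sq U = kap @: E)%VS.
    apply/vspaceP => p; apply/memv_capP/memv_imgP.
      case=> /memv_imgP [c cF ->]; rewrite sqP kapE /= memvN => /andP[ZU YU].
      by exists c; rewrite ?kapE // EE cF YU.
    case=> c; rewrite EE => /and3P[cF YU ZU] ->; rewrite memv_img // sqP kapE /=.
    by rewrite memvN ZU YU.
  have := limg_ker_dim kap F0; have := limg_ker_dim kap E.
  have -> : (E :&: lker kap = F0 :&: lker kap)%VS.
    apply/vspaceP => c; rewrite !memv_cap EE memv_ker kapE.
    case: eqP => [[->]|]; rewrite ?andbF // => /eqP.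
    by rewrite oppr_eq0 => /eqP ->; rewrite mem0v !andbT.
  lia.
split=> [|Eq a b aF bF abU]; first by have := dimvS TZ; lia.
have TZE : T == Zs by rewrite eqEdim TZ; lia.
have : (a, b) \in T by rewrite (eqP TZE) memv_cap sqP -memv_preim piiE /= aF bF.
case/memv_addP => _ /memv_imgP [c cF ->] [u]; rewrite sqP => /andP[u1 u2].
rewrite kapE => -[-> ->]; exists c; split=> //.
  by rewrite addrAC subrr add0r.
by rewrite addrAC addNr add0r.
Qed.

(** * Maximal growth from degree two to degree three *)

Section ImgDim.
Variables (K : fieldType) (V1 V2 : vectType K) (f : 'Hom(V1, V2)).

Lemma dim_img_preim (W : {vspace V1}) (S : {vspace V2}) :
  (\dim (f @: W + S) + \dim (W :&: f @^-1: S) = \dim W + \dim S)%N.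
Proof.
have E1 : (f @: (W :&: f @^-1: S) = f @: W :&: S)%VS.
  apply/eqP; rewrite eqEsubv; apply/andP; split; apply/subvP => x.
    case/memv_imgP => p /memv_capP [pF]; rewrite -memv_preim => pU ->.
    by apply/memv_capP; split=> //; apply: memv_img.
  case/memv_capP => /memv_imgP [p pF ->] pU.
  by apply: memv_img; apply/memv_capP; rewrite -memv_preim.
have E2 : (W :&: f @^-1: S :&: lker f = W :&: lker f)%VS.
  apply/vspaceP => p; rewrite !memv_cap -memv_preim memv_ker.
  by case: eqP => [->|]; rewrite ?mem0v ?andbT ?andbF.
have h1 := limg_ker_dim f W; have h2 := limg_ker_dim f (W :&: f @^-1: S).
have h3 := dimv_sum_cap (f @: W) S; rewrite E1 E2 in h2; lia.
Qed.
End ImgDim.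

Section VspaceExtra.
Variables (K : fieldType) (V : vectType K).
Implicit Types (U W : {vspace V}).

Lemma addvAC U1 U2 U3 : (U1 + U2 + U3 = U1 + U3 + U2)%VS.
Proof. by rewrite -!addvA [(U2 + U3)%VS]addvC. Qed.

Lemma dim_add_line U v : v \notin U -> \dim (U + <[v]>) = (\dim U).+1.
Proof.
move=> vU; have v0 : v != 0 by apply: contraNneq vU => ->; rewrite mem0v.
rewrite dimv_disjoint_sum ?dim_vline ?v0 ?addn1 //.
apply/eqP; rewrite -subv0; apply/subvP => x /memv_capP [xU /vlineP [k xE]]; move: xU; rewrite {}xE.
have [->|k0] := eqVneq k 0; first by move=> _; rewrite scale0r mem0v.
move=> kv; case/negP: vU; rewrite -[v]scale1r -(mulVf k0) -scalerA; exact: memvZ.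
Qed.

Lemma dim_addl_le U v : (\dim (U + <[v]>) <= (\dim U).+1)%N.
Proof.
case: (boolP (v \in U)) => [vU|/dim_add_line ->//].
by rewrite (addv_idPl vU) leqW.
Qed.

Lemma ex_notin U W : (\dim U < \dim W)%N -> exists2 v, v \in W & v \notin U.
Proof.
move=> UW; apply/subvPn; apply/negP => /dimvS; lia.
Qed.

End VspaceExtra.

(** Here [d2], [d3], [d4] are the dimensions of [m^2], [m^3], [m^4], [q] is that
    of [m^2 l + m^4] and [s] that of the kernel of multiplication by [l] from
    [m^2] to [m^3 / m^4]. If the image has codimension at most one, it has
    dimension 3 over [m^4], so the kernel is no larger than [m^3]. *)
Lemma quad_arith (s q qw d2 d3 d4 : nat) : d2 = (d3 + 3)%N -> d3 = (d4 + 4)%N ->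
  (d3 <= qw)%N -> (qw <= q.+1)%N -> (q + s = d2 + d4)%N -> (s <= d3)%N.
Proof. by lia. Qed.

Lemma quad_arith2 (a b c : nat) : a = (b + 3)%N -> (b + 2 <= c)%N -> (a <= c.+1)%N.
Proof. by lia. Qed.

Lemma quad_arith3 (a b : nat) : a = (b + 3)%N -> (a <= b.+3)%N.
Proof. by lia. Qed.

Section SpecialElement.
Variables (K : fieldType) (A : falgType K) (M : {vspace A}).
Hypothesis hC : forall a b : A, a * b = b * a.
Hypothesis Mideal : (fullv * M <= M)%VS.
Implicit Types (a b c l x y z : A).

Lemma prodvC (U W : {vspace A}) : (U * W = W * U)%VS.
Proof.
by apply/eqP; rewrite eqEsubv; apply/andP; split; apply/prodvP => u v hu hv;
  rewrite hC memv_mul.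
Qed.

Lemma expv_ideal t : (fullv * M ^+ t.+1 <= M ^+ t.+1)%VS.
Proof. by rewrite expvSl prodvA; apply: prodvSl. Qed.

Lemma expv_decr t : (M ^+ t.+2 <= M ^+ t.+1)%VS.
Proof.
rewrite expvSl; apply: subv_trans (expv_ideal t); apply: prodvSl; exact: subvf.
Qed.

Lemma expv_le t u : (0 < t <= u)%N -> (M ^+ u <= M ^+ t)%VS.
Proof.
case: t => // t /subnK <-; elim: (u - t.+1)%N => // k; rewrite addSn addnS => IH.
exact: subv_trans (expv_decr _) IH.
Qed.

Lemma memv_mulC (U W S : {vspace A}) a b :
  a \in U -> b \in W -> (U * W <= S)%VS -> a * b \in S.
Proof. by move=> aU bW /subvP; apply; apply: memv_mul. Qed.

Hypothesis dim1 : (\dim M = \dim (M ^+ 2) + 3 :> nat)%N.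
Hypothesis dim2 : (\dim (M ^+ 2) = \dim (M ^+ 3) + 3 :> nat)%N.
Hypothesis dim3 : (\dim (M ^+ 3) = \dim (M ^+ 4) + 4 :> nat)%N.

(** The multiples of [l] in degrees 2 and 3, together with the next power. *)
Let P l : {vspace A} := (M * <[l]> + M ^+ 3)%VS.
Let Q l : {vspace A} := (M ^+ 2 * <[l]> + M ^+ 4)%VS.

Let P2 l : l \in M -> (P l <= M ^+ 2)%VS.
Proof.
move=> lm; rewrite subv_add; apply/andP; split; last exact: expv_le.
by rewrite expv2; apply: prodvSr.
Qed.

Let MP l : (M * P l <= Q l)%VS.
Proof. by rewrite prodvDr prodvA -expv2 -expvSl. Qed.

Let dimP l : (\dim (P l) + \dim (M :&: amulr l @^-1: (M ^+ 3)) = \dim M + \dim (M ^+ 3))%N.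
Proof. by rewrite /P -limg_amulr dim_img_preim. Qed.

Let dimQ l : (\dim (Q l) + \dim (M ^+ 2 :&: amulr l @^-1: (M ^+ 4)) = \dim (M ^+ 2) + \dim (M ^+ 4))%N.
Proof. by rewrite /Q -limg_amulr dim_img_preim. Qed.

Let amulrE l c : amulr l c = c * l. Proof. by rewrite lfunE. Qed.

Let lM3 l c : l \in M -> c \in (M ^+ 3)%VS -> c * l \in (M ^+ 4)%VS.
Proof.
by move=> lm cm; apply: (memv_mulC cm lm); rewrite -expvSr.
Qed.

(** If the multiples of [l] filled degree 2, they would also fill degree 3; but
    they are the image of a space of dimension 3, and degree 3 has dimension
    4. *)
Let P_proper l : l \in M -> ~~ (M ^+ 2 <= P l)%VS.
Proof.
move=> lm; apply/negP => h.
have h3 : (M ^+ 3 <= Q l)%VS.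
  by rewrite expvSl; apply: subv_trans (MP l); apply: prodvSr.
have h4 : (M ^+ 3 <= M ^+ 2 :&: amulr l @^-1: (M ^+ 4))%VS.
  apply/subvP => c cm; rewrite memv_cap (subvP (expv_le (isT : (0 < 2 <= 3)%N))) //=.
  by rewrite -memv_preim amulrE lM3.
have := dimQ l; have := dimvS h3; have := dimvS h4; lia.
Qed.

(** When [P l] has codimension one in [M ^+ 2], the products of [y] and [z] form
    a symmetric bilinear form with values in a line, and this form is not zero.
    If [q] spans the line, degree 3 is spanned by [y * q] and [z * q] modulo
    [Q l], and these two are dependent: when [q] is a square [y * y] and
    [y * z] is a multiple [k *: q], then [z * q = y * (y * z)] is [k] times
    [y * q]; when both squares vanish and [q = y * z], then [y * q] vanishes. *)
Let quad l y z : l \in M -> y \in M -> z \in M ->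
  (M <= M ^+ 2 + <[l]> + <[y]> + <[z]>)%VS ->
  (\dim (M ^+ 3) + 2 <= \dim (P l))%N ->
  exists w, (M ^+ 3 <= Q l + <[w]>)%VS.
Proof.
move=> lm ym zm gen dP.
have My q : q \in (M ^+ 2)%VS -> q \notin P l ->
    (M ^+ 3 <= Q l + <[y * q]> + <[z * q]>)%VS.
  move=> q2 qP; have MPq : (M ^+ 2 <= P l + <[q]>)%VS.
    suff /eqP <- : (P l + <[q]> == M ^+ 2)%VS by [].
    rewrite eqEdim (dim_add_line qP); apply/andP; split.
      by rewrite subv_add P2.
    exact: quad_arith2 dim2 dP.
  rewrite expvSl; apply: subv_trans (prodvSr _ MPq) _; rewrite prodvDr.
  rewrite subv_add; apply/andP; split.
    by apply: subv_trans (MP l) _; rewrite -addvA addvSl.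
  apply: subv_trans (prodvSl _ gen) _; rewrite !prodvDl !prodv_line !subv_add.
  have QS (X : {vspace A}) : (X <= Q l)%VS -> (X <= Q l + <[y * q]> + <[z * q]>)%VS.
    by move=> XQ; rewrite -addvA; apply: subv_trans XQ (addvSl _ _).
  apply/andP; split; last exact: addvSr.
  apply/andP; split; last by rewrite addvAC; apply: addvSr.
  apply/andP; split; apply: QS.
    apply: subv_trans (addvSr _ _); rewrite (expvD M 2 2); exact: prodvSr.
  apply: subv_trans (addvSl _ _); rewrite hC -prodv_line; exact: prodvSl.
have yM q : q \in P l -> y * q \in Q l.
  by move=> qP; apply: memv_mulC ym qP (MP l).
have zM q : q \in P l -> z * q \in Q l.
  by move=> qP; apply: memv_mulC zm qP (MP l).
have mm2 a b : a \in M -> b \in M -> a * b \in (M ^+ 2)%VS.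
  by move=> am bm; rewrite expv2 memv_mul.
(* b * q = a * (a * b) is a multiple of a * q, modulo Q l *)
have step q a b : q \in (M ^+ 2)%VS -> q \notin P l -> a \in M -> b \in M ->
    q = a * a -> (M ^+ 3 <= Q l + <[a * q]> + <[b * q]>)%VS ->
    (forall p, p \in P l -> a * p \in Q l) ->
    exists w, (M ^+ 3 <= Q l + <[w]>)%VS.
  move=> q2 qP am bm qE Mq aP; exists (a * q).
  apply: subv_trans Mq _; rewrite subv_add subvv /=.
  have MPq : (M ^+ 2 <= P l + <[q]>)%VS.
    suff /eqP <- : (P l + <[q]> == M ^+ 2)%VS by [].
    rewrite eqEdim (dim_add_line qP); apply/andP; split.
      by rewrite subv_add P2.
    exact: quad_arith2 dim2 dP.
  have /(subvP MPq) /memv_addP [p pP [_ /vlineP [k ->] abE]] := mm2 _ _ am bm.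
  have E : b * q = a * p + k *: (a * q).
    by rewrite {1}qE mulrA [b * a]hC abE mulrDl -scalerAl [p * a]hC [q * a]hC.
  rewrite -memvE E; apply: memv_add; first exact: aP.
  by apply: memvZ; apply: memv_line.
have [yyP|yyP] := boolP (y * y \in P l); last first.
  by apply: (step (y * y) y z) => //; [apply: mm2|apply: My => //; apply: mm2].
have [zzP|zzP] := boolP (z * z \in P l); last first.
  apply: (step (z * z) z y) => //; first exact: mm2.
  by rewrite addvAC; apply: My => //; apply: mm2.
have [yzP|yzP] := boolP (y * z \in P l); last first.
  exists (z * (y * z)); apply: subv_trans (My _ (mm2 _ _ ym zm) yzP) _.
  rewrite subv_add; apply/andP; split; last exact: addvSr.
  rewrite subv_add addvSl /= mulrA -memvE hC.
  by apply: (subvP (addvSl _ _)); apply: zM.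
(* now the form is zero, so that P l is all of M ^+ 2 *)
exfalso; have /negP := P_proper lm; apply.
rewrite expv2; apply: subv_trans (prodvSl _ gen) _; rewrite !prodvDl !subv_add.
have PM a : a \in M -> (forall b, b \in [:: l; y; z] -> a * b \in P l) ->
    (<[a]> * M <= P l)%VS.
  move=> am h; apply: subv_trans (prodvSr _ gen) _; rewrite !prodvDr !subv_add.
  rewrite !prodv_line -!memvE !h ?inE ?eqxx ?orbT // !andbT.
  apply: subv_trans (addvSr _ _); rewrite prodvC (expvSr M 2); exact: prodvSr.
have lP a : a \in M -> a * l \in P l.
  by move=> am; apply: (subvP (addvSl _ _)); apply: memv_mul => //; apply: memv_line.
apply/andP; split; [apply/andP; split; [apply/andP; split|]|].
- by apply: subv_trans (addvSr _ _); rewrite -expvSr.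
- by rewrite prodvC; apply: addvSl.
- apply: PM => // b; rewrite !inE => /or3P[] /eqP -> //; exact: lP.
- apply: PM => // b; rewrite !inE => /or3P[] /eqP -> //; first exact: lP.
  by rewrite hC.
Qed.

(** An [l] with two independent multiples in degree 2 kills a linear form [x] in
    degree 2, and by [quad] it is injective from degree 2 to degree 3. For [v] in
    [M], [(x * v) * l = (x * l) * v] vanishes in degree 3, hence [x * v] vanishes
    in degree 2. *)
Let special_of l : l \in M -> (\dim (M ^+ 3) + 2 <= \dim (P l))%N ->
  exists x, [/\ x \in M, x \notin (M ^+ 2)%VS & (<[x]> * M <= M ^+ 3)%VS].
Proof.
move=> lm dP.
have dPl : \dim (P l) = (\dim (M ^+ 3) + 2)%N :> nat.
  have /dimv_leqif_eq := P2 lm; case=> le eq.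
  have : P l != (M ^+ 2)%VS by apply: contra (P_proper lm) => /eqP ->.
  by move: eq; case: (P l =P _) => // _; lia.
have [x] : exists2 x, x \in (M :&: amulr l @^-1: (M ^+ 3))%VS & x \notin (M ^+ 2)%VS.
  by apply: ex_notin; have := dimP l; lia.
rewrite memv_cap -memv_preim amulrE => /andP[xm xl] x2.
exists x; split=> //.
have l2 : l \notin (M ^+ 2)%VS.
  apply/negP => l2; have : (P l <= M ^+ 3)%VS.
    by rewrite subv_add subvv andbT expvSl; apply: prodvSr.
  by move/dimvS; lia.
have [y ym yn] : exists2 y, y \in M & y \notin (M ^+ 2 + <[l]>)%VS.
  by apply: ex_notin; rewrite dim_add_line //; lia.
have [z zm zn] : exists2 z, z \in M & z \notin (M ^+ 2 + <[l]> + <[y]>)%VS.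
  by apply: ex_notin; rewrite !dim_add_line //; lia.
have [|w hw] := quad lm ym zm _ dP.
  suff /eqP E : (M ^+ 2 + <[l]> + <[y]> + <[z]> == M)%VS by rewrite E.
  rewrite eqEdim !dim_add_line //; apply/andP; split; last exact: quad_arith3.
  by rewrite !subv_add -!memvE ym zm lm !andbT; apply: (@expv_le 1).
have inj c : c \in (M ^+ 2)%VS -> c * l \in (M ^+ 4)%VS -> c \in (M ^+ 3)%VS.
  move=> c2 cl; pose S := (M ^+ 2 :&: amulr l @^-1: (M ^+ 4))%VS.
  have S3 : (M ^+ 3 <= S)%VS.
    apply/subvP => d dm; rewrite memv_cap (subvP (expv_le (isT : (0 < 2 <= 3)%N))) //=.
    by rewrite -memv_preim amulrE lM3.
  suff /eqP -> : (M ^+ 3 == S)%VS by rewrite memv_cap c2 -memv_preim amulrE.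
  rewrite eqEdim S3 /=.
  exact: (quad_arith dim2 dim3 (dimvS hw) (dim_addl_le _ _) (dimQ l)).
apply/prodvP => _ v /vlineP [k ->] vm; rewrite -scalerAl; apply: memvZ.
apply: inj; first by rewrite expv2 memv_mul.
rewrite -mulrA [v * l]hC mulrA; apply: (memv_mulC xl vm); by rewrite -expvSr.
Qed.

(** The Hilbert function (1, 3, 3, 4, ...) grows maximally from degree 2 to
    degree 3, which forces a linear form that vanishes in degree 2 after
    multiplication by any other. Without an [l] as in [special_of], each [P l]
    is at most a line modulo [M ^+ 3]. For generators [a], [b], [c], the three
    lines [P a], [P b], [P c] then span degree 2 and are independent, so
    [a * b] lies in the intersection of two of them and vanishes, as do
    [a * c] and [b * c]; hence [P (a + b)] contains the squares of [a] and [b],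
    and is not a line. *)
Lemma special_element :
  exists x, [/\ x \in M, x \notin (M ^+ 2)%VS & (<[x]> * M <= M ^+ 3)%VS].
Proof.
apply: contrapT => nex.
have dP l : l \in M -> (\dim (P l) <= (\dim (M ^+ 3)).+1)%N.
  move=> lm; rewrite leqNgt; apply/negP => h; apply: nex.
  by apply: (special_of lm); lia.
(* two lines do not span degree 2 *)
have two S T : (\dim S <= (\dim (M ^+ 3)).+1)%N -> (\dim T <= (\dim (M ^+ 3)).+1)%N ->
    (M ^+ 3 <= S)%VS -> (M ^+ 3 <= T)%VS -> (M ^+ 2 <= S + T)%VS -> False.
  move=> dS dT S3 T3 /dimvS ST; have := dimv_sum_cap S T.
  have : (M ^+ 3 <= S :&: T)%VS by rewrite subv_cap S3.
  by move/dimvS; lia.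
have P3 l : (M ^+ 3 <= P l)%VS by apply: addvSr.
have [a am an] : exists2 a, a \in M & a \notin (M ^+ 2)%VS by apply: ex_notin; lia.
have [b bm bn] : exists2 b, b \in M & b \notin (M ^+ 2 + <[a]>)%VS.
  by apply: ex_notin; rewrite dim_add_line //; lia.
have [c cm cn] : exists2 c, c \in M & c \notin (M ^+ 2 + <[a]> + <[b]>)%VS.
  by apply: ex_notin; rewrite !dim_add_line //; lia.
have gen : (M <= M ^+ 2 + <[a]> + <[b]> + <[c]>)%VS.
  suff /eqP E : (M ^+ 2 + <[a]> + <[b]> + <[c]> == M)%VS by rewrite E.
  rewrite eqEdim !dim_add_line //; apply/andP; split; last exact: quad_arith3.
  by rewrite !subv_add -!memvE am bm cm !andbT; apply: (@expv_le 1).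
have all3 : (M ^+ 2 <= P a + P b + P c)%VS.
  rewrite expv2; apply: subv_trans (prodvSr _ gen) _; rewrite !prodvDr !subv_add.
  rewrite -expvSl (subv_trans (P3 c) _) /=; last first.
    by apply: subv_trans (addvSr _ _); apply: subvv.
  apply/andP; split; last by apply: subv_trans (addvSr _ _); apply: addvSl.
  apply/andP; split; apply: subv_trans (addvSl _ _).
    by apply: subv_trans (addvSl _ _); apply: addvSl.
  by apply: subv_trans (addvSr _ _); apply: addvSl.
have lP l v : v \in M -> l \in M -> v * l \in P l.
  by move=> vm lm; apply: (subvP (addvSl _ _)); apply: memv_mul => //; apply: memv_line.
(* if l * l' did not vanish, the lines of l and l' would coincide *)
have merge l l' m : l \in M -> l' \in M -> m \in M ->
   (M ^+ 2 <= P l + P l' + P m)%VS -> l * l' \in (M ^+ 3)%VS.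
  move=> lm lm' mm h; apply: contrapT => /negP ll.
  have PE u : u \in M -> l * l' \in P u -> P u = (M ^+ 3 + <[l * l']>)%VS.
    move=> um lu; apply/esym/eqP; rewrite eqEdim subv_add P3 -memvE lu /=.
    by rewrite dim_add_line // dP.
  apply: (two (P l) (P m) (dP _ lm) (dP _ mm) (P3 _) (P3 _)); apply: subv_trans h _.
  have E1 : P l = (M ^+ 3 + <[l * l']>)%VS by apply: PE => //; rewrite hC; apply: lP.
  have E2 : P l' = (M ^+ 3 + <[l * l']>)%VS by apply: PE => //; apply: lP.
  by rewrite E2 -E1 addvv; apply: subvv.
have ab : a * b \in (M ^+ 3)%VS by apply: (merge a b c).
have ac : a * c \in (M ^+ 3)%VS by apply: (merge a c b) => //; rewrite addvAC.
have bc : b * c \in (M ^+ 3)%VS.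
  by apply: (merge b c a) => //; rewrite addvC addvA.
have sq u v w : u \in M -> v \in M -> w \in M -> (M <= M ^+ 2 + <[u]> + <[v]> + <[w]>)%VS ->
    u * v \in (M ^+ 3)%VS -> u * w \in (M ^+ 3)%VS -> (P u <= P (u + v)%R)%VS.
  move=> um vm wm g uv uw; rewrite subv_add P3 andbT.
  apply: subv_trans (prodvSl _ g) _; rewrite !prodvDl !prodv_line !subv_add.
  apply/andP; split; [apply/andP; split; [apply/andP; split|]|].
  - apply: subv_trans (P3 _); rewrite (expvSr M 2); exact: prodvSr.
  - rewrite -memvE -[u * u](addrK (u * v)) -mulrDr memvB //.
      by apply: lP => //; apply: memvD.
    exact: (subvP (P3 _)).
  - by rewrite -memvE hC; apply: (subvP (P3 _)).
  - by rewrite -memvE hC; apply: (subvP (P3 _)).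
have abm : a + b \in M by apply: memvD.
apply: (two (P (a + b)) (P c) (dP _ abm) (dP _ cm) (P3 _) (P3 _)).
apply: subv_trans all3 _; apply: addvS (subvv _); rewrite subv_add.
apply/andP; split; first exact: (sq a b c).
rewrite addrC; apply: (sq b a c) => //; last by rewrite hC.
by rewrite (addvAC _ <[b]>).
Qed.
End SpecialElement.

(** * Falls of Gorenstein Hilbert functions *)

Lemma subspace_vspace (K : fieldType) (V : vectType K) (P : set V) :
  is_subspace P -> exists W : {vspace V}, forall x, (x \in W) <-> P x.
Proof.
move=> [P0 PL].
pose Q (d : nat) := `[< exists W : {vspace V}, \dim W = d /\ (forall x, x \in W -> P x) >].
have Qex : exists d, Q d.
  by exists 0%N; apply/asboolP; exists 0%VS; split=> [|x]; rewrite ?dimv0 // memv0 => /eqP ->.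
have Qb d : Q d -> (d <= \dim {:V})%N by move=> /asboolP [W [<- _]]; apply/dimvS/subvf.
case: (ex_maxnP Qex Qb) => d /asboolP [W [dW WP]] dmax.
exists W => x; split=> [|Px]; first exact: WP.
apply: contrapT => /negP xW.
have : Q (\dim (W + <[x]>)).
  apply/asboolP; exists (W + <[x]>)%VS; split=> // y.
  move=> /memv_addP [w /WP Pw [_ /vlineP [k ->] ->]].
  by rewrite addrC; apply: PL.
by move/dmax; rewrite dim_add_line // dW ltnn.
Qed.

(** The inequality [dim F_t + dim F_(t+2) <= 2 dim F_(t+1) + 1] bounds a second
    difference of dimensions, that is, a fall of the Hilbert function. The
    lemmas below carry out this translation; in the last two, the dimension of
    [F_t] exceeds that of [m^t] by one when [j < t]. *)
Lemma koszul_arith1 (f0 f1 f2 u e : nat) : (f0 + u + f2 <= 2 * f1 + e)%N ->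
  (e <= u.+1)%N -> (f0 + f2 <= 2 * f1 + 1)%N.
Proof. lia. Qed.

Lemma koszul_arith2 (f0 f1 f2 u e : nat) : (f0 + u + f2 <= 2 * f1 + e)%N ->
  (e <= u.+1)%N -> (f0 + f2)%N = (2 * f1 + 1)%N -> (f0 + u + f2)%N = (2 * f1 + e)%N.
Proof. lia. Qed.

Lemma falls_arith1 (a b c h0 h1 : nat) : a = (b + h0)%N -> b = (c + h1)%N ->
  (a + c <= 2 * b + 1)%N -> (h0 <= h1 + 1)%N.
Proof. lia. Qed.

Lemma falls_arith2 (a b c h0 h1 t j : nat) : a = (b + h0)%N -> b = (c + h1)%N ->
  (t.+1 < j)%N ->
  (a + (j < t) + (c + (j < t.+2)) != 2 * (b + (j < t.+1)) + 1)%N ->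
  (a + (j < t) + (c + (j < t.+2)) <= 2 * (b + (j < t.+1)) + 1)%N ->
  ((t < j)%N -> (h0 <= h1)%N) /\ (h0 <= h1 + 1 + (t == j))%N.
Proof. by lia. Qed.

Lemma falls_arith3 (a b c h0 h1 t j : nat) : a = (b + h0)%N -> b = (c + h1)%N ->
  ~~ (t.+1 < j)%N ->
  (a + (j < t) + (c + (j < t.+2)) <= 2 * (b + (j < t.+1)) + 1)%N ->
  ((t < j)%N -> (h0 <= h1)%N) /\ (h0 <= h1 + 1 + (t == j))%N.
Proof. by lia. Qed.

Section GorensteinFalls.
Variables (K : fieldType) (A : falgType K) (M : {vspace A}).
Hypothesis hC : forall a b : A, a * b = b * a.
Hypothesis Mideal : (fullv * M <= M)%VS.
Hypothesis Mfull : (fullv <= <[1]> + M)%VS.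
Variable N0 : nat.
Hypothesis Mnil : (M ^+ N0.+1 = 0)%VS.
Variable phi : 'Hom(A, K^o).
Hypothesis phi_nondeg : forall a, (forall b, phi (a * b) = 0) -> a = 0.
Implicit Types (a b c u x y z : A).

Let M_t t := (M ^+ t)%VS.
Let powM (t u : nat) a b : a \in M_t t -> b \in M_t u -> a * b \in M_t (t + u).
Proof. by move=> ha hb; rewrite /M_t expvD memv_mul. Qed.

Let pow_le (t u : nat) a : (0 < t <= u)%N -> a \in M_t u -> a \in M_t t.
Proof. by move=> tu; apply: (subvP (expv_le Mideal tu)). Qed.

Variables (x y z : A).
Hypotheses (xM : x \in M) (yM : y \in M) (zM : z \in M).
Hypothesis xM3 : (<[x]> * M <= M ^+ 3)%VS.
Hypothesis Mgen : (M <= M ^+ 2 + <[x]> + <[y]> + <[z]>)%VS.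

Let Y := amulr y.
Let Z := amulr z.
Let YE c : Y c = y * c. Proof. by rewrite lfunE /= hC. Qed.
Let ZE c : Z c = z * c. Proof. by rewrite lfunE /= hC. Qed.
Let YW (W : {vspace A}) : (Y @: W = <[y]> * W)%VS.
Proof. by rewrite limg_amulr (prodvC hC). Qed.
Let ZW (W : {vspace A}) : (Z @: W = <[z]> * W)%VS.
Proof. by rewrite limg_amulr (prodvC hC). Qed.

(** [1] and [B1] span a subalgebra of codimension one. Its maximal ideal [B1] is
    generated by [y] and [z] and has the same powers as [M] from the second
    on. *)
Let B1 : {vspace A} := (M ^+ 2 + <[y]> + <[z]>)%VS.

(** As [x * M] lies in [M ^+ 3], the generator [x] can be dropped at the price of
    a term one degree higher, and the powers of [M] vanish eventually. *)
Let M_yz t : (2 <= t)%N -> (M_t t.+1 <= Y @: M_t t + Z @: M_t t)%VS.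
Proof.
move=> t2.
have step (u : nat) : (2 <= u)%N -> (M_t u.+1 <= Y @: M_t u + Z @: M_t u + M_t u.+2)%VS.
  move=> u2; rewrite /M_t expvSl; apply: subv_trans (prodvSl _ Mgen) _.
  rewrite !prodvDl !subv_add YW ZW -expvD.
  apply/andP; split; last by rewrite (addvAC (_ * _)%VS); apply: addvSr.
  apply/andP; split; last by rewrite -addvA; apply: addvSl.
  apply/andP; split; apply: subv_trans (addvSr _ _); first by [].
  case: u u2 => // u _; rewrite expvSl prodvA -/M_t.
  by apply: subv_trans (prodvSl _ xM3) _; rewrite -expvD.
have all k : (M_t t.+1 <= Y @: M_t t + Z @: M_t t + M_t (t.+1 + k).+1)%VS.
  elim: k => [|k IHk]; first by rewrite addn0; apply: step.
  apply: subv_trans IHk _; rewrite subv_add addvSl /= addnS.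
  apply: subv_trans (step (t.+1 + k)%N _) _; first by lia.
  apply: addvS (subvv _); apply: addvS; apply: limgS;
    by apply: (expv_le Mideal); lia.
have := all N0; rewrite [X in (_ + X)%VS](_ : _ = 0%VS) ?addv0 //.
by rewrite /M_t -addnS expvD Mnil prodv0.
Qed.

Let Mt_yz t : (2 <= t)%N -> (Y @: M_t t + Z @: M_t t = M_t t.+1)%VS.
Proof.
move=> t2; apply/eqP; rewrite eqEsubv M_yz // andbT subv_add YW ZW.
by rewrite /M_t expvSl !prodvSl.
Qed.

Let B1_full : (fullv <= <[1]> + <[x]> + B1)%VS.
Proof.
apply: subv_trans Mfull _; rewrite subv_add -addvA addvSl /=.
apply: subv_trans Mgen _; rewrite /B1 !addvA.
rewrite -[(M ^+ 2 + <[x]> + _ + _)%VS]addvA (addvC (M ^+ 2)%VS) -!addvA.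
exact: addvSr.
Qed.

Let M2B1 : (M ^+ 2 <= B1)%VS. Proof. by rewrite /B1 -addvA addvSl. Qed.

Let B1M : (B1 <= M)%VS.
Proof. by rewrite /B1 !subv_add -!memvE yM zM !andbT (@expv_le _ _ M Mideal 1). Qed.

(** The same in degree 2, where a factor in [M] has to be replaced by one in
    [B1]: the two differ by a multiple of [x], which does not matter modulo
    [M ^+ 3]. *)
Let M2_yz : (M ^+ 2 <= Y @: B1 + Z @: B1)%VS.
Proof.
have M3 : (M ^+ 3 <= Y @: B1 + Z @: B1)%VS.
  by apply: subv_trans (M_yz (leqnn 2)) _; apply: addvS; apply: limgS.
have xm a : a \in M -> x * a \in M_t 3.
  by move=> aM; apply: (subvP xM3); apply: memv_mul => //; apply: memv_line.
have line a : a \in B1 -> (<[a]> * M <= <[a]> * B1 + M ^+ 3)%VS.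
  move=> aB; apply: subv_trans (prodvSr _ Mgen) _.
  have -> : (M ^+ 2 + <[x]> + <[y]> + <[z]> = B1 + <[x]>)%VS.
    by rewrite /B1 (addvAC _ <[x]>) (addvAC _ <[x]>).
  rewrite prodvDr addvS // prodv_line -memvE hC; apply: xm.
  exact: (subvP B1M).
rewrite expv2; apply: subv_trans (prodvSl _ Mgen) _; rewrite !prodvDl !subv_add.
rewrite -expvSr M3 (subv_trans xM3 M3) /= YW ZW.
have M3' := M3; rewrite YW ZW in M3'.
have yB : y \in B1 by rewrite /B1 (addvAC _ <[y]>) memvE addvSr.
have zB : z \in B1 by rewrite /B1 memvE addvSr.
apply/andP; split; apply: subv_trans (line _ _) _ => //; rewrite subv_add M3' andbT.
  exact: addvSl.
exact: addvSr.
Qed.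

(** The orthogonal in [M ^+ 2] of the subalgebra spanned by [1] and [B1]. *)
Let U_ex : exists U : {vspace A}, forall c,
  (c \in U) <-> [/\ c \in M_t 2, phi c = 0 & forall b, b \in B1 -> phi (c * b) = 0].
Proof.
apply: (@subspace_vspace K A (fun c =>
   [/\ c \in M_t 2, phi c = 0 & forall b, b \in B1 -> phi (c * b) = 0])).
split; first by split; rewrite ?mem0v ?linear0 // => b _; rewrite mul0r linear0.
move=> k a b [a2 a0 aB] [b2 b0 bB]; split.
- by apply: memvD => //; apply: memvZ.
- by rewrite linearD linearZ /= a0 b0 scaler0 addr0.
- by move=> c cB; rewrite mulrDl -scalerAl linearD linearZ /= aB // bB // scaler0 addr0.
Qed.

(** Modulo [U], the subalgebra spanned by [1] and [B1] behaves like a Gorenstein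
    algebra with two generators: an element that [y] and [z] multiply into [U]
    and on which [phi] vanishes lies in [U]. So [koszul_count] bounds the falls
    of its Hilbert function by one, and [U] accounts for the exceptional degree
    [j]. When [U = 0] there is no exception and the bound holds with
    [j = 0]. *)
Lemma falls_of_generators (h : nat -> nat) :
  (forall t, (0 < t)%N -> \dim (M ^+ t) = (\dim (M ^+ t.+1) + h t)%N) ->
  exists j, forall t, (2 <= t)%N -> ((t < j)%N -> (h t <= h t.+1)%N) /\
    (h t <= h t.+1 + 1 + (t == j))%N.
Proof.
move=> dimM; have [U UP] := U_ex.
have dK (W : {vspace K^o}) : (\dim W <= 1)%N.
  by apply: leq_trans (dimvS (subvf W)) _; rewrite dimvf.
have UM2 : (U <= M_t 2)%VS by apply/subvP => c /UP [].
have full a : exists k l b, [/\ b \in B1 & a = k *: 1 + l *: x + b].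
  have /memv_addP [p + [b bB ->]] := subvP B1_full _ (memvf a).
  move=> /memv_addP [_ /vlineP [k ->] [_ /vlineP [l ->] ->]].
  by exists k, l, b.
have U_inj c : c \in U -> phi (c * x) = 0 -> c = 0.
  move=> /UP [_ c0 cB] cx; apply: phi_nondeg => a.
  have [k [l [b [bB ->]]]] := full a.
  rewrite !mulrDr -!scalerAr mulr1 !linearD !linearZ /= c0 cx cB //.
  by rewrite !scaler0 !addr0.
have B1B1 a b : a \in B1 -> b \in B1 -> a * b \in B1.
  move=> aB bB; apply: (subvP M2B1); rewrite expv2.
  by apply: memv_mul; apply: (subvP B1M).
have yB : y \in B1 by rewrite /B1 (addvAC _ <[y]>) memvE addvSr.
have zB : z \in B1 by rewrite /B1 memvE addvSr.
have U_stable a c : a \in B1 -> c \in U -> a * c \in U.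
  move=> aB /UP [c2 c0 cB]; apply/UP; split.
  - rewrite hC; apply: (@pow_le 2 3) => //; apply: (powM c2 (u := 1)).
    exact: (subvP B1M).
  - by rewrite hC cB.
  - by move=> b bB; rewrite [a * c]hC -mulrA cB // B1B1.
(* on U, the form c |-> phi (c * x) decides whether c = 0 *)
have dimU : (\dim U <= 1)%N.
  have [g gE] : exists g : 'Hom(A, K^o), g =1 (fun c => phi (c * x)).
    by apply: linear_lfun => k a b; rewrite mulrDl -scalerAl linearD linearZ.
  have <- : \dim (g @: U) = \dim U.
    apply: limg_dim_eq; apply/eqP; rewrite -subv0; apply/subvP => c.
    by move=> /memv_capP [cU]; rewrite memv_ker gE memv0 => /eqP /(U_inj _ cU) ->.
  exact: dK.
pose F t := (M_t t + U)%VS.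
have E_ex t : exists E : {vspace A}, forall c,
    (c \in E) = [&& c \in F t, Y c \in U & Z c \in U].
  exists (F t :&: (Y @^-1: U :&: Z @^-1: U))%VS => c.
  by rewrite !memv_cap -!memv_preim.
(* the part of E in the kernel of phi lies in U, because y and z generate the
   maximal ideal of the subalgebra *)
have dimE t (E : {vspace A}) : (2 <= t)%N ->
    (forall c, (c \in E) = [&& c \in F t, Y c \in U & Z c \in U]) ->
    (\dim E <= (\dim U).+1)%N.
  move=> t2 EE.
  have <- := limg_ker_dim phi E; rewrite -addn1; apply: leq_add.
    apply: dimvS; apply/subvP => c /memv_capP []; rewrite memv_ker EE.
    move=> /and3P[cF yc zc] /eqP c0; apply/UP; split=> //.
      move: cF; apply/subvP; rewrite subv_add UM2 andbT.
      by apply: (expv_le Mideal); rewrite t2.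
    have phiU d b : d \in U -> b \in B1 -> phi (d * b) = 0.
      by move=> /UP [_ _]; apply.
    move=> b; rewrite /B1 -addvA => /memv_addP [p pM [q + ->]].
    have {}pM := subvP M2_yz _ pM.
    case/memv_addP: pM => _ /memv_imgP [p1 p1B ->] [_ /memv_imgP [p2 p2B ->] ->].
    move=> /memv_addP [_ /vlineP [k ->] [_ /vlineP [l ->] ->]].
    have py d : d \in B1 -> phi (c * Y d) = 0.
      by move=> dB; rewrite YE mulrA [c * y]hC -YE phiU.
    have pz d : d \in B1 -> phi (c * Z d) = 0.
      by move=> dB; rewrite ZE mulrA [c * z]hC -ZE phiU.
    have [/UP [_ + _] /UP [_ + _]] := (yc, zc); rewrite YE ZE => yc0 zc0.
    rewrite !mulrDr -!scalerAr !linearD !linearZ /= py // pz //.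
    by rewrite [c * y]hC [c * z]hC yc0 zc0 !scaler0 !addr0.
  exact: dK.
have kos t : (2 <= t)%N -> (\dim (F t) + \dim (F t.+2) <= 2 * \dim (F t.+1) + 1)%N /\
   ((\dim (F t) + \dim (F t.+2) = 2 * \dim (F t.+1) + 1)%N ->
   forall a b, a \in F t.+1 -> b \in F t.+1 -> Y a + Z b \in U ->
   exists c, [/\ c \in F t, a - Z c \in U & b + Y c \in U]).
  move=> t2; have [E EE] := E_ex t.
  have stab a (aB : a \in B1) : (<[a]> * U <= U)%VS.
    by apply/prodvP => _ v /vlineP [k ->] vU; rewrite -scalerAl memvZ // U_stable.
  have YF (u : nat) : (2 <= u)%N -> (Y @: F u <= F u.+1)%VS.
    move=> u2; rewrite /F YW prodvDr; apply: addvS; last exact: stab.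
    by rewrite /M_t expvSl prodvSl.
  have ZF (u : nat) : (2 <= u)%N -> (Z @: F u <= F u.+1)%VS.
    move=> u2; rewrite /F ZW prodvDr; apply: addvS; last exact: stab.
    by rewrite /M_t expvSl prodvSl.
  have F2E : (Y @: F t.+1 + Z @: F t.+1 + U = F t.+2)%VS.
    apply/eqP; rewrite eqEsubv !subv_add YF ?ZF ?addvSr 1?leqW //=.
    rewrite andbT -Mt_yz 1?leqW //; apply: subv_trans (addvSl _ _).
    by apply: addvS; apply: limgS; apply: addvSl.
  have [|||||E1 E2] := @koszul_count K A Y Z (F t) (F t.+1) (F t.+2) U E _ _ _ _ _ F2E EE.
  - by move=> c; rewrite !YE !ZE !mulrA [y * z]hC.
  - by move=> u uU; rewrite YE ZE !U_stable.
  - exact: YF.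
  - exact: ZF.
  - exact: addvSr.
  have dE := dimE _ _ t2 EE; split; first exact: koszul_arith1 E1 dE.
  by move=> eq; apply: E2; apply: koszul_arith2 E1 dE eq.
have [U0|U1] := posnP (\dim U).
  have FE t : F t = M_t t.
    by move/eqP: U0; rewrite dimv_eq0 /F => /eqP ->; rewrite addv0.
  exists 0%N => t t2; split=> //; apply: leq_trans (leq_addr _ _).
  have [+ _] := kos t t2; rewrite !FE.
  exact: (falls_arith1 (dimM t (ltnW t2)) (dimM t.+1 isT)).
have {}dimU : \dim U = 1%N by apply/eqP; rewrite eqn_leq dimU.
have [j [j2 Uj Uj1]] : exists j, [/\ (2 <= j)%N, (U <= M_t j)%VS & ~~ (U <= M_t j.+1)%VS].
  have exj : exists j, (2 <= j)%N && (U <= M_t j)%VS by exists 2%N.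
  have bj j : (2 <= j)%N && (U <= M_t j)%VS -> (j <= N0.+1)%N.
    move=> /andP[_ Uj]; rewrite leqNgt; apply/negP => jN.
    have : (U <= M ^+ N0.+1)%VS by apply: subv_trans Uj _; apply: (expv_le Mideal); rewrite /= ltnW.
    by rewrite Mnil subv0 => /eqP U0; rewrite U0 dimv0 in dimU.
  case: (ex_maxnP exj bj) => j /andP[j2 Uj] jmax; exists j; split=> //.
  by apply/negP => Uj1; have := jmax j.+1; rewrite Uj1 leqW // ltnn => /(_ isT).
have dF t : (2 <= t)%N -> \dim (F t) = (\dim (M_t t) + (j < t))%N.
  move=> t2; have [jt|tj] := ltnP j t; last first.
    rewrite addn0; congr (\dim _); apply/addv_idPl; apply: subv_trans Uj _.
    by apply: (expv_le Mideal); rewrite tj (ltnW t2).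
  have -> : (true : nat) = \dim U by rewrite dimU.
  apply: dimv_disjoint_sum; apply/eqP; rewrite -dimv_eq0.
  have : (\dim (M_t t :&: U) <= \dim U)%N by apply/dimvS/capvSr.
  rewrite dimU leq_eqVlt => /orP[/eqP d1|]; last by rewrite ltnS leqn0.
  case/negP: Uj1; apply: (@subv_trans _ _ (M_t t)); last first.
    by apply: (expv_le Mideal); rewrite jt.
  apply/capv_idPr/eqP; rewrite eqEdim capvSr /= d1 dimU //.
(* In case of equality, u = Y a + Z b with a and b in M ^+ t.+1 is a Koszul
   relation modulo U: a - Z c and b + Y c lie in U, and
   u = Y (a - Z c) + Z (b + Y c) lies one power of M deeper than U. *)
have strict t : (2 <= t)%N -> (t.+1 < j)%N ->
    (\dim (F t) + \dim (F t.+2))%N != (2 * \dim (F t.+1) + 1)%N.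
  move=> t2 tj; apply/eqP => /((kos t t2).2) h'.
  case/negP: Uj1; apply/subvP => u uU.
  have : u \in (Y @: M_t t.+1 + Z @: M_t t.+1)%VS.
    rewrite Mt_yz 1?leqW //; apply: (subvP (expv_le Mideal _)) (subvP Uj _ uU).
    by rewrite tj.
  case/memv_addP => _ /memv_imgP [a aM ->] [_ /memv_imgP [b bM ->] uE].
  have [|||c [_ ac bc]] := h' a b.
  - by apply: (subvP (addvSl _ _)).
  - by apply: (subvP (addvSl _ _)).
  - by rewrite -uE.
  have -> : u = y * (a - Z c) + z * (b + Y c).
    by rewrite uE !YE !ZE !mulrDr mulrN !mulrA [z * y]hC addrACA addNr addr0.
  have yU v w : v \in M -> w \in U -> v * w \in M_t j.+1.
    move=> vM wU; rewrite hC -addn1.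
    exact: (powM (subvP Uj _ wU) (vM : v \in M_t 1)).
  by apply: memvD; apply: yU.
exists j => t t2.
have dt := dimM t (ltnW t2); have dt1 := dimM t.+1 isT.
have [+ _] := kos t t2; rewrite (dF t t2) (dF t.+1 (leqW t2)) (dF t.+2 (leqW (leqW t2))).
have [tj|] := boolP (t.+1 < j)%N.
  have := strict t t2 tj; rewrite (dF t t2) (dF t.+1 (leqW t2)) (dF t.+2 (leqW (leqW t2))).
  exact: falls_arith2 dt dt1 tj.
exact: falls_arith3 dt dt1.
Qed.
End GorensteinFalls.

Lemma vspace_qdim (K : fieldType) (V : vectType K) (W : {vspace V}) (P : set V) :
  (forall x, (x \in W) <-> P x) -> has_qdim P [set 0] (\dim W).
Proof.
move=> WP; exists (fun i => (vbasis W)`_i); split.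
- by move=> i; apply/WP/vbasis_mem/mem_nth; rewrite size_tuple.
- move=> x /WP xW; exists (fun i => coord (vbasis W) i x).
  by rewrite -(coord_vbasis xW) subrr.
- move=> c c0 i; have /freeP := basis_free (vbasisP W).
  by apply; rewrite c0.
Qed.

(** For [phi] one may take any coordinate that does not vanish on the socle:
    every nonzero ideal meets the socle, which is a line, so [phi] vanishes on no
    nonzero ideal. *)
Lemma gorenstein_falls (K : fieldType) (A : comAlgType K) (m : set A) h s :
  artinian_local m -> is_gorenstein m -> is_hilbert_function m h ->
  (forall i, (s < i)%N -> h i = 0%N) -> h 1 = 3%N -> h 2 = 3%N -> h 3 = 4%N ->
  exists j, forall t, (2 <= t)%N -> ((t < j)%N -> (h t <= h t.+1)%N) /\
    (h t <= h t.+1 + 1 + (t == j))%N.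
Proof.
move=> loc gor hf hs h1 h2 h3.
have mn := hilbert_vanish loc hf (hs _ (ltnSn s)).
have H : has_qdim (@setT A) [set 0] _ := hilbert_total hf mn (leq0n _).
pose B := fdalg H.
have mi := local_ideal loc; have [m0 mD mM] := mi.
have [M MP] : exists M : {vspace B}, forall x, (x \in M) <-> m x.
  exact: (@subspace_vspace K B m (ideal_subspace mi)).
have hC (a b : B) : a * b = b * a by exact: (@mulrC A).
have Mid : (fullv * M <= M)%VS by apply/prodvP => a b _ /MP bm; apply/MP/mM.
have MtP t : forall x, (x \in (M ^+ t.+1)%VS) <-> ideal_pow m t.+1 x.
  elim: t => [|t IHt] x; first by rewrite expv1 ideal_pow1.
  rewrite expvSl; split=> [xMt|].
    have [W WP] : exists W : {vspace B}, forall x, (x \in W) <-> ideal_pow m t.+2 x.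
      exact: (@subspace_vspace K B _ (ideal_subspace (ideal_pow_ideal m t.+2))).
    apply/WP; apply: (subvP _ _ xMt); apply/prodvP => a b /MP am /IHt bm.
    by apply/WP; apply: (@ideal_powM A m t.+1 a b am bm).
  move=> mx; have : ideal_pow m t.+2 `<=` [set x | forall a : B, a * x \in (M * M ^+ t.+1)%VS].
    apply: ideal_gen_sub.
      split=> [a|y z hy hz a|b y hy a]; first by rewrite mulr0 mem0v.
        by rewrite mulrDr; apply: memvD; [apply: hy|apply: hz].
      by rewrite mulrA; apply: hy.
    move=> _ [y my [z mz <-]] a; rewrite mulrA.
    by apply: memv_mul; [apply/MP/mM|apply/IHt].
  by move=> /(_ x mx 1); rewrite mul1r.
have dimM t : (0 < t)%N -> \dim (M ^+ t) = (\dim (M ^+ t.+1) + h t)%N.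
  case: t => // t _; rewrite addnC; apply: (@qdim_uniq _ B _ _ _ _ (@subspace0 K B)).
    exact: vspace_qdim (MtP t).
  apply: (@qdim_add K B _ (ideal_pow m t.+2)) (hf t.+1) (vspace_qdim (MtP t.+1)).
  - exact/ideal_subspace/ideal_pow_ideal.
  - exact: subspace0.
  - exact: ideal_powS.
  - by move=> _ ->; case: (ideal_pow_ideal m t.+2).
have Mnil : (M ^+ s.+1 = 0)%VS.
  by apply/eqP; rewrite -subv0; apply/subvP => x /MtP; rewrite mn memv0 => ->.
have Mfull : (fullv <= <[1]> + M)%VS.
  apply/subvP => x _; have [_ _ /(_ x) [c mc]] := loc.
  rewrite -[x](subrK c%:A) addrC; apply: memv_add; last exact/MP.
  by apply: memvZ; apply: memv_line.
have [sig [ssig gsig isig]] := gor.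
pose sg : B := sig ord0.
have sg0 : sg <> 0.
  move=> E; have := isig (fun _ => 1); rewrite big_ord1 scale1r => /(_ E ord0) /eqP.
  by rewrite oner_eq0.
have [i ci] : exists i, coord (vbasis fullv) i sg != 0.
  apply: contrapT => nex; apply: sg0; rewrite (coord_vbasis (memvf sg)) big1 // => i _.
  have [->|ne] := eqVneq (coord (vbasis fullv) i sg) 0; first by rewrite scale0r.
  by case: nex; exists i.
have [phi phiE] : exists F : 'Hom(B, K^o), F =1 (fun c => coord (vbasis fullv) i c).
  by apply: linear_lfun => k a b; rewrite linearP.
have nondeg (a : B) : (forall b, phi (a * b) = 0) -> a = 0.
  move=> pa; apply/eqP; apply: contraT => /(socle_above loc) [b [ba0 sba]].
  have [c /eqP] := gsig _ sba; rewrite big_ord1 subr_eq0 => /eqP baE.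
  have := pa b; rewrite hC phiE (baE : (b : B) * a = c ord0 *: sg) linearZ /= => /eqP.
  rewrite mulf_eq0 (negPf ci) orbF => /eqP c0.
  by move: ba0; rewrite baE c0 scale0r eqxx.
have d1 : (\dim M = \dim (M ^+ 2) + 3 :> nat)%N by have := dimM 1%N isT; rewrite h1.
have d2 : (\dim (M ^+ 2) = \dim (M ^+ 3) + 3 :> nat)%N by have := dimM 2%N isT; rewrite h2.
have d3 : (\dim (M ^+ 3) = \dim (M ^+ 4) + 4 :> nat)%N by have := dimM 3%N isT; rewrite h3.
have [x [xM x2 xM3]] := special_element hC Mid d1 d2 d3.
have dx := dim_add_line x2.
have [y yM yn] : exists2 y, y \in M & y \notin (M ^+ 2 + <[x]>)%VS.
  by apply: ex_notin; rewrite dx d1 addn3.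
have dy := dim_add_line yn.
have [z zM zn] : exists2 z, z \in M & z \notin (M ^+ 2 + <[x]> + <[y]>)%VS.
  by apply: ex_notin; rewrite dy dx d1 addn3.
have dz := dim_add_line zn.
have gen : (M <= M ^+ 2 + <[x]> + <[y]> + <[z]>)%VS.
  suff /eqP E : (M ^+ 2 + <[x]> + <[y]> + <[z]> == M)%VS by rewrite E.
  rewrite eqEdim dz dy dx d1 addn3 leqnn andbT.
  by rewrite !subv_add -!memvE xM yM zM !andbT; apply: (expv_le Mid (t := 1)).
exact: (@falls_of_generators K B M hC Mid Mfull s Mnil phi nondeg x y z).
Qed.

(** * Macaulay's bound and the conditions on the falls *)

Section Combinatorics.
Local Open Scope nat_scope.
Implicit Types (h : nat -> nat) (d s t i j nu : nat).

Lemma expansion_decr i a k : binomial_expansion i a k ->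
  forall l, l < size k -> nth 0 k l + l <= nth 0 k 0.
Proof.
move=> [_ + _ _]; case: k => // x k /= pk; elim=> [|l IHl] lk; first by rewrite addn0.
have /(pathP 0) /(_ l) := pk; rewrite /= -ltnS => /(_ lk).
by have := IHl (ltnW lk); case: l {IHl lk} => [|l] /=; lia.
Qed.

(** [C(k, i)] exceeds [i] as soon as [k > i], so the expansion of a number
    [a <= i] is a sum of binomials [C(l, l)], and Macaulay's bound for [a] is [a]
    itself. *)
Lemma macaulay_small i a k : 0 < i -> binomial_expansion i a k -> a <= i ->
  \sum_(l < size k) 'C((nth 0 k l).+1, (i - l).+1) <= a.
Proof.
move=> i0 E ai; have dec := expansion_decr E; case: E => sk _ lo aE.
have [k0|k0] := posnP (size k).
  by rewrite big1 // => -[l lk]; have := lk; rewrite {1}k0.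
have k0i : nth 0 k 0 = i.
  have := lo 0 k0; rewrite subn0 leq_eqVlt => /orP[/eqP //|ki].
  suff : i < a by rewrite ltnNge ai.
  rewrite aE (bigD1 (Ordinal k0)) //= subn0; apply: leq_trans (leq_addr _ _).
  by apply: leq_trans (leq_bin2l i ki); rewrite binSn.
have kl l : l < size k -> nth 0 k l = i - l.
  by move=> lk; have := lo l lk; have := dec l lk; rewrite k0i; lia.
rewrite aE; apply: leq_sum => -[l lk] _ /=.
by rewrite kl // !binn.
Qed.

(** The expansion of [i + 1] is [C(i + 1, i)]: with [k_0 = i] at most [i]
    summands [C(l, l)] are available, [k_0 >= i + 2] gives a number that is too
    large, and [k_0 = i + 1] leaves no room for a second summand. *)
Lemma macaulay_top i k : 0 < i -> binomial_expansion i i.+1 k ->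
  \sum_(l < size k) 'C((nth 0 k l).+1, (i - l).+1) <= i.+2.
Proof.
move=> i0 E; have dec := expansion_decr E; case: E => sk srt lo aE.
have [k0|k0] := posnP (size k).
  by rewrite big1 // => -[l lk]; have := lk; rewrite {1}k0.
have := lo 0 k0; rewrite subn0 leq_eqVlt => /orP[/eqP ki|ki].
  have kl l : l < size k -> nth 0 k l = i - l.
    by move=> lk; have := lo l lk; have := dec l lk; rewrite -ki; lia.
  suff : i.+1 <= size k by lia.
  rewrite {1}aE -[X in _ <= X]card_ord -sum1_card; apply: leq_sum => -[l lk] _ /=.
  by rewrite kl // binn.
have bi : i.+1 <= 'C(nth 0 k 0, i) by apply: leq_trans (leq_bin2l i ki); rewrite binSn.
have sk1 : size k = 1.
  apply/eqP; rewrite eqn_leq k0 andbT leqNgt; apply/negP => k1.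
  suff : i.+2 <= i.+1 by rewrite ltnn.
  rewrite {2}aE (bigD1 (Ordinal k0)) //= subn0 (bigD1 (Ordinal k1)) //=.
  have : 0 < 'C(nth 0 k 1, i - 1) by rewrite bin_gt0 lo.
  by move: bi; lia.
move: aE; rewrite sk1 !big_ord1 /= subn0 => aE.
have kE : nth 0 k 0 = i.+1.
  apply/eqP; rewrite eqn_leq ki andbT leqNgt; apply/negP => k2.
  have := leq_bin2l i k2; rewrite -aE -addn2 -[in X in 'C(_, X)](addnK 2 i).
  by rewrite bin_sub ?leq_addl // bin2 /=; nia.
by rewrite kE binSn.
Qed.

Section Shape.
Variables (h : nat -> nat) (s : nat).
Hypothesis h133 : is_133_sequence h s.

Lemma seq133_small i : 0 < i -> h i <= i -> h i.+1 <= h i.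
Proof.
case: h133 => -[_ hO] _ _ _ _ i0 hi; have [k [kE le]] := hO i i0.
exact: leq_trans le (macaulay_small i0 kE hi).
Qed.

Lemma seq133_top i : 0 < i -> h i = i.+1 -> h i.+1 <= i.+2.
Proof.
case: h133 => -[_ hO] _ _ _ _ i0 hi; have [k [kE le]] := hO i i0.
by rewrite hi in kE; exact: leq_trans le (macaulay_top i0 kE).
Qed.

(** What Macaulay's bound leaves from degree 2 on: a staircase up to [d], a
    plateau that ends in degree [nu], and a descent. *)
Definition peak_shape d nu := [/\ 2 < d, d.-1 <= nu < s,
  forall i, 1 < i < d -> h i = i.+1, forall i, d.-1 <= i <= nu -> h i = d &
  h nu.+1 < d /\ forall i, d.-1 <= i -> h i.+1 <= h i].

(** [d] is the first degree in which [h] misses the value [i + 1]. There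
    [h d <= d] by [seq133_top], and from then on [h i <= i], so that
    [seq133_small] excludes any rise. *)
Lemma seq133_shape : exists d nu, peak_shape d nu.
Proof.
case: (h133) => -[h0 _] h1 h2 hs hbig.
have exd : exists d, (2 < d) && (h d != d.+1).
  exists (s + 3); rewrite hbig; lia.
case: (ex_minnP exd) => d /andP[d2 hd] dmin.
have rise i : 1 < i < d -> h i = i.+1.
  move=> /andP[i1 id]; have [->|i2] := eqVneq i 2; first by rewrite h2.
  apply/eqP; apply: contraT => hi; have := dmin i; rewrite hi andbT; lia.
have hd1 : h d.-1 = d by rewrite rise; lia.
have hdd : h d <= d.
  have := @seq133_top d.-1; rewrite prednK; [|lia]; rewrite hd1.
  by move=> /(_ _ erefl) h'; have := h' _; lia.
have le_i i : d <= i -> h i <= i /\ h i.+1 <= h i.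
  elim: i => [|i IHi] di; first by lia.
  have hi : h i.+1 <= i.+1.
    move: di; rewrite leq_eqVlt => /orP[/eqP <- //|].
    by rewrite ltnS => /IHi []; lia.
  by split=> //; apply: seq133_small.
have decr i : d.-1 <= i -> h i.+1 <= h i.
  rewrite leq_eqVlt => /orP[/eqP <-|]; first by rewrite prednK ?hd1; lia.
  by move=> di; apply: (le_i i _).2; lia.
have mono i j : d.-1 <= i -> i <= j -> h j <= h i.
  move=> di /subnK <-; elim: (j - i) => // k IHk; rewrite addSn.
  by apply: leq_trans IHk; apply: decr; lia.
have exn : exists n, (d.-1 <= n) && (h n == d) by exists d.-1; rewrite hd1 eqxx leqnn.
have bn n : (d.-1 <= n) && (h n == d) -> n <= s.
  by move=> /andP[_ /eqP hn]; rewrite leqNgt; apply/negP => /hbig; lia.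
case: (ex_maxnP exn bn) => nu /andP[dn /eqP hn] nmax.
exists d, nu; split=> //.
- rewrite dn /=; have := bn nu; rewrite dn hn eqxx => /(_ isT).
  by rewrite leq_eqVlt => /orP[/eqP E|//]; rewrite E hs in hn; lia.
- move=> i /andP[di ni]; have := mono d.-1 i (leqnn _) di; have := mono i nu di ni.
  by rewrite hd1 hn; lia.
- split=> //; have := decr nu dn; rewrite hn leq_eqVlt => /orP[/eqP hn1|//].
  by have := nmax nu.+1; rewrite hn1 eqxx andbT; lia.
Qed.

Lemma shape_mono d nu : peak_shape d nu -> forall i j, d.-1 <= i -> i <= j -> h j <= h i.
Proof.
move=> [_ _ _ _ [_ decr]] i j di /subnK <-; elim: (j - i) => // k IHk; rewrite addSn.
by apply: leq_trans IHk; apply: decr; lia.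
Qed.

Lemma shape_peak d nu : peak_shape d nu -> is_peak_position h nu.
Proof.
case: (h133) => -[h0 _] h1 h2 hs hbig.
move=> [d2 /andP[dn ns] rise flat [fall decr]]; split; first by rewrite (flat nu); lia.
move=> u hu; rewrite leqNgt; apply/negP => un.
have [|u2] := ltnP u 2; first by case: u hu {un} => [|[|//]]; rewrite ?h0 ?h1 ?h2; lia.
have [ud|ud] := ltnP u d.-1; first by move: hu; rewrite !rise; lia.
by move: hu; rewrite !flat; lia.
Qed.

Lemma seq_delta_le m : (forall i, 2 < i <= s -> `|(h i)%:Z - (h i.-1)%:Z|%N <= m) ->
  seq_delta h s <= m.
Proof.
move=> hm; apply/bigmax_leqP_seq => i; rewrite mem_index_iota => /andP[i1 i2] _.
by apply: hm; rewrite i1.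
Qed.

Lemma seq_delta_ge i : 2 < i <= s -> `|(h i)%:Z - (h i.-1)%:Z|%N <= seq_delta h s.
Proof.
move=> /andP[i1 i2].
by apply: (@leq_bigmax_seq _ _ _ (fun i => `|(h i)%:Z - (h i.-1)%:Z|%N)); rewrite // mem_index_iota i1.
Qed.

Lemma delta_fall t m : seq_delta h s <= m -> 1 < t -> t <> s -> h t <= h t.+1 + m.
Proof.
case: (h133) => _ _ _ hs hbig.
move=> dm t1 ts; have [tl|tl] := ltnP t s; last by rewrite hbig; lia.
by have := @seq_delta_ge t.+1; rewrite /= ltnS t1 tl => /(_ isT); lia.
Qed.

(** The common form of the three conditions used to build a complete
    intersection. *)
Definition peak_falls d nu := peak_shape d nu /\
  (h nu <= h nu.+1 + 2 /\ forall t, nu < t -> h t <= h t.+1 + 1).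

Lemma conditions_peak_falls : [\/ condition_I h, condition_II h s | condition_III h s] ->
  exists d nu, peak_falls d nu.
Proof.
case: (h133) => -[h0 _] h1 h2 hs hbig hc.
have [d [nu sh]] := seq133_shape; exists d, nu; split=> //.
have mono := shape_mono sh; have pk := shape_peak sh.
case: (sh) => d2 /andP[dn ns] rise flat [fall decr].
have hS : h s.+1 = 0 by apply: hbig.
case: hc => [hI|[h3 dl]|[h3 dl [t [[tf tmin] t2 tu]]]].
- have d3 : d = 3.
    have [//|dn3] := eqVneq d 3; rewrite /condition_I rise in hI => //; lia.
  have hpos t : nu <= t -> t <= s -> 0 < h t.
    by move=> nt ts; have := mono t s; rewrite hs; apply; lia.
  split; first by rewrite (flat nu); [|lia]; have := hpos nu.+1; lia.
  move=> t nt; have [ts|ts] := ltnP t s.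
    have h1t : h t <= h nu.+1 by apply: mono; lia.
    by have := hpos t.+1; lia.
  by have := mono s t; rewrite hs; lia.
- have all t : 1 < t -> h t <= h t.+1 + 1.
    move=> t1; have [->|/eqP ts] := eqVneq t s; first by rewrite hs hS.
    by apply: delta_fall => //; rewrite dl.
  split=> [|t nt]; last by apply: all; lia.
  by have := all nu; lia.
- have all u : 1 < u -> u <> s -> h u <= h u.+1 + 2.
    by move=> u1 us; apply: delta_fall => //; rewrite dl.
  have tE : t = nu by case: pk => f m; apply/eqP; rewrite eqn_leq tmin // m.
  split; first by apply: all; lia.
  move=> u nu_u; have [->|/eqP us] := eqVneq u s; first by rewrite hs hS.
  have := all u; have [E|] := eqVneq (h u) (h u.+1 + 2).
    by have := tu u E; lia.
  lia.
Qed.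

(** A fall by two can only occur at [j], and nothing falls before [j]; so it
    occurs at the peak. *)
Lemma falls_conditions j : h 3 = 4 ->
  (forall t, 2 <= t -> (t < j -> h t <= h t.+1) /\ h t <= h t.+1 + 1 + (t == j)) ->
  condition_II h s \/ condition_III h s.
Proof.
case: (h133) => -[h0 _] h1 h2 hs hbig h3 hj.
have [d [nu sh]] := seq133_shape.
have mono := shape_mono sh; have [pk1 pk2] := shape_peak sh.
case: (sh) => d2 /andP[dn ns] rise flat [fall decr].
have up t : 1 < t -> h t.+1 <= h t + 1.
  move=> t1; have [td|td] := ltnP t d.-1; first by rewrite !rise; lia.
  by have := decr t td; lia.
have s3 : 2 < s.
  by case: s hs ns {hbig sh} => [|[|[|]]] //; rewrite ?h0 ?h1 ?h2; lia.
have [[t [t1 t2]]|nof] := pselect (exists t, 1 < t /\ h t = h t.+1 + 2).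
  have tj : t = j by have [_] := hj t t1; case: eqP => // _; lia.
  subst t; right; split=> //.
    apply/eqP; rewrite eqn_leq; apply/andP; split.
      apply: seq_delta_le => -[//|i] /andP[i1 i2] /=.
      by have := up i; have [_] := hj i i1; case: eqP; lia.
    have js : j < s.
      rewrite ltnNge; apply/negP; rewrite leq_eqVlt => /orP[/eqP E|/hbig]; last by lia.
      by move: t2; rewrite -E hs; lia.
    by have := @seq_delta_ge j.+1; rewrite /= !ltnS t1 js => /(_ isT); lia.
  exists j; split=> //.
    split; first by lia.
    move=> u hu; rewrite leqNgt; apply/negP => uj.
    have [u2|u2] := ltnP u 2; last by have [/(_ uj)] := hj u u2; lia.
    by case: u hu u2 {uj} => [|[|//]]; rewrite ?h0 ?h1 ?h2; lia.
  move=> i; rewrite /has_fall => hi.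
  have [i2|i2] := ltnP i 2.
    by case: i hi i2 => [|[|//]]; rewrite ?h0 ?h1 ?h2; lia.
  by have [_] := hj i i2; case: eqP => // _; lia.
left; split=> //; apply/eqP; rewrite eqn_leq; apply/andP; split.
  apply: seq_delta_le => -[//|i] /andP[i1 i2] /=.
  have := up i; have [_] := hj i i1.
  have [E|ne] := eqVneq (h i) (h i.+1 + 2); first by case: nof; exists i.
  by case: eqP; lia.
by have := @seq_delta_ge 3; rewrite /= s3 h3 h2 => /(_ isT).
Qed.

Lemma condition_III_form : condition_III h s ->
  exists d r, [/\ d = seq_max h s, 4 <= d & form_III h s d r].
Proof.
case: (h133) => -[h0 _] h1 h2 hs hbig hc.
have [d [nu sh]] := seq133_shape; exists d, (nu - d.-1).
have mono := shape_mono sh; have [pk1 pk2] := shape_peak sh.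
case: (sh) => d2 /andP[dn ns] rise flat [fall decr].
case: hc => h3 dl [t [[tf tmin] t2 tu]].
have tE : t = nu by apply/eqP; rewrite eqn_leq tmin // pk2.
subst t.
have d4 : 3 < d.
  rewrite ltnNge; apply/negP => d3; have dE : d = 3 by lia.
  by have := mono 2 3; rewrite dE h2 h3 => /(_ isT isT).
have hS : h s.+1 = 0 by apply: hbig.
split=> //; last first.
  split=> // i is_ i1; split.
  - move=> id; have [->|i0] := eqVneq i 0; first by rewrite h0.
    by apply: rise; lia.
  - by move=> ii; apply: flat; lia.
  - move=> iE; have iE' : i = nu.+1 by lia.
    by move: t2; rewrite /has_fall iE' (flat nu); lia.
  - case: i is_ i1 => [|i] is_ i1 id; first by lia.
    rewrite [i.+1.-1]/=; have := decr i; have := @delta_fall i 2; rewrite dl.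
    have [E|ne] := eqVneq (h i) (h i.+1 + 2); last by lia.
    by have := tu i E; lia.
apply/eqP; rewrite eqn_leq; apply/andP; split.
  have nS : nu < s.+1 by lia.
  by rewrite -{1}(flat nu); [apply: (@leq_bigmax _ (fun i : 'I_s.+1 => h i) (Ordinal nS))|lia].
apply/bigmax_leqP => -[i /= is_] _.
have [i2|i2] := ltnP i 2.
  by case: i i2 {is_} => [|[|//]]; rewrite ?h0 ?h1; lia.
have [id|id] := ltnP i d.-1; first by rewrite rise; lia.
by rewrite -[X in _ <= X](flat d.-1); [apply: mono|lia].
Qed.

End Shape.
End Combinatorics.

(** * Quotient algebras *)

Section QuotientAlgebra.
Variables (K : fieldType) (R : comAlgType K) (I : set R).
Hypotheses (iI : is_ideal I) (I1 : ~ I 1).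

Definition ideal_mem : R -> bool := fun x => `[< I x >].

Lemma ideal_mem_closed : idealr_closed ideal_mem.
Proof.
case: iI => I0 ID IM; split; rewrite ?unfold_in; first exact/asboolP.
  by apply/negP => /asboolP.
move=> a u v; rewrite !unfold_in => /asboolP Iu /asboolP Iv.
by apply/asboolP; apply: ID => //; apply: IM.
Qed.

Definition ideal_clos : idealr R :=
  HB.pack ideal_mem (isIdealr.Build R ideal_mem ideal_mem_closed).

Definition quot_alg : Type := {ideal_quot ideal_clos}.
HB.instance Definition _ := GRing.ComNzRing.on quot_alg.

Definition quot_pi (x : R) : quot_alg := \pi_({ideal_quot ideal_clos})%qT x.

Lemma quot_piP x y : quot_pi x = quot_pi y <-> I (x - y).
Proof.
split=> [/eqP|Ixy].
  by rewrite /quot_pi -Quotient.idealrBE unfold_in => /asboolP.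
by apply/eqP; rewrite /quot_pi -Quotient.idealrBE unfold_in; apply/asboolP.
Qed.

Lemma quot_pi_surj (a : quot_alg) : exists x, quot_pi x = a.
Proof. by exists (repr (a : {ideal_quot ideal_clos})); rewrite /quot_pi reprK. Qed.

Lemma quot_piD x y : quot_pi (x + y) = quot_pi x + quot_pi y.
Proof. exact: (rmorphD (\pi_({ideal_quot ideal_clos})%qT)). Qed.

Lemma quot_piM x y : quot_pi (x * y) = quot_pi x * quot_pi y.
Proof. exact: (rmorphM (\pi_({ideal_quot ideal_clos})%qT)). Qed.

Lemma quot_pi1 : quot_pi 1 = 1.
Proof. exact: (rmorph1 (\pi_({ideal_quot ideal_clos})%qT)). Qed.

Definition quot_scale (c : K) (a : quot_alg) : quot_alg := quot_pi c%:A * a.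

Lemma quot_scaleA b c a : quot_scale b (quot_scale c a) = quot_scale (b * c) a.
Proof. by rewrite /quot_scale mulrA -quot_piM -scalerA mulr_algl. Qed.

Lemma quot_scale1 : left_id 1 quot_scale.
Proof. by move=> a; rewrite /quot_scale scale1r quot_pi1 mul1r. Qed.

Lemma quot_scaleDr : right_distributive quot_scale +%R.
Proof. by move=> c a b; rewrite /quot_scale mulrDr. Qed.

Lemma quot_scaleDl a : {morph quot_scale^~ a : b c / b + c}.
Proof. by move=> b c; rewrite /quot_scale scalerDl quot_piD mulrDl. Qed.

HB.instance Definition _ := GRing.Zmodule_isLmodule.Build K quot_alg
  quot_scaleA quot_scale1 quot_scaleDr quot_scaleDl.

Lemma quot_scaleAl c (a b : quot_alg) : c *: (a * b) = (c *: a) * b.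
Proof. exact: mulrA. Qed.

HB.instance Definition _ := GRing.Lmodule_isLalgebra.Build K quot_alg quot_scaleAl.
HB.instance Definition _ := GRing.Lalgebra_isComAlgebra.Build K quot_alg.

Lemma quot_piZ c x : quot_pi (c *: x) = c *: quot_pi x.
Proof. by rewrite -mulr_algl quot_piM. Qed.

End QuotientAlgebra.

Lemma quotient_algebra (K : fieldType) (R : comAlgType K) (I : set R) :
  is_ideal I -> ~ I 1 -> exists (A : comAlgType K) (phi : {lrmorphism R -> A}),
    (forall a, exists x, phi x = a) /\ (forall x, phi x = 0 <-> I x).
Proof.
move=> iI I1; exists (quot_alg iI I1).
pose p := quot_pi iI I1.
have pL : linear p by move=> c x y; rewrite /p quot_piD quot_piZ.
have pM : monoid_morphism p by split; [apply: quot_pi1|apply: quot_piM].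
pose L := GRing.isLinear.Build K R (quot_alg iI I1) *:%R p pL.
pose M := GRing.isMonoidMorphism.Build R (quot_alg iI I1) p pM.
pose phi : {lrmorphism R -> quot_alg iI I1} := HB.pack p L M.
exists phi; split; first exact: quot_pi_surj.
move=> x; rewrite -(subr0 x) -(quot_piP iI I1) subr0.
by rewrite (_ : quot_pi iI I1 0 = 0) //; exact: (linear0 phi).
Qed.

(** * Regular sequences and lengths *)

Section RegularLength.
Variables (K : fieldType) (R : comAlgType K).
Implicit Types (I Q : set R) (a b f g : R) (F : seq R) (k l : nat).

Definition colength I k := has_qdim (@setT R) I k.

(** Regularity and length are kept in one statement because each is needed to
    compute the other: lengths add up along products only in the presence of
    regularity. *)
Fixpoint reglen I F k : Prop :=
  if F is f :: F' then nzd f I /\ reglen (ideal_adj I f) F' k else colength I k.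

Lemma ideal_adjC I a b : is_ideal I ->
  ideal_adj (ideal_adj I a) b = ideal_adj (ideal_adj I b) a.
Proof.
move=> iI; suff sub c d : ideal_adj (ideal_adj I c) d `<=` ideal_adj (ideal_adj I d) c.
  by apply/seteqP; split; apply: sub.
have iJ := ideal_adj_ideal d iI.
apply: ideal_adj_min; first exact: ideal_adj_ideal.
  apply: ideal_adj_min; first exact: ideal_adj_ideal.
    by move=> x Ix; do 2 (apply: ideal_adj_sub => //).
  exact: ideal_adj_in.
by apply: ideal_adj_sub => //; apply: ideal_adj_in.
Qed.

Lemma nzd_swap I a b : is_ideal I -> nzd a I -> nzd b (ideal_adj I a) ->
  nzd a (ideal_adj I b).
Proof.
move=> iI na nb h [k hk].
have [k' kE] : ideal_adj I a k.
  apply: nb; exists h; have -> : k * b - a * h = - (h * a - b * k) by ring.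
  exact: idealN.
exists k'; apply: na.
have -> : (h - b * k') * a = (h * a - b * k) + b * (k - a * k') by ring.
by case: iI => _ ID IM; apply: ID => //; apply: IM.
Qed.

Lemma nzd_prod I a b : nzd a I -> nzd b I -> nzd (a * b) I.
Proof. by move=> na nb g h; apply: na; apply: nb; rewrite -mulrA. Qed.

(** The quotient by [a * b] is an extension of the quotient by [a] by the one by
    [b]; an element regular on both ends is regular in the middle. *)
Lemma nzd_mod_prod I a b f : is_ideal I -> nzd a I ->
  nzd f (ideal_adj I a) -> nzd f (ideal_adj I b) -> nzd f (ideal_adj I (a * b)).
Proof.
move=> iI na fa fb h [k hk]; have [I0 ID IM] := iI.
have [h' h'E] : ideal_adj I a h.
  by apply: fa; exists (b * k); rewrite mulrA.
have [k' k'E] : ideal_adj I b h'.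
  apply: fb; exists k; apply: na.
  have -> : (h' * f - b * k) * a = (h * f - a * b * k) - f * (h - a * h') by ring.
  by apply: idealB => //; apply: IM.
exists k'; have -> : h - a * b * k' = (h - a * h') + a * (h' - b * k') by ring.
by apply: ID => //; apply: IM.
Qed.

Lemma ideal_adj_prod_sub I a b : is_ideal I -> ideal_adj I (a * b) `<=` ideal_adj I a.
Proof.
move=> iI; apply: ideal_adj_min; first exact: ideal_adj_ideal.
  exact: ideal_adj_sub.
by apply: idealMr; [apply: ideal_adj_ideal|apply: ideal_adj_in].
Qed.

(** Multiplication by [a] gives an exact sequence
    [0 -> R / I -> R / J' -> R / J -> 0]. *)
Lemma colength_prod I J J' a k l :
  is_ideal I -> is_ideal J -> is_ideal J' -> J' `<=` J -> J a ->
  (forall h, I h -> J' (a * h)) -> (forall h, J' (a * h) -> I h) ->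
  (forall x, J x -> exists h, J' (x - a * h)) ->
  colength J k -> colength I l -> colength J' (k + l).
Proof.
move=> iI iJ iJ' sub Ja I_J' J'_I J_dec cJ [e' [_ ge' ie']].
apply: (@qdim_add K R _ J) => //; try exact: ideal_subspace.
have [J'0 J'D J'M] := iJ'.
have dist (c : 'I_l -> K) : \sum_i c i *: (a * e' i) = a * \sum_i c i *: e' i.
  by rewrite mulr_sumr; apply: eq_bigr => i _; rewrite scalerAr.
exists (fun i => a * e' i); split.
- by move=> i; apply: idealMr.
- move=> x /J_dec [h xh]; have [c hc] := ge' h Logic.I; exists c.
  rewrite dist; apply: (ideal_trans iJ' xh).
  by rewrite -mulrBr; apply: I_J'.
- by move=> c; rewrite dist => /J'_I; apply: ie'.
Qed.

(** If [F] is regular modulo [a] and modulo [b], the annihilator of [a] modulo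
    [(a * b) + (F)] is [(b) + (F)], and [colength_prod] applies. To see this the
    elements of [F] are divided out one at a time, with [a] and [b] remaining
    regular. *)
Lemma reglen_prod I a b F k l : is_ideal I ->
  reglen I (a :: F) k -> reglen I (b :: F) l -> reglen I (a * b :: F) (k + l).
Proof.
move=> iI /= [na ra] [nb rb]; split; first exact: nzd_prod.
elim: F I iI na ra nb rb => [|f F IH] I iI na ra nb rb /=.
  have [I0 ID IM] := iI.
  apply: (@colength_prod (ideal_adj I b) (ideal_adj I a)) => //;
    try exact: ideal_adj_ideal.
  - exact: ideal_adj_prod_sub.
  - exact: ideal_adj_in.
  - move=> h [c hc]; exists c; have -> : a * h - a * b * c = a * (h - b * c) by ring.
    exact: IM.
  - move=> h [c hc]; exists c; apply: na.
    by have -> : (h - b * c) * a = a * h - a * b * c by ring.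
  - move=> x [h xh]; exists h; exact: ideal_adj_sub.
case: ra rb => /= fa ra [fb rb].
split; first exact: nzd_mod_prod.
rewrite ideal_adjC //; apply: IH.
- exact: ideal_adj_ideal.
- exact: nzd_swap.
- by rewrite ideal_adjC.
- exact: nzd_swap.
- by rewrite ideal_adjC.
Qed.

Lemma ideal_adj_congr I a b : is_ideal I -> I (a - b) -> ideal_adj I a = ideal_adj I b.
Proof.
move=> iI ab; have sub c d : I (c - d) -> ideal_adj I c `<=` ideal_adj I d.
  move=> cd; apply: ideal_adj_min; first exact: ideal_adj_ideal.
    exact: ideal_adj_sub.
  by exists 1; rewrite mulr1.
by apply/seteqP; split; apply: sub => //; apply: ideal_sym.
Qed.

Lemma nzd_congr I a b : is_ideal I -> I (a - b) -> nzd a I -> nzd b I.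
Proof.
move=> iI ab na g gb; apply: na.
have -> : g * a = g * b + g * (a - b) by ring.
by case: iI => _ ID IM; apply: ID => //; apply: IM.
Qed.

Lemma reglen_congr I a b F k : is_ideal I -> I (a - b) ->
  reglen I (a :: F) k -> reglen I (b :: F) k.
Proof.
move=> iI ab /= [na ra]; split; first exact: nzd_congr ab na.
by rewrite -(ideal_adj_congr iI ab).
Qed.

Lemma ideal_adjN I a : is_ideal I -> ideal_adj I (- a) = ideal_adj I a.
Proof.
move=> iI; have sub c : ideal_adj I (- c) `<=` ideal_adj I c.
  apply: ideal_adj_min; first exact: ideal_adj_ideal.
    exact: ideal_adj_sub.
  by apply: idealN; [apply: ideal_adj_ideal|apply: ideal_adj_in].
by apply/seteqP; split=> //; rewrite -{1}[a]opprK; apply: sub.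
Qed.

Lemma reglenN I a F k : is_ideal I -> reglen I (a :: F) k -> reglen I (- a :: F) k.
Proof.
move=> iI /= [na ra]; split; last by rewrite ideal_adjN.
by move=> g; rewrite mulrN => /(idealN iI); rewrite opprK; apply: na.
Qed.

Lemma reglen_swap I a b k : is_ideal I -> nzd b I ->
  reglen I [:: a; b] k -> reglen I [:: b; a] k.
Proof.
move=> iI nb /= [na [nba c]]; split=> //; split; first exact: nzd_swap.
by rewrite ideal_adjC.
Qed.

Lemma reglen1 I : is_ideal I -> reglen I [:: 1] 0.
Proof.
move=> iI; split; first by move=> g; rewrite mulr1.
exists (fun _ => 0); split=> [[]//|x _|c _ []//].
exists (fun _ => 0); rewrite big_ord0 subr0; exists x; rewrite mul1r subrr.
by case: iI.
Qed.

Lemma reglen_exp I a k n : is_ideal I -> reglen I [:: a] k -> reglen I [:: a ^+ n] (n * k).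
Proof.
move=> iI ra; elim: n => [|n IHn]; first by rewrite expr0; apply: reglen1.
by rewrite exprS mulSn; apply: reglen_prod.
Qed.

(** In a ring that is separated for the powers of [y], regularity may be checked
    modulo [y]: if [g * f] lies in [Q], then [g] is divisible by [y] modulo [Q],
    the quotient has the same property, and so [g] is divisible by all powers of
    [y]. *)
Lemma nzd_separated Q y f : is_ideal Q -> nzd y Q ->
  (forall g, (forall n, ideal_adj Q (y ^+ n) g) -> Q g) ->
  nzd f (ideal_adj Q y) -> nzd f Q.
Proof.
move=> iQ ny sep nf g gf; have [Q0 QD QM] := iQ.
apply: sep => n; elim: n => [|n [g' g'E]].
  by exists g; rewrite expr0 mul1r subrr.
have ne : nzd (y ^+ n) Q.
  elim: n {g' g'E} => [|n IH]; first by move=> h; rewrite expr0 mulr1.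
  by rewrite exprS; apply: nzd_prod.
have [r rE] : ideal_adj Q y g'.
  apply: nf; apply: ideal_adj_sub => //; apply: ne.
  have -> : g' * f * y ^+ n = g * f - f * (g - y ^+ n * g') by ring.
  by apply: idealB => //; apply: QM.
exists r; have -> : g - y ^+ n.+1 * r = (g - y ^+ n * g') + y ^+ n * (g' - y * r).
  by rewrite exprS; ring.
by apply: QD => //; apply: QM.
Qed.

Definition ideal_adjs I F := foldl (@ideal_adj R) I F.

Lemma reglen_colength I F k : reglen I F k -> colength (ideal_adjs I F) k.
Proof. by elim: F I => //= f F IH I [_ /IH]. Qed.

Lemma ideal_adjsE F : ideal_gen [set` F] = ideal_adjs [set 0] F.
Proof.
elim/last_ind: F => [|G g IH]; first exact: ideal_gen_nil.
by rewrite ideal_gen_rcons IH /ideal_adjs foldl_rcons.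
Qed.

Lemma reglen_regular F k : reglen [set 0] F k -> forall i, (i < size F)%N ->
  nzd F`_i (ideal_gen [set` take i F]).
Proof.
move=> rF i iF; rewrite ideal_adjsE.
elim: F i [set 0] rF iF => // f F IH [|i] I /= [nf rF] iF //.
exact: IH.
Qed.

End RegularLength.

Section SeriesSep.
Variables (n : nat) (K : fieldType).
Local Notation R := (mseries n K).

Lemma serX_exp0 (k : 'I_n) e (r : R) (m : 'X_{1..n}) : (m k < e)%N -> (serX K k ^+ e * r) m = 0.
Proof.
elim: e m => // e IH m; rewrite exprS -mulrA serXM ltnS => me.
case: ifPn => // mk; apply: IH.
by rewrite mnmBE mnm1E eqxx subn1; lia.
Qed.

Lemma xideal_separated T (k : 'I_n) (g : R) :
  (forall e, ideal_adj (xideal T) (serX K k ^+ e) g) -> xideal T g.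
Proof.
move=> h m hm; have [r gr] := h (m k).+1.
have := gr m hm; rewrite seriesDE seriesNE serX_exp0 // subr0; exact.
Qed.

Lemma colength_vars : colength (xideal predT : set R) 1.
Proof.
exists (fun _ => 1); split=> // [g _|c].
  exists (fun _ => g 0%MM); rewrite big_ord1 xidealT /= seriesDE seriesNE seriesZE.
  by rewrite series1E eqxx mulr1 subrr.
rewrite big_ord1 xidealT /= seriesZE series1E eqxx mulr1 => c0 i.
by rewrite ord1.
Qed.
End SeriesSep.

(** * A complete intersection with prescribed falls *)

Section Continuants.
Variable R : comNzRingType.
Implicit Types (y z : R) (k : nat -> nat).

(** Continuants: the polynomials for which Euclid's algorithm, applied to two
    consecutive ones, has all its quotients equal to [z] and splits off the power
    [y ^+ k i] from the [i]-th remainder. *)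
Fixpoint cont y z k i {struct i} : R :=
  match i with
  | 0 => 1
  | i'.+1 => match i' with
             | 0 => z
             | j.+1 => z * cont y z k i' + y ^+ k j * cont y z k j
             end
  end.

Lemma contSS y z k i :
  cont y z k i.+2 = z * cont y z k i.+1 + y ^+ k i * cont y z k i.
Proof. by []. Qed.

Lemma nat_ind2 (P : nat -> Prop) : P 0%N -> P 1%N ->
  (forall i, P i -> P i.+1 -> P i.+2) -> forall i, P i.
Proof.
move=> P0 P1 PS i; suff [] : P i /\ P i.+1 by [].
by elim: i => // i [Pi PSi]; split=> //; apply: PS.
Qed.

Lemma cont_mod y z k (J : set R) : is_ideal J -> J y -> (forall i, (0 < k i)%N) ->
  forall i, J (cont y z k i - z ^+ i).
Proof.
move=> iJ Jy k0; have [J0 JD JM] := iJ.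
apply: nat_ind2 => [|| i _ IH] /=; first by rewrite subrr.
  by rewrite expr1 subrr.
rewrite -/(cont y z k i.+1) (_ : _ - _ = z * (cont y z k i.+1 - z ^+ i.+1) +
   y ^+ k i * cont y z k i); last by rewrite !exprS; ring.
apply: JD; first exact: JM.
by apply: idealMr => //; rewrite -(prednK (k0 i)) exprS; apply: idealMr.
Qed.

End Continuants.

Lemma rmorph_cont (R S : comNzRingType) (phi : {rmorphism R -> S}) y z k i :
  phi (cont y z k i) = cont (phi y) (phi z) k i.
Proof.
elim/nat_ind2: i => [||i IH1 IH2]; first exact: rmorph1.
  by [].
by rewrite !contSS rmorphD !rmorphM rmorphXn IH1 IH2.
Qed.

Section TheIdeal.
Variable K : fieldType.
Local Notation R := (mseries 3 K).

Definition ix : 'I_3 := @Ordinal 3 0 isT.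
Definition iy : 'I_3 := @Ordinal 3 1 isT.
Definition iz : 'I_3 := @Ordinal 3 2 isT.
Local Notation x := (serX K ix).
Local Notation y := (serX K iy).
Local Notation z := (serX K iz).
Variables (k : nat -> nat) (D n r : nat).
Hypotheses (k0 : forall i, (0 < k i)%N) (n0 : (0 < n)%N).
Local Notation p := (cont y z k).

Local Notation T0 := (pred0 : pred 'I_3).
Local Notation Tx := (predU1 ix T0).
Local Notation Txy := (predU1 iy Tx).
Local Notation Ty := (predU1 iy T0).
Local Notation Tyz := (predU1 iz Ty).
Local Notation Q := (@xideal 3 K).

Let iQ T : is_ideal (Q T). Proof. exact: xideal_ideal. Qed.

Lemma ix_cases (j : 'I_3) : [\/ j = ix, j = iy | j = iz].
Proof.
case: j => -[|[|[|//]]] lt; [constructor 1|constructor 2|constructor 3]; exact: val_inj.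
Qed.

Let QT1 : Q (predU1 iz Txy) = Q predT.
Proof. by apply: xideal_ext => j; case: (ix_cases j) => ->. Qed.

Let QT2 : Q (predU1 ix Tyz) = Q predT.
Proof. by apply: xideal_ext => j; case: (ix_cases j) => ->. Qed.

Let rl_z : reglen (Q Txy) [:: z] 1.
Proof. by split; [apply: xideal_nzd|rewrite -xideal_adj QT1; apply: colength_vars]. Qed.

Let rl_x : reglen (Q Tyz) [:: x] 1.
Proof. by split; [apply: xideal_nzd|rewrite -xideal_adj QT2; apply: colength_vars]. Qed.

Let p_mod_xy i : Q Txy (p i - z ^+ i).
Proof. by apply: cont_mod => //; apply: xideal_in. Qed.

Let p_nzd_xy i : nzd (p i) (Q Txy).
Proof.
apply: (@nzd_congr _ _ _ (z ^+ i)) => //; first exact: ideal_sym (p_mod_xy i).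
by have [] := reglen_exp i (iQ _) rl_z.
Qed.

(** Modulo [x] and [y], [p i] is [z ^+ i], and [y] can be added back because power
    series are separated for the powers of [y]. *)
Let p_nzd_x i : nzd (p i) (Q Tx).
Proof.
apply: (@nzd_separated _ _ _ y) => //; first exact: xideal_nzd.
  exact: xideal_separated.
by rewrite -xideal_adj.
Qed.

Let rl_py i : reglen (Q Tx) [:: p i; y] i.
Proof.
apply: reglen_swap => //; split; first exact: xideal_nzd.
rewrite -xideal_adj; apply: (@reglen_congr _ _ _ (z ^+ i)) => //.
  exact: ideal_sym (p_mod_xy i).
by rewrite -[X in reglen _ _ X]muln1; apply: reglen_exp.
Qed.

Let rl_pyn i e : reglen (Q Tx) [:: p i; y ^+ e] (e * i).
Proof.
have [np ry] := rl_py i; split=> //; apply: reglen_exp => //.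
exact: ideal_adj_ideal.
Qed.

(** The length of [K[[y, z]] / (p_(i+1), p_i)], see [rl_pp]. *)
Definition cont_len i := (\sum_(j < i) k j * j.+1)%N.

Let rl_pyp i e m : reglen (Q Tx) [:: p i; p m] (cont_len m) ->
  reglen (Q Tx) [:: p i; y ^+ e * p m] (e * i + cont_len m).
Proof.
case: (rl_pyn i e) => np ry [_ rp]; split=> //; apply: reglen_prod => //.
exact: ideal_adj_ideal.
Qed.

(** A step of Euclid's algorithm: modulo [p_(i+1)], [p_(i+2)] is
    [y ^+ k i * p i]; the factor [y ^+ k i] contributes [k i * i.+1] and the factor
    [p i] the length of the step before. *)
Let rl_pp i : reglen (Q Tx) [:: p i.+1; p i] (cont_len i).
Proof.
elim: i => [|i IHi].
  rewrite /cont_len big_ord0; split; first exact: p_nzd_x.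
  by apply: reglen1; apply: ideal_adj_ideal.
apply: reglen_swap => //.
have -> : cont_len i.+1 = (k i * i.+1 + cont_len i)%N.
  by rewrite /cont_len big_ord_recr addnC.
case: (rl_pyp (k i) IHi) => np rp.
split=> //; apply: (@reglen_congr K R _ (y ^+ k i * p i) _ [::] _ _ _ rp).
  exact: ideal_adj_ideal.
exists (- z); have -> : y ^+ k i * p i - p i.+2 - p i.+1 * - z = 0 by rewrite contSS; ring.
by case: (iQ Tx).
Qed.

(** Write [M] for the matrix with rows [(0, 0)] and
    [(y^(k_D - 1) p_D, p_(D+1))]. The first two generators are, up to sign, the
    entries of the column [(x - M) (y, z)], and the third one is
    [q - det (x - M)] with [q = y^n p_(D+1) + z^r p_(D+2)]. *)
Definition fall_ideal : seq R :=
  [:: x * y; p D.+2 - x * z;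
      y ^+ n * p D.+1 + z ^+ r * p D.+2 + x * p D.+1 - x * x].

Let adj0 (j : 'I_3) : ideal_adj [set 0] (serX K j) = Q (predU1 j T0).
Proof. by rewrite xideal_adj -xideal0. Qed.

(** Modulo [x] there remain [p_(D+2)] and [y^n p_(D+1)]. *)
Let branch_x : reglen [set 0] (x :: behead fall_ideal) (n * D.+2 + cont_len D.+1).
Proof.
split; first by rewrite -xideal0; apply: xideal_nzd.
rewrite adj0; have := rl_pyp n (rl_pp D.+1) => -[np rp].
have Qxx : Q Tx x by apply: xideal_in.
have Qx c : Q Tx (x * c) by exact: (idealMr c (iQ Tx) Qxx).
have iJ := ideal_adj_ideal (p D.+2) (iQ Tx).
apply: (@reglen_congr _ _ _ (p D.+2)) => //.
  by have -> : p D.+2 - (p D.+2 - x * z) = x * z by ring.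
split=> //; apply: (@reglen_congr K R _ (y ^+ n * p D.+1) _ [::] _ iJ _ rp).
exists (- z ^+ r).
set P := p D.+2; set P' := p D.+1.
have -> : y ^+ n * P' - (y ^+ n * P' + z ^+ r * P + x * P' - x * x) - P * - z ^+ r =
  x * (x - P') by ring.
exact: Qx.
Qed.

Let u : R := z ^+ D.+1 - x.

Let rl_u : reglen (Q Ty) [:: u; z] 1.
Proof.
have ru : reglen (Q Tyz) [:: u] 1.
  apply: (@reglen_congr _ _ _ (- x)) => //; last exact: reglenN.
  rewrite /u exprS (_ : _ - _ = z * (- z ^+ D)); last by ring.
  have Qz : Q Tyz z by apply: xideal_in.
  exact: (idealMr _ (iQ Tyz) Qz).
have nu : nzd u (Q Ty).
  apply: (@nzd_separated _ _ _ z) => //; first exact: xideal_nzd.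
    exact: xideal_separated.
  by rewrite -xideal_adj; case: ru.
apply: reglen_swap => //; split; first exact: xideal_nzd.
by rewrite -xideal_adj.
Qed.

(** Modulo [y] the second generator is [z * u] up to sign. Modulo [z] there
    remains [x^2]; modulo [u], where [x] is [z^(D+1)], there remains
    [z^(r + D + 2)]. *)
Let branch_y : reglen [set 0] (y :: behead fall_ideal) (2 + (r + D.+2)).
Proof.
split; first by rewrite -xideal0; apply: xideal_nzd.
rewrite adj0.
have Qy : Q Ty y by apply: xideal_in.
have pE i : Q Ty (p i - z ^+ i) by exact: (cont_mod z (iQ Ty) Qy k0).
pose f3 := y ^+ n * p D.+1 + z ^+ r * p D.+2 + x * p D.+1 - x * x.
apply: (@reglen_congr K R _ (z * u) (p D.+2 - x * z) [:: f3]) => //.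
  rewrite /u (_ : _ - _ = - (p D.+2 - z ^+ D.+2)); first exact: (idealN (iQ Ty) (pE D.+2)).
  by move: (p D.+2) => P; rewrite !exprS; ring.
apply: (@reglen_prod _ _ (Q Ty) z u [:: f3]) => //.
  split; first exact: xideal_nzd.
  rewrite -xideal_adj; apply: (@reglen_congr _ _ _ (- (x * x))) => //; last first.
    apply: reglenN => //; rewrite -expr2; exact: (@reglen_exp _ _ _ _ 1 2).
  have Qyz : Q Tyz y by apply: xideal_in.
  have Qp i : Q Tyz (p i.+1).
    apply: (ideal_congr (iQ Tyz) (@cont_mod _ y z k _ (iQ Tyz) Qyz k0 i.+1)).
    have Qz : Q Tyz z by apply: xideal_in.
    by rewrite exprS; exact: (idealMr _ (iQ Tyz) Qz).
  rewrite (_ : _ - _ = - (y ^+ n * p D.+1 + z ^+ r * p D.+2 + x * p D.+1)); last first.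
    by rewrite /f3; move: (p D.+2) (p D.+1) => P P'; ring.
  have [q0 qD qM] := iQ Tyz; apply: (idealN (iQ Tyz)).
  apply: (qD); last exact: (qM _ _ (Qp _)).
  apply: (qD); last exact: (qM _ _ (Qp _)).
  by rewrite -(prednK n0) exprS -mulrA; exact: (idealMr _ (iQ Tyz) Qyz).
have [nu rz] := rl_u; split=> //.
have := reglen_exp (r + D.+2) (ideal_adj_ideal u (iQ Ty)) rz; rewrite muln1.
apply: (@reglen_congr K R _ _ _ [::]); first exact: ideal_adj_ideal.
exists (- x); rewrite (_ : _ - _ = - (y ^+ n * p D.+1 +
    z ^+ r * (p D.+2 - z ^+ D.+2) + x * (p D.+1 - z ^+ D.+1))); last first.
  by rewrite /f3 /u; move: (p D.+2) (p D.+1) => P P'; rewrite exprD !exprS; ring.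
have [q0 qD qM] := iQ Ty; apply: (idealN (iQ Ty)).
apply: (qD); last exact: (qM _ _ (pE _)).
apply: (qD); last exact: (qM _ _ (pE _)).
by rewrite -(prednK n0) exprS -mulrA; exact: (idealMr _ (iQ Ty) Qy).
Qed.

Lemma fall_ideal_reglen :
  reglen [set 0] fall_ideal (n * D.+2 + cont_len D.+1 + (2 + (r + D.+2))).
Proof. by apply: reglen_prod; [apply: is_ideal0|apply: branch_x|apply: branch_y]. Qed.

Lemma fall_ideal_const f : f \in fall_ideal -> f 0%MM = 0.
Proof.
have E := @xidealT 3 K; have iT := iQ predT; rewrite E in iT; have [t0 tD tM] := iT.
have X j : [set g : R | g 0%MM = 0] (serX K j) by rewrite -E; apply: xideal_in.
have Tp i : [set g : R | g 0%MM = 0] (p i.+1).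
  apply: (ideal_congr iT (cont_mod z iT (X iy) k0 i.+1)).
  by rewrite exprS; exact: (idealMr _ iT (X iz)).
rewrite !inE => /or3P[] /eqP ->; rewrite -[_ = 0]/([set g : R | g 0%MM = 0] _).
- exact: (idealMr _ iT (X ix)).
- exact: (idealB iT (Tp _) (idealMr _ iT (X ix))).
- apply: (idealB iT _ (idealMr _ iT (X ix))).
  apply: (tD); last exact: (tM _ _ (Tp _)).
  by apply: (tD); exact: (tM _ _ (Tp _)).
Qed.

End TheIdeal.

(** * The Hilbert function of this complete intersection *)

Lemma fd_artinian (K : fieldType) (A : comAlgType K) N :
  has_qdim (@setT A) [set 0] N -> is_artinian A.
Proof.
move=> H I iI Idec; pose B := fdalg H.
have /choice [W WP] : forall i, exists W : {vspace B}, forall x, (x \in W) <-> I i x.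
  move=> i; exact: (@subspace_vspace K B (I i) (ideal_subspace (iI i))).
have ex : exists d, `[< exists i, \dim (W i) = d >].
  by exists (\dim (W 0%N)); apply/asboolP; exists 0%N.
case: (ex_minnP ex) => d /asboolP [n dn] dmin.
have Imono i : (n <= i)%N -> I i `<=` I n.
  move=> /subnK <-; elim: (i - n)%N => // j IH; rewrite addSn.
  exact: subset_trans (Idec _) IH.
exists n => i ni; apply/seteqP; split; first exact: Imono.
have WW : (W i <= W n)%VS by apply/subvP => x /WP /(Imono _ ni) /WP.
have /eqP E : W i == W n.
  by rewrite eqEdim WW dn dmin //; apply/asboolP; exists i.
by move=> x /WP; rewrite -E => /WP.
Qed.

Section LocalQuotient.
Variables (K : fieldType) (n : nat) (A : comAlgType K).
Variables (phi : {lrmorphism mseries n K -> A}) (J : set (mseries n K)).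
Hypotheses (surj : forall a, exists g, phi g = a)
  (kerE : forall g, phi g = 0 <-> J g) (J0 : J `<=` [set g | g 0%MM = 0]).
Variable N : nat.
Hypothesis fdA : has_qdim (@setT A) [set 0] N.

Definition quot_max : set A := [set phi g | g in [set g : mseries n K | g 0%MM = 0]].

Lemma quot_max_ideal : is_ideal quot_max.
Proof.
have [z0 zD zM] := @xideal_ideal n K predT; rewrite xidealT in z0 zD zM.
split; first by exists 0; rewrite ?rmorph0.
  by move=> _ _ [x hx <-] [y hy <-]; exists (x + y); [apply: zD|rewrite rmorphD].
move=> a _ [x hx <-]; have [b <-] := surj a.
by exists (b * x); [apply: zM|rewrite rmorphM].
Qed.

(** Series with a nonzero constant term are units, so [quot_max] contains every
    proper ideal. *)
Lemma quot_local : artinian_local quot_max.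
Proof.
have m1 : ~ quot_max 1.
  move=> [g g0 gE]; have /J0 /= : J (1 - g).
    by apply/kerE; rewrite [LHS]rmorphB rmorph1 [X in _ - X](gE : phi g = 1) subrr.
  by rewrite seriesDE seriesNE g0 subr0 series1E eqxx => /eqP; rewrite oner_eq0.
have sub I : is_ideal I -> ~ I 1 -> I `<=` quot_max.
  move=> [I0 ID IM] I1 a; have [g <-] := surj a => Ig; exists g => //.
  have : [set g | I (phi g)] `<=` [set g | g 0%MM = 0].
    apply: proper_ideal_max; last by rewrite /= rmorph1.
    split=> [|x y /= mx my|b x /= mx]; first by rewrite /= rmorph0.
      by rewrite rmorphD; apply: ID.
    by rewrite rmorphM; apply: IM.
  by apply.
have mm : is_maximal_ideal quot_max.
  split=> //; first exact: quot_max_ideal.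
  by move=> I iI mI I1; apply/seteqP; split=> //; apply: sub.
split.
- exact: fd_artinian fdA.
- split=> // m' [im' m'1 max]; apply/esym; apply: max => //.
    exact: quot_max_ideal.
  exact: sub.
- move=> a; have [g <-] := surj a; exists (g 0%MM); exists (g - (g 0%MM)%:A).
    by rewrite /= seriesDE seriesNE seriesZE series1E eqxx mulr1 subrr.
  have pc : phi (g 0%MM)%:A = (g 0%MM)%:A by rewrite linearZZ rmorph1.
  by rewrite [LHS]rmorphB [X in _ - X]pc.
Qed.

End LocalQuotient.

(** The number of spanning elements bounds the Hilbert function from above in
    every degree, and the totals agree. *)
Lemma hilbert_of_spanning (K : fieldType) (A : comAlgType K) (m : set A) h s N :
  artinian_local m -> has_qdim (@setT A) [set 0] N ->
  (forall t, (s < t)%N -> h t = 0%N) -> (N = \sum_(t < s.+1) h t)%N ->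
  (forall t, exists E : seq A, [/\ size E = h t,
     forall i, (i < size E)%N -> ideal_pow m t E`_i &
     forall x, ideal_pow m t x -> exists c : 'I_(size E) -> K,
       ideal_pow m t.+1 (x - \sum_i c i *: E`_i)]) ->
  is_hilbert_function m h.
Proof.
move=> loc fdA hs NE span.
have sub t := ideal_subspace (ideal_pow_ideal m t).
have /choice [g gP] : forall t, exists d,
    (d <= h t)%N /\ has_qdim (ideal_pow m t) (ideal_pow m t.+1) d.
  move=> t; have [E [<- mE gE]] := span t.
  have [|d dk hd] := @qdim_span _ _ _ _ _ (fun i : 'I_(size E) => E`_i) (sub t.+1) _ gE.
    by move=> i; apply: mE.
  by exists d.
have hg : is_hilbert_function m g by move=> t; have [] := gP t.
have g0 t : (s < t)%N -> g t = 0%N.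
  by move=> st; have [+ _] := gP t; rewrite hs // leqn0 => /eqP.
have mn := hilbert_vanish loc hg (g0 _ (ltnSn s)).
have := hilbert_total hg mn (leq0n _); rewrite big_mkord => /(qdim_uniq (@subspace0 K A) fdA).
rewrite NE => /eqP; rewrite eq_sym => /eqP sumE.
have : (\sum_(t < s.+1) (h t - g t) = 0)%N.
  by rewrite sumnB => [|i _]; [rewrite sumE subnn|have [] := gP i].
move/eqP; rewrite sum_nat_eq0 => /forallP gh.
move=> t; have [gt ht] := gP t; rewrite (_ : h t = g t) //.
have [st|ts] := ltnP s t; first by rewrite hs // g0.
by have := gh (Ordinal (ts : (t < s.+1)%N)); rewrite implyTb /=; lia.
Qed.

Section Spanning.
Variables (K : fieldType) (A : comAlgType K) (m : set A) (x y z : A).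
Hypotheses (mi : is_ideal m) (mx : m x) (my : m y) (mz : m z).
Hypothesis mres : forall a : A, exists c : K, m (a - c%:A).
Hypothesis mgen : forall a, m a -> exists b c d, a = b * x + c * y + d * z.
Variables (k nb : nat -> nat) (D r : nat).
Hypotheses (k2 : forall i, (2 <= k i)%N)
  (nbk : forall i, (i <= D)%N -> nb i = (nb i.+1 + k i)%N)
  (nbr : (r < nb D.+1)%N) (nb0 : nb D.+2 = 0%N).
Local Notation P := (cont y z k).
Local Notation nu := (r + D.+2)%N.
Hypotheses (xy0 : x * y = 0) (xzE : x * z = P D.+2)
  (xxE : x * x = y ^+ nb D.+1 * P D.+1 + z ^+ r * P D.+2 + x * P D.+1).

(** In each degree [t], monomials are reduced to those with a smaller exponent of
    [z]: [low t b] is what may remain of [y ^+ (t - b) * z ^+ b]. For [e > t] the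
    truncated difference makes the generator [z ^+ e], of degree larger than
    [t]. *)
Definition low t b : set A :=
  ideal_gen [set y ^+ (t - e) * z ^+ e | e in [set e : nat | (e < b)%N]].

Let low_ideal t b : is_ideal (low t b). Proof. exact: ideal_gen_ideal. Qed.

Let low_in t b e : (e < b)%N -> low t b (y ^+ (t - e) * z ^+ e).
Proof. by move=> eb; apply: ideal_gen_in; exists e. Qed.

Let low_sub t b (J : set A) : is_ideal J ->
  (forall e, (e < b)%N -> J (y ^+ (t - e) * z ^+ e)) -> low t b `<=` J.
Proof. by move=> iJ h; apply: ideal_gen_sub => // _ [e /h + <-]. Qed.

Let low_mul t b c c' v : (b <= t.+1)%N -> low t b v ->
  low (t + c + c') (b + c') (y ^+ c * z ^+ c' * v).
Proof.
move=> bt; move: v; apply: low_sub.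
  have [l0 lD lM] := low_ideal (t + c + c') (b + c'); split=> /=.
  - by rewrite mulr0.
  - by move=> u v hu hv; rewrite mulrDr; apply: lD.
  - by move=> a v hv; rewrite mulrCA; apply: lM.
move=> e eb /=; rewrite mulrACA -!exprD.
have -> : (c + (t - e) = t + c + c' - (c' + e))%N by lia.
by apply: low_in; lia.
Qed.

Let low_le t b b' : (b <= b')%N -> low t b `<=` low t b'.
Proof. by move=> bb; apply: low_sub => // e eb; apply: low_in; lia. Qed.

Let low_deg t t' : (t <= t')%N -> low t' t'.+1 `<=` low t t.+1.
Proof.
move=> tt; apply: low_sub => // e et; have [_ _ lM] := low_ideal t t.+1.
have [le|lt] := leqP e t.
  have -> : (t' - e = (t' - t) + (t - e))%N by lia.
  by rewrite exprD -mulrA; apply: lM; apply: low_in.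
have -> : (e = (e - t) + t)%N by lia.
rewrite exprD mulrA; apply: lM; have := @low_in t t.+1 t (ltnSn t).
by rewrite subnn expr0 mul1r.
Qed.

(** As [k i >= 2], all terms of [P i] have degree at least [i], and [z ^+ i] is the
    only one without [y]. *)
Let P_lead i : low i i (P i - z ^+ i).
Proof.
elim/nat_ind2: i => [||i IH1 IH2].
- by rewrite /= expr0 subrr; case: (low_ideal 0 0).
- by rewrite /= expr1 subrr; case: (low_ideal 1 1).
have [_ lD _] := low_ideal i.+2 i.+2.
have -> : P i.+2 - z ^+ i.+2 = z * (P i.+1 - z ^+ i.+1) + y ^+ k i * P i.
  by rewrite contSS !exprS; ring.
apply: lD.
  have := @low_mul i.+1 i.+1 0 1 _ (leqnSn _) IH2.
  by rewrite expr0 mul1r expr1 addn0 !addn1.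
have h1 : low i i.+1 (P i).
  apply: (ideal_congr (low_ideal _ _) (low_le (leqnSn i) IH1)).
  by have := @low_in i i.+1 i (ltnSn i); rewrite subnn expr0 mul1r.
have h2 : low i.+2 i.+2 (y ^+ 2 * P i).
  apply: (@low_le _ i.+1) => //.
  have := @low_mul i i.+1 2 0 _ (leqnn _) h1.
  by rewrite expr0 mulr1 !addn0 addn2.
rewrite -(subnK (k2 i)) exprD -mulrA.
by case: (low_ideal i.+2 i.+2) => _ _; apply.
Qed.

Let P_low i : low i i.+1 (P i).
Proof.
apply: (ideal_congr (low_ideal _ _) (low_le (leqnSn i) (P_lead (i := i)))).
by have := @low_in i i.+1 i (ltnSn i); rewrite subnn expr0 mul1r.
Qed.

(** The relations satisfied by [y] and [z] alone: [yP_top], [yq] and [zq]. The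
    last two are the Cayley-Hamilton argument, applied to [y * (x * x)] and
    [z * (x * x)]. *)
Let yP_top : y * P D.+2 = 0. Proof. by rewrite -xzE mulrCA mulrA xy0 mul0r. Qed.

Let xP c : (0 < k c)%N -> x * P c.+2 = P D.+2 * P c.+1.
Proof.
move=> kc; rewrite contSS mulrDr mulrA xzE -(prednK kc) exprS.
by rewrite [x * (_ * _ * _)]mulrA mulrA xy0 !mul0r addr0.
Qed.

Let q : A := y ^+ nb D.+1 * P D.+1 + z ^+ r * P D.+2.

Let yq : y ^+ (nb D.+1).+1 * P D.+1 = 0.
Proof.
have E : y * (x * x) = y ^+ (nb D.+1).+1 * P D.+1 + z ^+ r * (y * P D.+2) +
    (x * y) * P D.+1.
  by rewrite xxE exprS; move: (P D.+2) (P D.+1) => p2 p1; ring.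
move: E; rewrite yP_top xy0 mul0r mulr0 !addr0 => <-.
by rewrite mulrA [y * x]mulrC xy0 mul0r.
Qed.

Let zq : z * q = 0.
Proof.
have k0 : (0 < k D)%N by apply: leq_trans (k2 D).
have E : z * (x * x) = z * q + (x * z) * P D.+1 by rewrite xxE /q; move: (P D.+2) (P D.+1) => p2 p1; ring.
apply: (addIr ((x * z) * P D.+1)); rewrite -E add0r.
by rewrite mulrA [z * x]mulrC xzE [P D.+2 * x]mulrC xP.
Qed.

(** Descending induction on [i]: [y ^+ k i * P i = P i.+2 - z * P i.+1], and both
    terms are killed by the next higher powers of [y], since
    [nb i = nb i.+1 + k i]. *)
Let yP i a : (i <= D.+2)%N -> (nb i < a)%N -> y ^+ a * P i = 0.
Proof.
move=> iD; suff h : y ^+ (nb i).+1 * P i = 0.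
  by move=> na; rewrite -(subnK na) exprD -mulrA h mulr0.
suff : forall j, (j <= D.+1)%N -> y ^+ (nb (D.+1 - j)).+1 * P (D.+1 - j) = 0 /\
    y ^+ (nb (D.+1 - j).+1).+1 * P (D.+1 - j).+1 = 0.
  move=> H; have [->|lt] := eqVneq i D.+2.
    by have [_] := H 0%N isT; rewrite subn0.
  by have [+ _] := H (D.+1 - i)%N (leq_subr _ _); rewrite subKn //; lia.
elim=> [_|j IHj jD]; first by rewrite subn0 yq nb0 expr1 yP_top.
have [h1 h2] := IHj (ltnW jD).
have E : (D.+1 - j = (D.+1 - j.+1).+1)%N by lia.
rewrite E in h1 h2; split=> //; set i0 := (D.+1 - j.+1)%N in h1 h2 *.
have i0D : (i0 <= D)%N by lia.
have nbi := nbk i0D.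
have nb2 : (nb i0.+2 <= nb i0.+1)%N.
  have [i1|i1] := leqP i0.+1 D; first by have := nbk i1; lia.
  have E0 : i0 = D by lia.
  by rewrite E0 nb0.
have -> : y ^+ (nb i0).+1 * P i0 = y ^+ (nb i0.+1 - nb i0.+2) * (y ^+ (nb i0.+2).+1 * P i0.+2)
    - z * (y ^+ (nb i0.+1).+1 * P i0.+1).
  have e : y ^+ (nb i0.+1 - nb i0.+2) * y ^+ (nb i0.+2).+1 = y ^+ (nb i0.+1).+1.
    by rewrite -exprD; congr (_ ^+ _); lia.
  by rewrite [in RHS]mulrA e nbi -addSn exprD contSS; ring.
by rewrite h1 h2 !mulr0 subrr.
Qed.

(** Multiplication by [x] kills the monomials divisible by [y] and takes [z ^+ t]
    to [z ^+ t.-1 * P D.+2], which has degree at least [t.+1]. *)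
Let x_low t : (0 < t)%N -> forall v, low t t.+1 v -> low t.+1 t.+2 (x * v).
Proof.
move=> t0; have [l0 lD lM] := low_ideal t.+1 t.+2; apply: low_sub.
  split=> [|u v hu hv|a v hv] /=; first by rewrite mulr0.
    by rewrite mulrDr; apply: lD.
  by rewrite mulrCA; apply: lM.
move=> e et /=; have [lt|le] := ltnP e t.
  have -> : (t - e = (t - e).-1.+1)%N by lia.
  by rewrite exprS !mulrA xy0 !mul0r.
have -> : e = t by lia.
rewrite subnn expr0 mul1r -(prednK t0) exprS mulrA xzE mulrC.
apply: (@low_deg _ (D.+2 + t.-1)); first by lia.
have := @low_mul D.+2 D.+3 0 t.-1 _ (leqnn _) (P_low (i := D.+2)).
by rewrite expr0 mul1r addn0.
Qed.

(** From degree 2 on, [x] is not needed: [x * y], [x * z] and [x * x] are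
    expressed by [y] and [z] in degree at least 2. *)
Let m2_low : ideal_pow m 2 `<=` low 2 3.
Proof.
have l2 := low_ideal 2 3; have [l0 lD lM] := l2.
have yy : low 2 3 (y * y) by have := @low_in 2 3 0 isT; rewrite expr0 mulr1.
have yz : low 2 3 (y * z) by have := @low_in 2 3 1 isT.
have zz : low 2 3 (z * z) by have := @low_in 2 3 2 isT; rewrite expr0 mul1r.
have xz : low 2 3 (x * z) by rewrite xzE; apply: (@low_deg 2 D.+2).
have xx : low 2 3 (x * x).
  rewrite xxE; apply: (lD); first apply: (lD).
  - apply: (@low_deg 2 (D.+1 + nb D.+1)); first by lia.
    have := @low_mul D.+1 D.+2 (nb D.+1) 0 _ (leqnn _) (P_low (i := D.+1)).
    rewrite expr0 mulr1 !addn0; apply: low_le; lia.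
  - by apply: (lM); apply: (@low_deg 2 D.+2).
  - by apply: (@low_deg 2 D.+2) => //; apply: x_low.
have prod a b : m a -> m b -> low 2 3 (a * b).
  move=> /mgen [a1 [a2 [a3 ->]]] /mgen [b1 [b2 [b3 ->]]].
  rewrite (_ : _ * _ = (a1 * b1) * (x * x) + (a1 * b2 + a2 * b1) * (x * y)
    + (a1 * b3 + a3 * b1) * (x * z) + (a2 * b2) * (y * y) + (a2 * b3 + a3 * b2) * (y * z)
    + (a3 * b3) * (z * z)); last by ring.
  rewrite xy0 mulr0.
  by apply: (lD); [apply: (lD); [apply: (lD); [apply: (lD); [apply: (lD)|]|]|]|]; rewrite ?mulr0 //; apply: (lM).
apply: ideal_gen_sub => // _ [a ma [b mb <-]]; apply: prod => //.
by rewrite -(ideal_pow1 mi).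
Qed.

Let m_low t : (2 <= t)%N -> ideal_pow m t `<=` low t t.+1.
Proof.
case: t => [|[|t]] // _; elim: t => [|t IHt]; first exact: m2_low.
have [l0 lD lM] := low_ideal t.+3 t.+4.
apply: ideal_gen_sub => // _ [a /mgen [b [c [d ->]]] [v /IHt lv <-]].
rewrite !mulrDl -!mulrA; apply: (lD); first apply: (lD); apply: lM.
- exact: x_low.
- have := @low_mul t.+2 t.+3 1 0 _ (leqnn _) lv.
  by rewrite expr0 mulr1 expr1 !addn0 addn1; apply: low_le.
- have := @low_mul t.+2 t.+3 0 1 _ (leqnn _) lv.
  by rewrite expr0 mul1r expr1 !addn0 !addn1.
Qed.

Let spanned (E : seq A) t (v : A) := exists c : 'I_(size E) -> K,
  ideal_pow m t.+1 (v - \sum_i c i *: E`_i).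

Let spanned_sub E t : is_subspace (spanned E t).
Proof.
have sm := ideal_subspace (ideal_pow_ideal m t.+1); split.
  exists (fun _ => 0); rewrite big1 ?subr0 ?(ideal_pow_ideal m t.+1).1; last by move=> i _; rewrite scale0r.
  by case: sm.
move=> a u v [c hc] [d hd]; exists (fun i => a * c i + d i).
have -> : a *: u + v - \sum_i (a * c i + d i) *: E`_i =
  a *: (u - \sum_i c i *: E`_i) + (v - \sum_i d i *: E`_i).
  under eq_bigr do rewrite scalerDl -scalerA.
  by rewrite big_split /= -scaler_sumr scalerBr opprD addrACA.
by case: sm => _; apply.
Qed.

Let spanned_mem E t v : v \in E -> spanned E t v.
Proof.
move=> vE; have iE : (index v E < size E)%N by rewrite index_mem.
exists (fun i => (i == Ordinal iE)%:R).
rewrite (bigD1 (Ordinal iE)) //= eqxx scale1r nth_index // big1 ?addr0 ?subrr.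
  by case: (ideal_pow_ideal m t.+1).
by move=> i /negPf ->; rewrite scale0r.
Qed.

Let spanned_mod E t v : ideal_pow m t.+1 v -> spanned E t v.
Proof.
move=> mv; exists (fun _ => 0); rewrite big1 ?subr0 // => i _.
by rewrite scale0r.
Qed.

(** Although [spanned] is only a subspace condition, this set is an ideal: modulo
    [m], elements of [A] are scalars. *)
Let good (E : seq A) t : set A := [set v | ideal_pow m t v /\ spanned E t v].

Let good_ideal E t : is_ideal (good E t).
Proof.
have [p0 pD pM] := ideal_pow_ideal m t; have sp := spanned_sub E t.
split; first by split; [exact: p0|case: sp].
  by move=> u v [mu su] [mv sv]; split; [apply: pD|apply: subspaceD].
move=> a v [mv sv]; split; first exact: pM.
have [c mc] := mres a; rewrite -[a](subrK c%:A) mulrDl mulr_algl.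
apply: subspaceD => //; last exact: subspaceZ.
by apply: spanned_mod; apply: ideal_powM.
Qed.

Let mon_pow t b : (b <= t)%N -> ideal_pow m t (y ^+ (t - b) * z ^+ b).
Proof.
have pw w : m w -> forall s u v, ideal_pow m s v -> ideal_pow m (u + s) (w ^+ u * v).
  move=> mw s u v mv; elim: u => [|u IHu]; first by rewrite expr0 mul1r.
  by rewrite exprS -mulrA addSn; apply: ideal_powM.
move=> bt; rewrite -{1}(subnK bt); apply: (pw) => //.
by rewrite -[X in ideal_pow m X]addn0 -[z ^+ b]mulr1; apply: (pw).
Qed.

(** The exponents of [z] in the monomials of degree [t] that cannot be
    reduced. *)
Definition std_exps (t : nat) : seq nat :=
  [seq b <- iota 0 D.+2 | (b < t <= b + nb b)%N] ++
  (if (t <= nu)%N then [:: t] else [::]).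

Definition std t := [seq y ^+ (t - b) * z ^+ b | b <- std_exps t].

Let std_good t b : (b <= t)%N -> b \in std_exps t -> good (std t) t (y ^+ (t - b) * z ^+ b).
Proof.
move=> bt bE; split; first exact: mon_pow.
by apply: spanned_mem; apply/mapP; exists b.
Qed.

(** A monomial that is not standard is the leading term, up to [low t b], of an
    element that vanishes: of [z ^+ (t - nu.+1) * (z * q)] for [b = t], of
    [y ^+ (t - b) * P b] for [b < D.+2], and of a multiple of [y * P D.+2] in
    between. *)
Let mon_good t b : (2 <= t)%N -> (b <= t)%N ->
  good (std t) t (y ^+ (t - b) * z ^+ b).
Proof.
move=> t2; have iG := good_ideal (std t) t.
elim/ltn_ind: b => b IH bt.
have lowG : low t b `<=` good (std t) t.
  by apply: low_sub => // e eb; apply: IH => //; lia.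
have [btE|bt'] := eqVneq b t.
  rewrite btE in IH lowG *; have [tn|nt] := leqP t nu.
    apply: std_good => //; rewrite mem_cat tn mem_head orbT //.
  apply: lowG; rewrite subnn expr0 mul1r.
  have -> : (t = (t - nu.+1) + nu.+1)%N by lia.
  rewrite exprD.
  (* z * q has the leading term z ^+ nu.+1; the condition on r ensures that
     y ^+ nb D.+1 * z * P D.+1 has at least the same degree *)
  suff h : low nu.+1 nu.+1 (z ^+ nu.+1).
    have := @low_mul nu.+1 nu.+1 0 (t - nu.+1) _ (leqnSn _) h.
    by rewrite expr0 mul1r addn0 addnC.
  have l1 := low_ideal nu.+1 nu.+1; have [l0 lD lM] := l1.
  have -> : z ^+ nu.+1 = z * q - (z ^+ r.+1 * (P D.+2 - z ^+ D.+2)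
      + y ^+ nb D.+1 * z * P D.+1).
    rewrite -addSn exprD /q !exprS; move: (P D.+2) (P D.+1) => p1 p2; ring.
  rewrite zq; apply: (idealB l1) => //; apply: (lD).
    have := @low_mul D.+2 D.+2 0 r.+1 _ (leqnSn _) (P_lead (i := D.+2)).
    by rewrite expr0 mul1r addn0 addnC addSn.
  rewrite -(subnK nbr) exprD -!mulrA; apply: (lM); rewrite mulrA.
  have := @low_mul D.+1 D.+2 r.+1 1 _ (leqnn _) (P_low (i := D.+1)).
  rewrite expr1 (_ : (D.+1 + r.+1 + 1 = nu.+1)%N); last by lia.
  by apply: low_le; lia.
have {}bt : (b < t)%N by rewrite ltn_neqAle bt'.
have [bD|Db] := ltnP b D.+2.
  have [tb|bt2] := leqP t (b + nb b).
    by apply: std_good; rewrite ?(ltnW bt) // mem_cat mem_filter bt tb mem_iota bD.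
  apply: lowG.
  have -> : y ^+ (t - b) * z ^+ b = y ^+ (t - b) * P b - y ^+ (t - b) * (P b - z ^+ b).
    by ring.
  rewrite yP; [|by lia|by lia]; rewrite sub0r; apply: (idealN (low_ideal _ _)).
  have := @low_mul b b (t - b) 0 _ (leqnSn _) (P_lead (i := b)).
  by rewrite expr0 mulr1 !addn0 subnKC // ltnW.
apply: lowG.
have -> : y ^+ (t - b) * z ^+ b = z ^+ (b - D.+2) * (y ^+ (t - b) * P D.+2) -
    y ^+ (t - b) * z ^+ (b - D.+2) * (P D.+2 - z ^+ D.+2).
  have e : z ^+ b = z ^+ (b - D.+2) * z ^+ D.+2 by rewrite -exprD subnK.
  by rewrite e; move: (P D.+2) => p1; ring.
rewrite yP ?nb0 ?subn_gt0 // mulr0 sub0r; apply: (idealN (low_ideal _ _)).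
have := @low_mul D.+2 D.+2 (t - b) (b - D.+2) _ (leqnSn _) (P_lead (i := D.+2)).
by rewrite (_ : (D.+2 + (t - b) + (b - D.+2) = t)%N) ?subnKC //; lia.
Qed.

(** The last summand is the contribution of [x]. *)
Definition fall_hilbert t : nat :=
  ((t <= nu) + \sum_(b < D.+2) (b < t <= b + nb b) + (t == 1))%N.

Lemma size_std t : (2 <= t)%N -> size (std t) = fall_hilbert t.
Proof.
move=> t2; rewrite size_map size_cat size_filter /fall_hilbert.
rewrite (_ : (t == 1%N) = false) ?addn0; last by lia.
rewrite addnC; congr (_ + _)%N; first by case: ifP.
rewrite -sum1_count -[iota 0 _]/(index_iota 0 D.+2) big_mkcond big_mkord /=.
by apply: eq_bigr => b _; case: ifP.
Qed.

Lemma fall_spanning t : exists E : seq A, [/\ size E = fall_hilbert t,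
  forall i, (i < size E)%N -> ideal_pow m t E`_i &
  forall v, ideal_pow m t v -> exists c : 'I_(size E) -> K,
    ideal_pow m t.+1 (v - \sum_i c i *: E`_i)].
Proof.
have nb1 : (0 < nb 0)%N by rewrite nbk //; have := k2 0; lia.
case: t => [|[|t]].
- exists [:: 1]; split=> //.
    by rewrite /fall_hilbert big1 // => b _; rewrite ltn0.
  move=> v _; have [c mc] := mres v; exists (fun _ => c).
  by rewrite big_ord1 ideal_pow1.
- exists [:: x; y; z]; split.
  + rewrite /fall_hilbert big_ord_recl big1 => [|b _] /=; last by [].
    by rewrite add0n nb1; lia.
  + by rewrite ideal_pow1 //; case=> [|[|[|]]].
  + move=> v; rewrite ideal_pow1 // => /mgen [a [b [c ->]]].
    have m1 w : m w -> ideal_pow m 1 w by rewrite ideal_pow1.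
    have sp := spanned_sub [:: x; y; z] 1.
    have mul a' w : m w -> w \in [:: x; y; z] -> spanned [:: x; y; z] 1 (a' * w).
      move=> mw wE; have [e me] := mres a'; rewrite -[a'](subrK e%:A) mulrDl mulr_algl.
      apply: subspaceD => //; last by apply: subspaceZ => //; apply: spanned_mem.
      by apply: spanned_mod; apply: ideal_powM => //; apply: m1.
    apply: (subspaceD sp); first apply: (subspaceD sp); apply: mul;
      by rewrite ?inE ?eqxx ?orbT.
- exists (std t.+2); split; first exact: size_std.
    move=> i iE; have /mapP [b bE ->] := mem_nth 0 iE; apply: mon_pow.
    move: bE; rewrite mem_cat mem_filter => /orP[/andP[/andP[bt _] _]|]; first exact: ltnW.
    by case: ifP => // _; rewrite inE => /eqP ->.
  move=> v /m_low lv.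
  have /(_ v (lv isT)) [] : low t.+2 t.+3 `<=` good (std t.+2) t.+2; last by [].
  by apply: low_sub => // e et; apply: mon_good.
Qed.

End Spanning.

Lemma sum_interval a b n : (b < n)%N -> (\sum_(t < n) (a < t <= b) = b - a)%N.
Proof.
suff -> : (\sum_(t < n) (a < t <= b) = minn n.-1 b - a)%N.
  by move=> bn; congr (_ - _)%N; apply/minn_idPr; lia.
elim: n => [|n IH]; first by rewrite big_ord0; lia.
by rewrite big_ord_recr /= IH; case: (ltnP a n); case: (leqP n b); lia.
Qed.

Lemma sum_lt n a : (\sum_(b < n) (b < a) = minn n a)%N.
Proof.
elim: n => [|n IH]; first by rewrite big_ord0 min0n.
by rewrite big_ord_recr /= IH; case: (ltnP n a); lia.
Qed.

Section FallAlgebra.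
Variable K : fieldType.
Variables (k nb : nat -> nat) (D r s : nat).
Hypotheses (k2 : forall i, (2 <= k i)%N)
  (nbk : forall i, (i <= D)%N -> nb i = (nb i.+1 + k i)%N)
  (nbr : (r < nb D.+1)%N) (nb0 : nb D.+2 = 0%N).
Hypotheses (s1 : (r + D.+2 <= s)%N) (s2 : forall b, (b < D.+2)%N -> (b + nb b <= s)%N).

(** Summation by parts, from [k i = nb i - nb i.+1]. *)
Lemma cont_len_sum j : (j <= D.+1)%N ->
  (nb j * j.+1 + cont_len k j = \sum_(b < j.+1) nb b)%N.
Proof.
elim: j => [|j IHj] jD; first by rewrite /cont_len big_ord0 big_ord1 muln1 addn0.
have lenS : cont_len k j.+1 = (cont_len k j + k j * j.+1)%N.
  by rewrite /cont_len big_ord_recr.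
have IH := IHj (ltnW jD); have nbj := nbk (jD : (j <= D)%N).
have sumS : (\sum_(b < j.+2) nb b = \sum_(b < j.+1) nb b + nb j.+1)%N.
  by rewrite big_ord_recr.
by rewrite sumS -IH lenS nbj; ring.
Qed.

Local Notation fh := (fall_hilbert nb D r).

Lemma fall_hilbert_sum : (\sum_(t < s.+1) fh t =
  nb D.+1 * D.+2 + cont_len k D.+1 + (2 + (r + D.+2)))%N.
Proof.
rewrite cont_len_sum // /fall_hilbert !big_split /= exchange_big /=.
have -> : (\sum_(t < s.+1) (t <= r + D.+2) = (r + D.+2).+1)%N.
  under eq_bigr do rewrite -ltnS.
  by rewrite sum_lt; apply/minn_idPr.
have -> : (\sum_(t < s.+1) (t == 1%N :> nat) = 1)%N.
  rewrite (eq_bigr (fun t : 'I_s.+1 => nat_of_bool (0 < t <= 1)%N)) ?sum_interval //; first by lia.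
  by move=> [[|[|t]]].
rewrite (eq_bigr (fun b : 'I_D.+2 => nb b)); first by lia.
by move=> b _; rewrite sum_interval ?addKn // ltnS; apply: s2.
Qed.

Lemma fall_hilbert_vanish t : (s < t)%N -> fh t = 0%N.
Proof.
move=> st; rewrite /fall_hilbert big1 => [|b _]; first by lia.
by have := s2 (ltn_ord b); lia.
Qed.

(** The quotient of [K[[x, y, z]]] by [fall_ideal]: its dimension is known from
    [fall_ideal_reglen] and its powers of the maximal ideal from
    [fall_spanning]. *)
Lemma fall_algebra : complete_intersection_sequence K fh.
Proof.
have k0 i : (0 < k i)%N by apply: leq_trans (k2 i).
have n0 : (0 < nb D.+1)%N by apply: leq_ltn_trans nbr.
pose F := fall_ideal K k D (nb D.+1) r.
have iF := ideal_gen_ideal [set` F].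
have F0 : ideal_gen [set` F] `<=` [set g | g 0%MM = 0].
  have iT := @xideal_ideal 3 K predT; rewrite xidealT in iT.
  by apply: ideal_gen_sub => // f /= /(fall_ideal_const k0).
have F1 : ~ ideal_gen [set` F] 1.
  by move/F0 => /=; rewrite series1E eqxx => /eqP; rewrite oner_eq0.
have rF := fall_ideal_reglen K D r k0 n0; rewrite -/F in rF.
have [A [phi [surj kerE]]] := quotient_algebra iF F1.
have fdA : has_qdim (@setT A) [set 0]
    (nb D.+1 * D.+2 + cont_len k D.+1 + (2 + (r + D.+2))).
  have := reglen_colength rF; rewrite -ideal_adjsE => -[e [_ ge ie]].
  exists (fun i => phi (e i)); split=> //.
    move=> a _; have [g <-] := surj a; have [c hc] := ge g Logic.I; exists c.
    have <- : phi (g - \sum_i c i *: e i) = phi g - \sum_i c i *: phi (e i).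
      by rewrite linearB linear_sum; congr (_ - _); apply: eq_bigr => i _; rewrite linearZZ.
    exact/kerE.
  move=> c hc; apply: ie; apply/kerE; rewrite linear_sum -[RHS]hc.
  by apply: eq_bigr => i _; rewrite linearZZ.
have loc := quot_local surj kerE F0 fdA.
exists A, (quot_max phi); split=> //.
  exists 3%N, phi, F; split=> //.
    by split=> // i iFs g; apply: (reglen_regular rF).
  by apply/seteqP; split=> g /kerE.
apply: (hilbert_of_spanning loc fdA fall_hilbert_vanish (esym fall_hilbert_sum)).
pose X j := phi (serX K j).
have kerF f : f \in F -> phi f = 0.
  by move=> fF; apply/kerE; apply: ideal_gen_in.
have iM := quot_max_ideal surj.
have mX j : quot_max phi (X j).
  exists (serX K j) => //; have := @xideal_in 3 K predT j isT; by rewrite xidealT.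
have PE i : phi (cont (serX K iy) (serX K iz) k i) = cont (X iy) (X iz) k i.
  exact: rmorph_cont.
apply: (@fall_spanning K A (quot_max phi) (X ix) (X iy) (X iz)) k2 nbk nbr nb0 _ _ _ => //.
- by case: loc.
- move=> a [g g0 <-].
  have : xideal (predU1 iz (predU1 iy (predU1 ix (pred0 : pred 'I_3)))) g.
    rewrite (@xideal_ext _ _ _ predT) ?xidealT // => j.
    by case: (ix_cases j) => ->.
  rewrite xideal_adj => -[g3]; rewrite xideal_adj => -[g2].
  rewrite xideal_adj => -[g1]; rewrite xideal0 => /= E.
  exists (phi g1), (phi g2), (phi g3); rewrite -!rmorphM -!rmorphD; congr (phi _).
  apply/eqP; rewrite -subr_eq0 -[X in _ == X]E; apply/eqP; ring.
- by rewrite /X -rmorphM; apply: kerF; rewrite mem_head.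
- apply/eqP; rewrite eq_sym -subr_eq0 /X -rmorphM -PE -rmorphB; apply/eqP/kerF.
  by rewrite !inE eqxx orbT.
- apply/eqP; rewrite eq_sym -subr_eq0 /X -!PE -!rmorphXn -!rmorphM -!rmorphD -rmorphB.
  by apply/eqP/kerF; rewrite !inE eqxx !orbT.
Qed.

End FallAlgebra.

(** In degrees [t >= nu], [h t] counts the [b < d] with [t <= e b], where [e b] is
    the last degree in which [h] exceeds [b]. The value [b = d - 1] belongs to the
    powers of [z] and the values [b < d - 1] to the other columns of the
    staircase, the column of [b] having [nb b] elements. Since all falls after
    [nu] are by one at most, [e b.+1 < e b] and so [nb b.+1 + 2 <= nb b]; a fall by
    two in degree [nu] means that [e (d - 2) = e (d - 1) = nu], which does no
    harm. *)
Lemma peak_falls_ci (K : fieldType) h s d nu : is_133_sequence h s ->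
  peak_falls h s d nu -> complete_intersection_sequence K h.
Proof.
move=> [[h0 _] h1 h2 hs hbig] [sh [f2 f1]]; have mono := shape_mono sh.
case: sh => d2 /andP[dn ns] rise flat [fall decr].
have hnu : h nu = d by apply: flat; rewrite dn leqnn.
have /choice [e eP] : forall b, exists e, (b < d)%N ->
    [/\ (nu <= e <= s)%N & forall t, (nu <= t)%N -> (t <= e)%N = (b < h t)%N].
  move=> b; have [bd|] := ltnP b d; last by exists 0%N.
  have ex : exists t, (nu <= t)%N && (b < h t)%N by exists nu; rewrite leqnn hnu.
  have bnd t : (nu <= t)%N && (b < h t)%N -> (t <= s)%N.
    by move=> /andP[_ bt]; rewrite leqNgt; apply/negP => /hbig E; rewrite E in bt.
  case: (ex_maxnP ex bnd) => e /andP[ne be] emax; exists e => _; split.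
    by rewrite ne bnd // ne be.
  move=> t nt; apply/idP/idP => [te|bt]; last by apply: emax; rewrite nt bt.
  by apply: leq_trans be _; apply: mono => //; lia.
pose D := (d - 3)%N; pose r := (nu - d.-1)%N.
pose nb b := if (b < D.+2)%N then (e b - b)%N else 0%N.
(* beyond D any value that is at least 2 will do *)
pose k i := if (i <= D)%N then (nb i - nb i.+1)%N else 2%N.
have nuE : (r + D.+2 = nu)%N by rewrite /r /D; lia.
have dE : (D.+2 = d.-1)%N by rewrite /D; lia.
have gap i : (i <= D)%N -> (nb i.+1 + 2 <= nb i)%N.
  move=> iD; rewrite /nb !ltnS iD (leq_trans iD (leqnSn _)).
  have [|/andP[en es] eQ] := eP i; first by lia.
  have [|/andP[en1 es1] eQ1] := eP i.+1; first by lia.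
  suff : (e i.+1 < e i)%N by lia.
  have h1e : (i.+1 < h (e i.+1))%N by rewrite -eQ1.
  rewrite eQ ?(leqW en1) //.
  have [E|ne] := eqVneq (e i.+1) nu; first by rewrite E; lia.
  have := f1 (e i.+1); lia.
have -> : h = fall_hilbert nb D r.
  apply/funext => t; rewrite /fall_hilbert nuE.
  have [t2|t2] := ltnP t 2.
    case: t t2 => [|[|//]] _; first by rewrite big1 ?h0.
    rewrite big_ord_recl big1 => [|b _] /=; last by [].
    have [|/andP[en es] _] := eP 0%N; first by lia.
    by rewrite /nb /= h1; lia.
  rewrite (_ : (t == 1%N) = false) ?addn0; last by lia.
  have [tn|nt] := leqP t nu.
    rewrite (eq_bigr (fun b : 'I_D.+2 => nat_of_bool (b < t)%N)) => [|b _].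
      rewrite sum_lt dE; have [td|td] := ltnP t d; first by rewrite rise ?t2 //; lia.
      by rewrite flat; lia.
    have bD := ltn_ord b; have [|/andP[en es] _] := eP b; first by lia.
    by rewrite /nb bD; congr nat_of_bool; lia.
  rewrite (eq_bigr (fun b : 'I_D.+2 => nat_of_bool (b < h t)%N)) => [|b _].
    rewrite sum_lt dE; have := mono nu.+1 t; lia.
  have bD := ltn_ord b; have [|/andP[en es] eQ] := eP b; first by lia.
  by rewrite /nb bD -eQ ?(ltnW nt) //; congr nat_of_bool; lia.
apply: (@fall_algebra K k nb D r s).
- by move=> i; rewrite /k; case: ifP => // iD; have := gap i iD; lia.
- by move=> i iD; rewrite /k iD; have := gap i iD; lia.
- rewrite /nb ltnSn; have [|/andP[en es] _] := eP D.+1; first by lia.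
  by rewrite /r; lia.
- by rewrite /nb ltnn.
- by rewrite nuE ltnW.
- move=> b bD; rewrite /nb bD; have [|/andP[en es] _] := eP b; lia.
Qed.

(** * The equivalence *)

Theorem theorem1 (K : fieldType) (h : nat -> nat) (s : nat)
    (h133 : is_133_sequence h s) :
  [/\ complete_intersection_sequence K h <-> gorenstein_sequence K h,
      gorenstein_sequence K h <->
        [\/ condition_I h, condition_II h s | condition_III h s] &
      condition_III h s ->
        exists d r : nat, [/\ d = seq_max h s, (4 <= d)%N & form_III h s d r]].
Proof.
have ci_gor : complete_intersection_sequence K h -> gorenstein_sequence K h.
  move=> [A [m [loc ci hf]]]; exists A, m; split=> //.
  exact: complete_intersection_gorenstein.
have cond_ci : [\/ condition_I h, condition_II h s | condition_III h s] ->
    complete_intersection_sequence K h.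
  by move=> /(conditions_peak_falls h133) [d [nu /(peak_falls_ci K h133)]].
have gor_cond : gorenstein_sequence K h ->
    [\/ condition_I h, condition_II h s | condition_III h s].
  move=> [A [m [loc gor hf]]].
  have [h3|h3] := leqP (h 3) 3; first by constructor 1.
  have [_ h1 h2 _ hbig] := h133.
  have h34 : h 3 = 4%N.
    by apply/eqP; rewrite eqn_leq h3 andbT; apply: (seq133_top h133 (i := 2)).
  have [j hj] := gorenstein_falls loc gor hf hbig h1 h2 h34.
  by case: (falls_conditions h133 h34 hj); [constructor 2|constructor 3].
split.
- by split=> // /gor_cond /cond_ci.
- by split=> // /cond_ci /ci_gor.
- exact: condition_III_form.
Qed.
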